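(* Let $K$ be a field and let $Q$ be the adjacency quiver of an ideal triangulation of a closed surface with exactly one puncture, viewed as a triangulation quiver $(Q,f)$. Then for any power series $p(x)\in xK[[x]]$ the potential $$-p(\omega)+\sum_{\alpha}\alpha\cdot f(\alpha)\cdot f^2(\alpha)$$ on $Q$ (where the sum runs over representatives $\alpha$ of the $f$-cycles and $\omega$ is the cycle $\omega_\beta$ for some $\beta\in Q_1$) is non-degenerate. In particular, the set of power series $$\{0\}\cup\{x^m : m \text{ is not divisible by the characteristic of } K\}$$ (with $m\ge1$) yields infinitely many non-degenerate potentials on $Q$ whose Jacobian algebras are pairwise non-isomorphic.
   Context: A closed surface with exactly one puncture is a compact, connected, oriented surface $S$ with empty boundary and one marked point. For an ideal triangulation $\tau$ (in the sense of Fomin-Shapiro-Thurston) of such a surface, the adjacency quiver $Q$ has the arcs of $\tau$ as vertices, and each triangle with sides $v_1,v_2,v_3$ in clockwise order contributes three arrows $\alpha\colon v_1\to v_2$, $\beta\colon v_2\to v_3$, $\gamma\colon v_3\to v_1$. Setting $f(\alpha)=\beta$, $f(\beta)=\gamma$, $f(\gamma)=\alpha$ for each triangle defines a permutation $f$ of the set $Q_1$ of arrows and makes $(Q,f)$ a triangulation quiver: at each vertex exactly two arrows start and exactly two end, $f(\alpha)$ starts where $\alpha$ ends, and $f^3=\mathrm{id}$. For an arrow $\alpha$, $\bar\alpha$ is the other arrow with the same starting vertex, and $g(\alpha)=\overline{f(\alpha)}$; $\omega_\beta=\beta\, g(\beta)\cdots g^{n_\beta-1}(\beta)$ where $n_\beta$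 is the length of the $g$-cycle of $\beta$ (paths are written left to right). Here $g$ has a single cycle, so the $\omega_\beta$ agree up to cyclic rotation. Potentials (possibly infinite combinations of cycles in the completed path algebra $\widehat{KQ}$, up to cyclic equivalence), Jacobian algebras (quotient of $\widehat{KQ}$ by the closure of the ideal generated by the cyclic derivatives), mutations of quivers with potentials and non-degeneracy (every finite sequence of mutations of the quiver with potential, at vertices, yields a quiver without 2-cycles) are in the sense of Derksen-Weyman-Zelevinsky. *)

(* Defs.v *)
From HB Require Import structures.
From mathcomp Require Import all_boot all_order all_algebra.
From mathcomp Require Import generic_quotient ring_quotient.
From mathcomp Require Import boolp classical_sets functions cardinality.

Set Implicit Arguments.
Unset Strict Implicit.
Unset Printing Implicit Defensive.

Import GRing.Theory.
Local Open Scope ring_scope.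
Local Open Scope quotient_scope.

Record quiver (V : finType) := Quiver {
  arrow : finType;
  src : arrow -> V;
  tgt : arrow -> V
}.
Arguments src {V q}.
Arguments tgt {V q}.

(* Arrows in a list are composed from left to right; the vertex is the start
   of the path, so that (v, [::]) is the trivial path at v. *)
Section Paths.
Variables (V : finType) (Q : quiver V).

Definition composable : rel (arrow Q) := [rel a b | tgt a == src b].

Definition is_path (w : V * seq (arrow Q)) : bool :=
  all (fun a => src a == w.1) (take 1 w.2) && sorted composable w.2.

Definition qpath := {w : V * seq (arrow Q) | is_path w}.

Definition pstart (p : qpath) : V := (val p).1.
Definition parrows (p : qpath) : seq (arrow Q) := (val p).2.
Definition plength (p : qpath) : nat := size (parrows p).

Definition word_end (v : V) (s : seq (arrow Q)) : V :=
  last v [seq tgt a | a <- s].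
Definition pend (p : qpath) : V := word_end (pstart p) (parrows p).

Definition is_cycle (p : qpath) : bool := (0 < plength p)%N && (pend p == pstart p).

Lemma ptake_subproof (i : nat) (p : qpath) :
  is_path (pstart p, take i (parrows p)).
Proof.
case: p => -[v s] hp; rewrite /is_path /pstart /parrows /=.
case/andP: (hp) => /= h1 h2 {hp}.
apply/andP; split; last exact: take_sorted.
by case: s i h1 {h2} => [|a s] [|i] /=; rewrite ?take0.
Qed.

Definition ptake (i : nat) (p : qpath) : qpath :=
  exist is_path (pstart p, take i (parrows p)) (ptake_subproof i p).

Lemma pdrop_subproof (i : nat) (p : qpath) :
  is_path (pend (ptake i p), drop i (parrows p)).
Proof.
case: p => -[v s] hp; case/andP: (hp) => /= h1 h2.
rewrite /is_path /pend /word_end /pstart /parrows /=.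
apply/andP; split; last exact: drop_sorted.
rewrite /pstart /parrows /=; move: h1 h2; clear hp.
elim: i v s => [|i IH] v [|a s] //= h1 h2.
apply: IH; last exact: path_sorted h2.
by case: s h2 {h1} => [|b s] //= /andP[/eqP -> _]; rewrite take0 /= eqxx.
Qed.

Definition pdrop (i : nat) (p : qpath) : qpath :=
  exist is_path (pend (ptake i p), drop i (parrows p)) (pdrop_subproof i p).

Lemma plength_take i p : plength (ptake i p) = minn i (plength p).
Proof. by rewrite /plength /parrows /= size_take_min. Qed.

Lemma plength_drop i p : plength (pdrop i p) = (plength p - i)%N.
Proof. by rewrite /plength /parrows /= size_drop. Qed.

Lemma ptake_size p : ptake (plength p) p = p.
Proof.
by apply: val_inj; rewrite /= /plength take_size; case: p => -[].
Qed.

Lemma pdrop0 p : pdrop 0 p = p.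
Proof.
by apply: val_inj; rewrite /= /pend /word_end /pstart /parrows /= take0 drop0;
   case: p => -[].
Qed.

Lemma ptake_take i j p : (i <= j)%N -> ptake i (ptake j p) = ptake i p.
Proof.
by move=> ij; apply: val_inj; rewrite /= /parrows /= take_takel.
Qed.

Lemma pdrop_drop i j p : pdrop j (pdrop i p) = pdrop (i + j) p.
Proof.
apply: val_inj; case: p => -[v s] hp /=.
rewrite /parrows /= drop_drop [(j + i)%N]addnC; congr pair.
rewrite /pend /word_end /pstart /parrows /=.
by rewrite /pend /word_end /pstart /parrows /= -last_cat -map_cat -takeD.
Qed.

Lemma ptake_drop i j p : ptake j (pdrop i p) = pdrop i (ptake (i + j) p).
Proof.
apply: val_inj; case: p => -[v s] hp /=.
rewrite /parrows /= take_drop [(j + i)%N]addnC; congr pair.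
rewrite /pend /word_end /pstart /parrows /=.
by rewrite /pend /word_end /pstart /parrows /= take_takel ?leq_addr.
Qed.

End Paths.

(* Since Q is finite, the completed path algebra is the product over all paths
   p of the lines K p: its elements are arbitrary families of coefficients. *)
Definition cpath_alg (K : fieldType) (V : finType) (Q : quiver V) : Type :=
  qpath Q -> K.

Section CompletedPathAlgebra.
Variables (K : fieldType) (V : finType) (Q : quiver V).
Notation A := (cpath_alg K Q).

HB.instance Definition _ := GRing.Lmodule.copy A (qpath Q -> K^o).

Definition cpa_one : A := fun p => (plength p == 0%N)%:R.
Definition cpa_mul (x y : A) : A :=
  fun p => \sum_(i < (plength p).+1) x (ptake i p) * y (pdrop i p).

Lemma cpa_mulA : associative cpa_mul.
Proof.
move=> x y z; apply/funext => p; rewrite /cpa_mul.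
set n := plength p.
transitivity (\sum_(0 <= i < n.+1) \sum_(0 <= k < n.+1 | (i <= k)%N)
    x (ptake i p) * y (pdrop i (ptake k p)) * z (pdrop k p)).
  rewrite big_mkord; apply: eq_bigr => i _.
  rewrite big_distrr /= plength_drop -/n -subSn -1?ltnS //.
  rewrite -(big_mkord xpredT (fun j => x (ptake i p) *
    (y (ptake j (pdrop i p)) * z (pdrop j (pdrop i p))))).
  rewrite [RHS](@big_cat_nat _ _ _ i) //=; last exact: ltnW.
  rewrite [X in _ = X + _]big_nat_cond [X in _ = X + _]big_pred0 ?add0r; last first.
    by move=> k /=; case: (leqP i k); rewrite ?andbF.
  rewrite [RHS]big_nat_cond [RHS](eq_bigl
    (fun k => (i <= k < n.+1)%N && true)); last first.
    by move=> k; case: (leqP i k) => h; rewrite ?andbF ?andbT.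
  rewrite -[RHS]big_nat_cond -[in RHS](add0n i) big_addn; apply: eq_bigr => j _.
  by rewrite ptake_drop pdrop_drop addnC mulrA.
rewrite (exchange_big_dep_nat xpredT) //= big_mkord; apply: eq_bigr => k _.
rewrite big_distrl /= plength_take -/n (minn_idPl _) -1?ltnS //.
rewrite -(big_mkord xpredT (fun i => x (ptake i (ptake k p)) *
    y (pdrop i (ptake k p)) * z (pdrop k p))).
rewrite [RHS](big_nat_widen _ _ n.+1) //; apply: eq_big => [i|i].
  by rewrite ltnS.
by move=> ik; rewrite ptake_take.
Qed.

Lemma cpa_mul1 : left_id cpa_one cpa_mul.
Proof.
move=> x; apply/funext => p; rewrite /cpa_mul big_ord_recl /= pdrop0.
rewrite /cpa_one plength_take min0n eqxx mul1r big1 ?addr0 // => i _.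
by rewrite plength_take /bump /= minnC (minn_idPr _) ?mul0r // ltn_ord.
Qed.

Lemma cpa_mulr1 : right_id cpa_one cpa_mul.
Proof.
move=> x; apply/funext => p; rewrite /cpa_mul big_ord_recr /= ptake_size.
rewrite /cpa_one plength_drop subnn eqxx mulr1 big1 ?add0r // => i _.
by rewrite plength_drop subn_eq0 leqNgt ltn_ord mulr0.
Qed.

Lemma cpa_addE (x y : A) p : (x + y) p = x p + y p. Proof. by []. Qed.

Lemma cpa_mulDl : left_distributive cpa_mul +%R.
Proof.
move=> x y z; apply/funext => p; rewrite cpa_addE /cpa_mul -big_split /=.
by apply: eq_bigr => i _; rewrite cpa_addE mulrDl.
Qed.

Lemma cpa_mulDr : right_distributive cpa_mul +%R.
Proof.
move=> x y z; apply/funext => p; rewrite cpa_addE /cpa_mul -big_split /=.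
by apply: eq_bigr => i _; rewrite cpa_addE mulrDr.
Qed.

HB.instance Definition _ := GRing.Zmodule_isPzRing.Build A
  cpa_mulA cpa_mul1 cpa_mulr1 cpa_mulDl cpa_mulDr.

Lemma cpa_mulE (x y : A) p :
  (x * y) p = \sum_(i < (plength p).+1) x (ptake i p) * y (pdrop i p).
Proof. by []. Qed.

Lemma cpa_scalerAl (c : K) (x y : A) : c *: (x * y) = (c *: x) * y.
Proof.
apply/funext => p; transitivity (c * (x * y) p) => //.
rewrite !cpa_mulE big_distrr /=; apply: eq_bigr => i _.
exact: mulrA.
Qed.

Lemma cpa_scalerAr (c : K) (x y : A) : c *: (x * y) = x * (c *: y).
Proof.
apply/funext => p; transitivity (c * (x * y) p) => //.
rewrite !cpa_mulE big_distrr /=; apply: eq_bigr => i _.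
exact: mulrCA.
Qed.

Definition idem (v : V) : A := fun p => (val p == (v, [::]))%:R.
Definition arr (a : arrow Q) : A := fun p => (val p == (src a, [:: a]))%:R.

Definition coef (x : A) (w : V * seq (arrow Q)) : K := oapp x 0 (insub w).

Local Open Scope classical_set_scope.

(* Closure for the topology in which the d-th powers of the arrow ideal, i.e.
   the families vanishing on all paths of length < d, are the basic
   neighbourhoods of 0. *)
Definition madic_closure (X : set A) : set A :=
  [set x | forall d, exists2 y, X y & forall p, (plength p < d)%N -> x p = y p].

Definition ideal_gen (G : set A) : set A :=
  [set x | exists (n : nat) (u v g : 'I_n -> A),
     (forall i, G (g i)) /\ x = \sum_(i < n) u i * g i * v i].

Definition lin_span (G : set A) : set A :=
  [set x | exists (n : nat) (c : 'I_n -> K) (g : 'I_n -> A),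
     (forall i, G (g i)) /\ x = \sum_(i < n) c i *: g i].

Definition is_potential (S : A) : Prop := forall p, S p != 0 -> is_cycle p.

(* The differences a_1 a_2 ... a_d - a_2 ... a_d a_1, for a cycle a_1 ... a_d *)
Definition rotations : set A :=
  [set x | exists2 p : qpath Q, is_cycle p &
     x = \prod_(a <- parrows p) arr a - \prod_(a <- rot 1 (parrows p)) arr a].

Definition cyc_equiv (S S' : A) : Prop :=
  madic_closure (lin_span rotations) (S - S').

(* Coefficientwise form of
     d_a (a_1 ... a_d) = sum_(i | a_i = a) a_(i+1) ... a_d a_1 ... a_(i-1) :
   a factorization p = u v contributes the coefficient in S of v a u.
   It is meant for potentials S; then only the paths p from tgt a to src a
   have a nonzero coefficient. *)
Definition cyc_deriv (a : arrow Q) (S : A) : A :=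
  fun p => \sum_(i < (plength p).+1)
    coef S (pend (ptake i p), drop i (parrows p) ++ a :: take i (parrows p)).

Definition jacobian_ideal (S : A) : set A :=
  madic_closure (ideal_gen (range (cyc_deriv^~ S))).

Definition trivial_qp (S : A) : Prop :=
  (forall p, S p != 0 -> plength p = 2%N) /\
  forall b, lin_span (range (cyc_deriv^~ S)) (arr b).

(* The trivial part, spanned by the derivatives of the degree 2 component of S,
   is zero. *)
Definition reduced_qp (S : A) : Prop :=
  forall a p, plength p = 1%N -> cyc_deriv a S p = 0.

(* The value at x of the power series with coefficients p; it is meant for x
   without components of length 0, so that x ^+ m lives in lengths >= m. *)
Definition series_eval (p : nat -> K) (x : A) : A :=
  fun w => \sum_(m < (plength w).+1) p m * (x ^+ m) w.

End CompletedPathAlgebra.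

Arguments idem K {V} Q v _.
Arguments arr K {V Q} a _.

Section JacobianAlgebra.
Variables (K : fieldType) (V : finType) (Q : quiver V) (S : cpath_alg K Q).
Notation A := (cpath_alg K Q).

Definition jac_mem : {pred A} := fun x => `[< jacobian_ideal S x >].

Lemma ideal_gen0 (G : set A) : ideal_gen G 0.
Proof.
exists 0%N, (fun=> 0), (fun=> 0), (fun=> 0); split; first by case.
by rewrite big_ord0.
Qed.

Lemma ideal_genD (G : set A) x y :
  ideal_gen G x -> ideal_gen G y -> ideal_gen G (x + y).
Proof.
move=> [n [u [v [g [Gg ->]]]]] [n' [u' [v' [g' [Gg' ->]]]]].
pose cmb (f : 'I_n -> A) (f' : 'I_n' -> A) (i : 'I_(n + n')) :=
  match fintype.split i with inl j => f j | inr j => f' j end.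
exists (n + n')%N, (cmb u u'), (cmb v v'), (cmb g g'); split.
  by move=> i; rewrite /cmb; case: fintype.split.
rewrite big_split_ord /=; congr (_ + _); apply: eq_bigr => i _; rewrite /cmb.
  by rewrite (unsplitK (inl i)).
by rewrite (unsplitK (inr i)).
Qed.

Lemma ideal_genMl (G : set A) z x : ideal_gen G x -> ideal_gen G (z * x).
Proof.
move=> [n [u [v [g [Gg ->]]]]]; exists n, (fun i => z * u i), v, g; split=> //.
by rewrite big_distrr /=; apply: eq_bigr => i _; rewrite !mulrA.
Qed.

Lemma ideal_genMr (G : set A) z x : ideal_gen G x -> ideal_gen G (x * z).
Proof.
move=> [n [u [v [g [Gg ->]]]]]; exists n, u, (fun i => v i * z), g; split=> //.
by rewrite big_distrl /=; apply: eq_bigr => i _; rewrite !mulrA.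
Qed.

Lemma jac_memD x y : jac_mem x -> jac_mem y -> jac_mem (x + y).
Proof.
move=> /asboolP hx /asboolP hy; apply/asboolP => d.
have [x' Ix ex] := hx d; have [y' Iy ey] := hy d.
exists (x' + y'); first exact: ideal_genD.
by move=> p dp; rewrite cpa_addE ex // ey.
Qed.

Lemma jac_memMl z x : jac_mem x -> jac_mem (z * x).
Proof.
move=> /asboolP hx; apply/asboolP => d; have [x' Ix ex] := hx d.
exists (z * x'); first exact: ideal_genMl.
move=> p dp; rewrite !cpa_mulE; apply: eq_bigr => i _; rewrite ex //.
by rewrite plength_drop (leq_ltn_trans (leq_subr _ _)).
Qed.

Lemma jac_memMr z x : jac_mem x -> jac_mem (x * z).
Proof.
move=> /asboolP hx; apply/asboolP => d; have [x' Ix ex] := hx d.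
exists (x' * z); first exact: ideal_genMr.
move=> p dp; rewrite !cpa_mulE; apply: eq_bigr => i _; rewrite ex //.
by rewrite plength_take (leq_ltn_trans (geq_minr _ _)).
Qed.

Lemma jac_mem_zmod : zmod_closed jac_mem.
Proof.
split; first by apply/asboolP => d; exists 0 => //; exact: ideal_gen0.
move=> x y hx hy; apply: jac_memD => //; rewrite -mulN1r.
exact: jac_memMl.
Qed.

HB.instance Definition _ := GRing.isZmodClosed.Build A jac_mem jac_mem_zmod.

Lemma jac_memZ c x : jac_mem x -> jac_mem (c *: x).
Proof. by move=> hx; rewrite -[x]mul1r cpa_scalerAl; exact: jac_memMl. Qed.

Definition jacobian_algebra : Type := {ideal_quot (jac_mem : zmodClosed A)}.
Notation J := jacobian_algebra.

HB.instance Definition _ := Choice.copy J {ideal_quot (jac_mem : zmodClosed A)}.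
HB.instance Definition _ := EqQuotient.copy J {ideal_quot (jac_mem : zmodClosed A)}.
HB.instance Definition _ := GRing.Zmodule.copy J {ideal_quot (jac_mem : zmodClosed A)}.

Lemma jac_piE (x y : A) : reflect (\pi_J x = \pi_J y) (jac_mem (x - y)).
Proof. by apply: (iffP idP) => [h|/eqP]; [apply/eqP|]; rewrite piE. Qed.

Definition jac_one : J := \pi_J 1.
Definition jac_mul (x y : J) : J := \pi_J (repr x * repr y).
Definition jac_scale (c : K) (x : J) : J := \pi_J (c *: repr x).

Lemma jac_piD x y : \pi_J (x + y) = \pi_J x + \pi_J y.
Proof. by rewrite piE. Qed.

Lemma jac_repr x : jac_mem (repr (\pi_J x) - x).
Proof. by apply/jac_piE; rewrite reprK. Qed.

Lemma jac_piM x y : jac_mul (\pi_J x) (\pi_J y) = \pi_J (x * y).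
Proof.
apply/jac_piE; set x' := repr _; set y' := repr _.
rewrite -[x' * y'](addrNK (x * y')) -mulrBl -addrA -mulrBr.
by apply: jac_memD; [apply: jac_memMr | apply: jac_memMl]; exact: jac_repr.
Qed.

Lemma jac_piZ c x : jac_scale c (\pi_J x) = \pi_J (c *: x).
Proof. by apply/jac_piE; rewrite -scalerBr; exact/jac_memZ/jac_repr. Qed.

Lemma jac_ind (P : J -> Prop) : (forall x, P (\pi_J x)) -> forall x, P x.
Proof. by move=> h x; rewrite -[x]reprK. Qed.

Lemma jac_mulA : associative jac_mul.
Proof.
elim/jac_ind=> x; elim/jac_ind=> y; elim/jac_ind=> z.
by rewrite !jac_piM mulrA.
Qed.

Lemma jac_mul1 : left_id jac_one jac_mul.
Proof. by elim/jac_ind=> x; rewrite jac_piM mul1r. Qed.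

Lemma jac_mulr1 : right_id jac_one jac_mul.
Proof. by elim/jac_ind=> x; rewrite jac_piM mulr1. Qed.

Lemma jac_mulDl : left_distributive jac_mul +%R.
Proof.
elim/jac_ind=> x; elim/jac_ind=> y; elim/jac_ind=> z.
by rewrite -jac_piD !jac_piM -jac_piD mulrDl.
Qed.

Lemma jac_mulDr : right_distributive jac_mul +%R.
Proof.
elim/jac_ind=> x; elim/jac_ind=> y; elim/jac_ind=> z.
by rewrite -jac_piD !jac_piM -jac_piD mulrDr.
Qed.

HB.instance Definition _ := GRing.Zmodule_isPzRing.Build J
  jac_mulA jac_mul1 jac_mulr1 jac_mulDl jac_mulDr.

Lemma jac_scalerA c d x : jac_scale c (jac_scale d x) = jac_scale (c * d) x.
Proof. by elim/jac_ind: x => x; rewrite !jac_piZ scalerA. Qed.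

Lemma jac_scale1 : left_id 1 jac_scale.
Proof. by elim/jac_ind=> x; rewrite jac_piZ scale1r. Qed.

Lemma jac_scalerDr : right_distributive jac_scale +%R.
Proof.
move=> c; elim/jac_ind=> x; elim/jac_ind=> y.
by rewrite -jac_piD !jac_piZ -jac_piD scalerDr.
Qed.

Lemma jac_scalerDl x : {morph jac_scale^~ x : c d / c + d >-> c + d}.
Proof.
by elim/jac_ind: x => x c d; rewrite !jac_piZ -jac_piD scalerDl.
Qed.

HB.instance Definition _ := GRing.Zmodule_isLmodule.Build K J
  jac_scalerA jac_scale1 jac_scalerDr jac_scalerDl.

End JacobianAlgebra.


(* Isomorphisms of K-algebras are scalable ring isomorphisms. The structures
   lalgType and lrmorphism are not used because they require 1 != 0, which can
   fail for the quotients above (when a derivative of S is invertible). *)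
Definition jacobian_iso (K : fieldType) (V V' : finType)
    (Q : quiver V) (Q' : quiver V')
    (S : cpath_alg K Q) (S' : cpath_alg K Q') : Prop :=
  exists f : {rmorphism jacobian_algebra S -> jacobian_algebra S'},
    bijective f /\ scalable f.

Definition right_equiv (K : fieldType) (V : finType) (Q Q' : quiver V)
    (S : cpath_alg K Q) (S' : cpath_alg K Q') : Prop :=
  exists f : {rmorphism cpath_alg K Q -> cpath_alg K Q'},
    [/\ bijective f, scalable f, forall v, f (idem K Q v) = idem K Q' v
      & cyc_equiv (f S) S'].

(* Given for each arrow of Q' either a word in the arrows of Q or nothing,
   [relabel h x] has as coefficient at a path of Q' that of x at the word
   obtained by expanding all arrows, and 0 if some arrow has no expansion. *)
Section Relabel.
Variables (K : fieldType) (V : finType) (Q Q' : quiver V).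
Variable h : arrow Q' -> option (seq (arrow Q)).

Definition expand (s : seq (arrow Q')) : option (seq (arrow Q)) :=
  foldr (fun b o => if h b is Some u then omap (cat u) o else None)
    (Some [::]) s.

Definition relabel (x : cpath_alg K Q) : cpath_alg K Q' :=
  fun p => oapp (fun s => coef x (pstart p, s)) 0 (expand (parrows p)).

End Relabel.

Section DirectSum.
Variables (K : fieldType) (V : finType) (Q Q' : quiver V).

Definition dsum_quiver : quiver V :=
  @Quiver V (arrow Q + arrow Q')%type
    (fun c => match c with inl a => src a | inr b => src b end)
    (fun c => match c with inl a => tgt a | inr b => tgt b end).

Definition dsum_pot (S : cpath_alg K Q) (S' : cpath_alg K Q') :
    cpath_alg K dsum_quiver :=
  @relabel K V Q dsum_quiver (fun c => if c is inl a then Some [:: a] else None) S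
  + @relabel K V Q' dsum_quiver (fun c => if c is inr b then Some [:: b] else None) S'.

End DirectSum.

Section Mutation.
Variables (K : fieldType) (V : finType).

(* Taking b = a, this also excludes loops. *)
Definition two_acyclic (Q : quiver V) : Prop :=
  forall a b : arrow Q, ~ (tgt a = src b /\ tgt b = src a).

Definition no_two_cycle_at (k : V) (Q : quiver V) : Prop :=
  forall a b : arrow Q, ~ [/\ tgt a = k, src b = k & tgt b = src a].

(* The arrows of the premutation at k are those of Q not incident to k, a
   composite [ab] for each path ab through k, and a reversed arrow a* for each
   arrow a incident to k. *)
Definition kept (k : V) (Q : quiver V) : finType :=
  {a : arrow Q | (src a != k) && (tgt a != k)}.
Definition composite (k : V) (Q : quiver V) : finType :=
  {ab : arrow Q * arrow Q | (tgt ab.1 == k) && (src ab.2 == k)}.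
Definition reversed (k : V) (Q : quiver V) : finType :=
  {a : arrow Q | (src a == k) || (tgt a == k)}.

Definition premutation (k : V) (Q : quiver V) : quiver V :=
  @Quiver V (kept k Q + composite k Q + reversed k Q)%type
    (fun c => match c with
       | inl (inl a) => src (val a)
       | inl (inr ab) => src (val ab).1
       | inr a => tgt (val a)
     end)
    (fun c => match c with
       | inl (inl a) => tgt (val a)
       | inl (inr ab) => tgt (val ab).2
       | inr a => src (val a)
     end).

Definition unbracket (k : V) (Q : quiver V) (c : arrow (premutation k Q)) :
    option (seq (arrow Q)) :=
  match c with
  | inl (inl a) => Some [:: val a]
  | inl (inr ab) => Some [:: (val ab).1; (val ab).2]
  | inr _ => None
  end.

(* [S] + sum_(ab) [ab] b* a*; when no cycle in S starts at k, each of them has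
   a unique bracketing. *)
Definition premutation_pot (k : V) (Q : quiver V) (S : cpath_alg K Q) :
    cpath_alg K (premutation k Q) :=
  relabel (@unbracket k Q) S
  + \sum_(ab : composite k Q) \sum_(b : reversed k Q | val b == (val ab).2)
      \sum_(a : reversed k Q | val a == (val ab).1)
        arr K (Q := premutation k Q) (inl (inr ab))
        * arr K (Q := premutation k Q) (inr b)
        * arr K (Q := premutation k Q) (inr a).

Arguments premutation_pot k {Q} S _.

(* (Q', S') is a mutation of (Q, S) at k, i.e. a reduced part of a premutation
   of (Q, S) at k. By the splitting theorem it exists and is unique up to right
   equivalence; being determined only up to it, it is given by a relation. *)
Definition is_mutation (k : V) (Q : quiver V) (S : cpath_alg K Q)
    (Q' : quiver V) (S' : cpath_alg K Q') : Prop :=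
  no_two_cycle_at k Q /\
  exists (S0 : cpath_alg K Q) (Qt : quiver V) (St : cpath_alg K Qt),
    [/\ is_potential S0, cyc_equiv S S0 & forall p, pstart p = k -> S0 p = 0] /\
    [/\ is_potential St, trivial_qp St, is_potential S', reduced_qp S'
      & right_equiv (premutation_pot k S0) (dsum_pot St S')].

Fixpoint nondegenerate_along (ks : seq V) (Q : quiver V) (S : cpath_alg K Q)
    {struct ks} : Prop :=
  two_acyclic Q /\
  if ks is k :: ks' then
    forall (Q' : quiver V) (S' : cpath_alg K Q'),
      is_mutation k S S' -> nondegenerate_along ks' S'
  else True.

Definition nondegenerate_qp (Q : quiver V) (S : cpath_alg K Q) : Prop :=
  is_potential S /\ forall ks : seq V, nondegenerate_along ks S.

End Mutation.

(* Oriented triangles glued along pairs of sides by orientation reversing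
   identifications; the sides of a triangle t are, in clockwise order,
   side t 0, side t 1 and side t 2. The surface has empty boundary because each
   arc is a side twice. *)
Record triangulation := Triangulation {
  triangle : finType;
  ideal_arc : finType;
  side : triangle -> 'Z_3 -> ideal_arc;
  sideP : forall x : ideal_arc,
    #|[set ti : triangle * 'Z_3 | side ti.1 ti.2 == x]%SET| = 2%N
}.

Section Adjacency.
Variable T : triangulation.

(* The pair (t, i) is the arrow side t i -> side t (i + 1) *)
Definition adj_quiver : quiver (ideal_arc T) :=
  @Quiver (ideal_arc T) (triangle T * 'Z_3)%type
    (fun a => side a.1 a.2) (fun a => side a.1 (a.2 + 1)).

Definition adj_f (a : arrow adj_quiver) : arrow adj_quiver := (a.1, a.2 + 1).

Definition adj_bar (a : arrow adj_quiver) : arrow adj_quiver :=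
  odflt a [pick b | (src b == src a) && (b != a)].

Definition adj_g (a : arrow adj_quiver) : arrow adj_quiver := adj_bar (adj_f a).

(* The arrow (t, i) is also the corner of t between its sides i and i + 1, and
   adj_g is the passage to the next corner when turning around the common
   vertex of the corners. Hence the marked points are the cycles of adj_g. *)
Definition num_punctures : nat := fcard adj_g predT.

Definition adjacent : rel (triangle T) :=
  [rel t u | [exists i, exists j, side t i == side u j]].

Definition closed_once_punctured : Prop :=
  (forall t u, connect adjacent t u) /\ num_punctures = 1%N.

Definition f_representatives (R : {set arrow adj_quiver}) : Prop :=
  forall a, #|[set x in R | fconnect adj_f a x]%SET| = 1%N.

Variable K : fieldType.

Definition omega (b : arrow adj_quiver) : cpath_alg K adj_quiver :=
  \prod_(a <- orbit adj_g b) arr K a.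

Definition surface_potential (R : {set arrow adj_quiver}) (b : arrow adj_quiver)
    (p : nat -> K) : cpath_alg K adj_quiver :=
  - series_eval p (omega b)
  + \sum_(a in R) arr K a * arr K (adj_f a) * arr K (adj_f (adj_f a)).

End Adjacency.

Definition power_series_X (K : fieldType) (m : nat) : nat -> K :=
  fun i => (i == m)%:R.

Local Open Scope classical_set_scope.

Definition special_series (K : fieldType) : set (nat -> K) :=
  [set (fun=> 0)] `|`
  [set power_series_X K m | m in
    [set m | (0 < m)%N /\ forall c, c \in [pchar K] -> ~~ (c %| m)%N]].

Arguments special_series K _ : clear implicits.

(* Main.v *)
From HB Require Import structures.
Require Import Defs.
From mathcomp Require Import all_boot all_algebra.
From mathcomp Require Import generic_quotient.
From mathcomp Require Import boolp classical_sets cardinality.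
From mathcomp Require Import ring zify.

(** Non-degeneracy only sees cubic parts. For a potential whose cubic part is,
    after a linear change of arrows, the sum of the triangles of a triangulation
    quiver with a single g-cycle, the reduced part of the mutation at k has the
    same property for the flipped triangulation quiver: the quadratic part of the
    premutation is non-degenerate on the arrows that the flip removes, and the
    cubic part of a reduced part is the image of the cubic part of the
    premutation modulo these arrows, by any right equivalence. The quartic terms
    that become cubic are either killed, or of the form [ab] y f(y), and then
    they are absorbed by a linear change along the third side of the triangle of
    y, since g has no cycle of length 4. A triangulation quiver whose g has a
    single cycle has no 2-cycles. As omega has length at least 4, the term
    p(omega) does not contribute to the cubic part.

    Jacobian algebras are distinguished by the largest n such that some product
    of n elements of square zero does not vanish. With N the number of arrows,
    for p = x^m all products of mN + 1 elements of the arrow ideal vanish,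
    because f-consecutive arrows can be replaced by g-paths of length mN - 1,
    while g-paths of length at most mN - 2 are nonzero; for p = 0 all g-paths are
    nonzero. *)

Set Implicit Arguments.
Unset Strict Implicit.
Unset Printing Implicit Defensive.

Import GRing.Theory.

(** * Coefficients along words *)

Section Words.
Local Open Scope ring_scope.
Variables (K : fieldType) (V : finType) (Q : quiver V).
Notation A := (cpath_alg K Q).
Implicit Types (x y z : A) (p : qpath Q) (a b c : arrow Q) (w s t : seq (arrow Q)).

(** A mutation is known only through some right equivalence, so only data that every right
    equivalence respects can be carried along. In a potential without quadratic terms, the cubic
    coefficients summed over rotations change merely by the linear part of the equivalence; hence
    the invariant asks for triangles only after a linear change of parallel arrows, recorded by dual
    frames. Sums over rotations make sense in every characteristic, being coefficients of cyclic
    derivatives. The model arrows form one fixed set with fixed sources and fixed [bar]; a flip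
    alters [f] alone, so that no triangulations have to be identified along a sequence of mutations.
    The single cycle of [bar \o f] is used by exhaustion: a forbidden local configuration would
    close up into a cycle containing all arrows, yet some arrow lies outside it. For the second
    part, a ring isomorphism may move the idempotents and the arrow ideal; elements of square zero
    are a substitute for arrows that it cannot miss. *)

Definition wcoef x w : K := if w is a :: _ then coef x (src a, w) else 0.

(* Rotations are counted with multiplicity: the value at [a :: w] is then the
   coefficient at [w] of the cyclic derivative along [a]. *)
Definition cyc_coef x w : K := \sum_(i < size w) wcoef x (rot i w).

Lemma is_path_cons a w : is_path (src a, a :: w) = path (@composable V Q) a w.
Proof. by rewrite /is_path /= take0 /= eqxx. Qed.

Lemma pstartE p a w : parrows p = a :: w -> pstart p = src a.
Proof.
by case: p => -[v s] hp; rewrite /parrows /pstart /= => E; move: hp;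
  rewrite E /is_path /= take0 /= andbT => /andP[/eqP].
Qed.

Lemma sorted_parrows p : sorted (@composable V Q) (parrows p).
Proof. by case: p => -[v s] hp; case/andP: (hp). Qed.

Lemma parrows_take i p : parrows (ptake i p) = take i (parrows p).
Proof. by []. Qed.
Lemma parrows_drop i p : parrows (pdrop i p) = drop i (parrows p).
Proof. by []. Qed.

Lemma coef_qpath x p : coef x (pstart p, parrows p) = x p.
Proof.
rewrite /coef; case: p => -[v s] hp; rewrite /pstart /parrows /=.
by rewrite (insubT (@is_path V Q) hp).
Qed.

Lemma coef_nonpath x v w : ~~ is_path (v, w) -> coef x (v, w) = 0.
Proof. by move=> h; rewrite /coef insubF //; apply: negbTE. Qed.

Lemma wcoefE x p : parrows p != [::] -> wcoef x (parrows p) = x p.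
Proof.
by case E: (parrows p) => [//|a w] _; rewrite /= -(pstartE E) -E coef_qpath.
Qed.

Definition word_path v w (h : is_path (v, w)) : qpath Q :=
  exist (@is_path V Q) (v, w) h.

(** Either the word is not composable and has coefficient zero everywhere, or it is the word of a
    path; identities between word coefficients thus reduce to pointwise ones. *)
Lemma wcoefP w : (forall x, wcoef x w = 0) \/
  exists p, [/\ parrows p = w, parrows p != [::] & forall x, wcoef x w = x p].
Proof.
case: w => [|a w]; first by left.
have [h|h] := boolP (is_path (src a, a :: w)); last first.
  by left=> x; rewrite /= coef_nonpath.
right; exists (word_path h); split=> // x.
exact: (@wcoefE x (word_path h)).
Qed.

Lemma wcoef_sorted x w : wcoef x w != 0 -> sorted (@composable V Q) w.
Proof.
case: (wcoefP w) => [->|[p [<- _ _]] _]; first by rewrite eqxx.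
exact: sorted_parrows.
Qed.

Lemma wcoef0 w : wcoef 0 w = 0.
Proof. by case: (wcoefP w) => [->|[p [_ _ ->]]]. Qed.
Lemma wcoefD x y w : wcoef (x + y) w = wcoef x w + wcoef y w.
Proof. by case: (wcoefP w) => [h|[p [_ _ h]]]; rewrite !h ?addr0. Qed.
Lemma wcoefN x w : wcoef (- x) w = - wcoef x w.
Proof. by case: (wcoefP w) => [h|[p [_ _ h]]]; rewrite !h ?oppr0. Qed.
Lemma wcoefB x y w : wcoef (x - y) w = wcoef x w - wcoef y w.
Proof. by rewrite wcoefD wcoefN. Qed.
Lemma wcoefZ k x w : wcoef (k *: x) w = k * wcoef x w.
Proof. by case: (wcoefP w) => [h|[p [_ _ h]]]; rewrite !h ?mulr0. Qed.
Lemma wcoef_sum I (r : seq I) (P : pred I) (F : I -> A) w :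
  wcoef (\sum_(i <- r | P i) F i) w = \sum_(i <- r | P i) wcoef (F i) w.
Proof.
exact: (big_morph (fun x => wcoef x w) (fun x y => wcoefD x y w) (wcoef0 w)).
Qed.

Lemma cpa_sum I (r : seq I) (P : pred I) (F : I -> A) p :
  (\sum_(i <- r | P i) F i) p = \sum_(i <- r | P i) F i p.
Proof. by apply: (big_morph (fun x : A => x p)). Qed.

Lemma cpa_scaleE k x p : (k *: x) p = k * x p. Proof. by []. Qed.
Lemma cpa_subE x y p : (x - y) p = x p - y p. Proof. by []. Qed.

Lemma arrE a p : arr K a p = (parrows p == [:: a])%:R.
Proof.
rewrite /arr; congr (_%:R); have -> : val p = (pstart p, parrows p) by case: p => -[].
rewrite xpair_eqE; case: (parrows p =P _) => [e|]; rewrite ?andbF //.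
by rewrite (pstartE e) eqxx.
Qed.

Lemma arr_mulE a x p : (arr K a * x) p =
  if parrows p is b :: _ then (b == a)%:R * x (pdrop 1 p) else 0.
Proof.
rewrite cpa_mulE /plength; case E: (parrows p) => [|b w] /=.
  by rewrite big_ord_recl big_ord0 addr0 arrE parrows_take take0 mul0r.
rewrite big_ord_recl big_ord_recl /= big1 ?addr0 => [|i _].
  rewrite !arrE !parrows_take E take0 mul0r add0r /= take0 eqseq_cons.
  by rewrite eqxx andbT.
rewrite arrE parrows_take E /= eqseq_cons.
by case: w E i => [|? ?] ? [i hi] //=; rewrite andbF mul0r.
Qed.

Lemma prod_arrE s p : s != [::] ->
  (\prod_(a <- s) arr K a) p = (parrows p == s)%:R.
Proof.
elim: s p => // a [|b s] IH p _; first by rewrite big_seq1 arrE.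
rewrite big_cons arr_mulE; case E: (parrows p) => [|c w] //.
rewrite IH // parrows_drop E /= drop0 eqseq_cons.
by case: eqP; rewrite ?mul1r ?mul0r.
Qed.

Lemma wcoef_prod s w : s != [::] ->
  wcoef (\prod_(a <- s) arr K a) w = (sorted (@composable V Q) w && (w == s))%:R.
Proof.
move=> hs; case: (wcoefP w) => [h|[p [<- hp ->]]]; last first.
  by rewrite prod_arrE // sorted_parrows.
rewrite h; case: eqP => [e|]; rewrite ?andbF // andbT; case hw: (sorted _ w) => //.
case: w e h hw => [|a w] e h hw; first by rewrite -e in hs.
have hp : is_path (src a, a :: w) by rewrite is_path_cons.
have /= := h (\prod_(a <- s) arr K a).
have -> : coef (\prod_(a <- s) arr K a) (src a, a :: w) = (\prod_(a <- s) arr K a) (word_path hp).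
  by rewrite -coef_qpath.
by rewrite prod_arrE // /parrows /= e eqxx.
Qed.

Lemma wcoef_arr a w : wcoef (arr K a) w = (w == [:: a])%:R.
Proof.
by have := @wcoef_prod [:: a] w isT; rewrite big_seq1 => ->; case: eqP => [->|];
  rewrite ?andbF.
Qed.

Definition ord_ge (d : nat) x := forall p, (plength p < d)%N -> x p = 0.

Lemma ord_ge_wcoef d x w : ord_ge d x -> (size w < d)%N -> wcoef x w = 0.
Proof.
move=> hx hw; case: (wcoefP w) => [->//|[p [e _ ->]]].
by apply: hx; rewrite /plength e.
Qed.

Lemma ord_geS d e x : (e <= d)%N -> ord_ge d x -> ord_ge e x.
Proof. by move=> de hx p hp; apply: hx; apply: leq_trans hp de. Qed.
Lemma ord_geD d x y : ord_ge d x -> ord_ge d y -> ord_ge d (x + y).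
Proof. by move=> hx hy p hp; rewrite cpa_addE hx // hy // addr0. Qed.
Lemma ord_geN d x : ord_ge d x -> ord_ge d (- x).
Proof. by move=> hx p hp; rewrite -[LHS]/(- x p) hx // oppr0. Qed.
Lemma ord_geZ k d x : ord_ge d x -> ord_ge d (k *: x).
Proof. by move=> hx p hp; rewrite -[LHS]/(k * x p) hx // mulr0. Qed.
Lemma ord_ge_sum I (r : seq I) (P : pred I) (F : I -> A) d :
  (forall i, P i -> ord_ge d (F i)) -> ord_ge d (\sum_(i <- r | P i) F i).
Proof. by move=> h; apply: big_ind => //; [exact: ord_geD]. Qed.

Lemma ord_geM d e x y : ord_ge d x -> ord_ge e y -> ord_ge (d + e) (x * y).
Proof.
move=> hx hy p hp; rewrite cpa_mulE big1 // => i _.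
have [h|h] := ltnP i d.
  by rewrite hx ?mul0r // plength_take (leq_ltn_trans (geq_minl _ _)).
rewrite [y _]hy ?mulr0 // plength_drop ltn_subLR; last by rewrite -ltnS.
by apply: leq_trans hp _; rewrite leq_add2r.
Qed.
Lemma ord_ge_prod s : ord_ge (size s) (\prod_(a <- s) arr K a).
Proof.
move=> p; case: (eqVneq s [::]) => [->//|hs] h.
by rewrite prod_arrE //; case: eqP => // e; rewrite /plength e ltnn in h.
Qed.

(* The value at the trivial path at a vertex other than [tgt a] is junk, which
   disappears in the product [arr K a * lderiv a x]. *)
Definition lderiv a x : A := fun p => coef x (src a, a :: parrows p).

Lemma ord_ge_decomp x : ord_ge 1 x -> x = \sum_a arr K a * lderiv a x.
Proof.
move=> hx; apply/funext => p; rewrite cpa_sum.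
case E: (parrows p) => [|b w].
  rewrite hx /plength ?E // big1 // => a _; by rewrite arr_mulE E.
rewrite (bigD1 b) //= [X in _ + X]big1 ?addr0 => [|a hab]; last first.
  by rewrite arr_mulE E eq_sym (negbTE hab) mul0r.
rewrite arr_mulE E eqxx mul1r /lderiv parrows_drop E /= drop0.
by rewrite -(pstartE E) -E coef_qpath.
Qed.

Lemma ord_ge_lderiv d a x : ord_ge d.+1 x -> ord_ge d (lderiv a x).
Proof.
move=> hx p hp; rewrite /lderiv.
have := @ord_ge_wcoef d.+1 x (a :: parrows p) hx; apply; exact: hp.
Qed.

Lemma idemE v p : idem K Q v p = ((plength p == 0%N) && (pstart p == v))%:R.
Proof.
rewrite /idem /plength size_eq0; case: p => -[u s] hp; rewrite /pstart /parrows /=.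
by rewrite xpair_eqE andbC.
Qed.

Lemma idem_mulE v x p : (idem K Q v * x) p = (pstart p == v)%:R * x p.
Proof.
rewrite cpa_mulE big_ord_recl /= pdrop0 big1 ?addr0 => [|i _].
  by rewrite idemE plength_take min0n eqxx.
by rewrite idemE plength_take (minn_idPl _) ?mul0r // /bump; apply: ltn_ord.
Qed.

Lemma mul_idemE v x p : (x * idem K Q v) p = x p * (pend p == v)%:R.
Proof.
rewrite cpa_mulE big_ord_recr /= ptake_size big1 ?add0r => [|i _].
  by rewrite idemE plength_drop subnn eqxx -[pstart (pdrop _ p)]/(pend (ptake (plength p) p)) ptake_size.
by rewrite idemE plength_drop subn_eq0 leqNgt ltn_ord mulr0.
Qed.

Lemma word_end_cons v a w : word_end v (a :: w) = tgt (last a w).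
Proof. by rewrite /word_end /= last_map. Qed.

Lemma idem_mul_wcoef v x a w :
  wcoef (idem K Q v * x) (a :: w) = (src a == v)%:R * wcoef x (a :: w).
Proof.
case: (wcoefP (a :: w)) => [h|[p [e _ h]]]; rewrite !h ?mulr0 //.
by rewrite idem_mulE (pstartE e).
Qed.
Lemma mul_idem_wcoef v x a w :
  wcoef (x * idem K Q v) (a :: w) = wcoef x (a :: w) * (tgt (last a w) == v)%:R.
Proof.
case: (wcoefP (a :: w)) => [h|[p [e _ h]]]; rewrite !h ?mul0r //.
by rewrite mul_idemE /pend e word_end_cons.
Qed.

Lemma idem_arr a : idem K Q (src a) * arr K a = arr K a.
Proof.
apply/funext => p; rewrite idem_mulE arrE; case: (parrows p =P _) => [e|]; rewrite ?mulr0 //.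
by rewrite (pstartE e) eqxx mul1r.
Qed.
Lemma arr_idem a : arr K a * idem K Q (tgt a) = arr K a.
Proof.
apply/funext => p; rewrite mul_idemE arrE; case: (parrows p =P _) => [e|]; rewrite ?mul0r //.
by rewrite /pend e word_end_cons /= eqxx mulr1.
Qed.

(** The common vertex [v] makes the rule hold at all words: without it, the right side could
    multiply coefficients of two words whose concatenation is not composable. *)
Lemma wcoef_mul v x y w : ord_ge 1 x -> ord_ge 1 y ->
  x * idem K Q v = x -> idem K Q v * y = y ->
  wcoef (x * y) w = \sum_(i < size w) wcoef x (take i w) * wcoef y (drop i w).
Proof.
move=> hx hy xv vy; case: (wcoefP w) => [h|[p [e ne ->]]].
  rewrite h big1 // => i _.
  case: (eqVneq (wcoef x (take i w)) 0) => [->|n1]; first by rewrite mul0r.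
  case: (eqVneq (wcoef y (drop i w)) 0) => [->|n2]; first by rewrite mulr0.
  exfalso; suff hw : sorted (@composable V Q) w.
    case: w h i n1 n2 hw => [|a w] h i n1 n2 hw; first by case: i n1 n2.
    have hp : is_path (src a, a :: w) by rewrite is_path_cons.
    have /= := h (\prod_(a <- a :: w) arr K a).
    have -> : coef (\prod_(a <- a :: w) arr K a) (src a, a :: w) =
       (\prod_(a <- a :: w) arr K a) (word_path hp) by rewrite -coef_qpath.
    by rewrite prod_arrE // /parrows /= eqxx => /eqP; rewrite oner_eq0.
  have s1 := wcoef_sorted n1; have s2 := wcoef_sorted n2.
  rewrite -(cat_take_drop i w).
  case E1: (take i w) n1 s1 => [|a t]; first by rewrite eqxx.
  case E2: (drop i w) n2 s2 => [|b u]; first by rewrite eqxx.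
  rewrite -xv -vy mul_idem_wcoef idem_mul_wcoef => n2 /= s2 n1 s1.
  rewrite cat_path s1 /= s2 andbT.
  move: n1 n2; case: (tgt _ =P v) => [<-|]; rewrite ?mulr0 ?eqxx // => _.
  case: (src b =P _) => [e _|]; rewrite ?mul0r ?eqxx //; exact/eqP/esym.
rewrite cpa_mulE big_ord_recr /= [y _]hy ?mulr0 ?addr0; last first.
  by rewrite plength_drop subnn.
rewrite {2}/plength -e; apply: eq_bigr => i _.
have -> : drop i (parrows p) = parrows (pdrop i p) by [].
have -> : take i (parrows p) = parrows (ptake i p) by [].
case: (posnP i) => [->|hi].
  rewrite hx ?mul0r; last by rewrite plength_take min0n.
  by rewrite {1}/parrows /= take0 mul0r.
rewrite !wcoefE // -size_eq0.
  by rewrite -/(plength (pdrop i p)) plength_drop subn_eq0 -ltnNge.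
by rewrite -/(plength (ptake i p)) plength_take (minn_idPl (ltnW (ltn_ord i))) -lt0n.
Qed.

End Words.

(** * Coefficients up to rotation and cyclic derivatives *)

Section CyclicCoefficients.
Local Open Scope ring_scope.
Variables (K : fieldType) (V : finType) (Q : quiver V).
Notation A := (cpath_alg K Q).
Implicit Types (x y S : A) (p : qpath Q) (a b c : arrow Q) (w s t : seq (arrow Q)).

Lemma cyc_coef0 w : cyc_coef (0 : A) w = 0.
Proof. by rewrite /cyc_coef big1 // => i _; rewrite wcoef0. Qed.
Lemma cyc_coefD x y w : cyc_coef (x + y) w = cyc_coef x w + cyc_coef y w.
Proof. by rewrite /cyc_coef -big_split /=; apply: eq_bigr => i _; rewrite wcoefD. Qed.
Lemma cyc_coefB x y w : cyc_coef (x - y) w = cyc_coef x w - cyc_coef y w.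
Proof. by rewrite /cyc_coef -sumrB /=; apply: eq_bigr => i _; rewrite wcoefB. Qed.
Lemma cyc_coefZ k x w : cyc_coef (k *: x) w = k * cyc_coef x w.
Proof. by rewrite /cyc_coef big_distrr /=; apply: eq_bigr => i _; rewrite wcoefZ. Qed.
Lemma cyc_coef_sum I (r : seq I) (P : pred I) (F : I -> A) w :
  cyc_coef (\sum_(i <- r | P i) F i) w = \sum_(i <- r | P i) cyc_coef (F i) w.
Proof.
exact: (big_morph (fun x => cyc_coef x w) (fun x y => cyc_coefD x y w) (cyc_coef0 w)).
Qed.

Lemma cyc_coef2 x a b :
  cyc_coef x [:: a; b] = wcoef x [:: a; b] + wcoef x [:: b; a].
Proof. by rewrite /cyc_coef /= !big_ord_recl big_ord0 addr0. Qed.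

Lemma cyc_coef3 x a b c : cyc_coef x [:: a; b; c] =
  wcoef x [:: a; b; c] + wcoef x [:: b; c; a] + wcoef x [:: c; a; b].
Proof. by rewrite /cyc_coef /= !big_ord_recl big_ord0 addr0 addrA. Qed.

Lemma cyc_coef2C x a b : cyc_coef x [:: a; b] = cyc_coef x [:: b; a].
Proof. by rewrite !cyc_coef2 addrC. Qed.

Lemma cyc_coef3_rot x a b c : cyc_coef x [:: a; b; c] = cyc_coef x [:: b; c; a].
Proof. by rewrite !cyc_coef3 [RHS]addrC addrA. Qed.

Lemma sum_rot_shift (G : seq (arrow Q) -> K) w :
  \sum_(i < size w) G (rot i w) = \sum_(i < size w) G (rot i.+1 w).
Proof.
case: w => [|a w]; first by rewrite !big_ord0.
rewrite [LHS]big_ord_recl [RHS]big_ord_recr /= addrC; congr (_ + _).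
by rewrite rot0 -[(size w).+1]/(size (a :: w)) rot_size.
Qed.

Lemma cycle_arrows p a w : parrows p = a :: w -> is_cycle p ->
  cycle (@composable V Q) (a :: w).
Proof.
move=> e /andP[_]; rewrite /pend e word_end_cons (pstartE e) => h.
rewrite /= rcons_path; have := sorted_parrows p; rewrite e /= => ->.
exact: h.
Qed.

Lemma wcoef_cycle S w : is_potential S -> wcoef S w != 0 ->
  cycle (@composable V Q) w.
Proof.
move=> hS; case: (wcoefP K w) => [->|[p [<- ne ->]]]; first by rewrite eqxx.
move=> /hS; case E: (parrows p) ne => [//|a t] _; exact: cycle_arrows.
Qed.

Lemma cyc_coef_cycle S w : is_potential S -> cyc_coef S w != 0 ->
  cycle (@composable V Q) w.
Proof.
move=> hS; apply: contraNT => hw; apply/eqP; rewrite /cyc_coef big1 // => i _.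
apply/eqP; apply: contraNT hw => /(wcoef_cycle hS).
by rewrite rot_cycle.
Qed.

Lemma cyc_coef_prod s w : cycle (@composable V Q) s -> s != [::] ->
  cyc_coef (\prod_(a <- s) arr K a) w = \sum_(i < size w) (rot i w == s)%:R.
Proof.
move=> cs hs; apply: eq_bigr => i _; rewrite wcoef_prod //.
case: eqP => [->|]; rewrite ?andbF // andbT.
by case: s cs {hs} => //= a s; rewrite rcons_path => /andP[->].
Qed.

Lemma potential_prod s : s != [::] -> cycle (@composable V Q) s ->
  is_potential (\prod_(a <- s) arr K a).
Proof.
move=> hs cs p; rewrite prod_arrE //; case: (parrows p =P s) => [e|]; last by rewrite eqxx.
case: s hs cs e => // a s _ /=; rewrite rcons_path => /andP[_ /eqP h] e _.
by rewrite /is_cycle /plength /pend e word_end_cons (pstartE e) h eqxx.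
Qed.

Lemma is_potentialD S S' : is_potential S -> is_potential S' -> is_potential (S + S').
Proof.
move=> h h' p; rewrite cpa_addE; case: (eqVneq (S p) 0) => [->|/h//].
by rewrite add0r; apply: h'.
Qed.

Lemma cyc_coef_rotation x w : @rotations K V Q x -> cyc_coef x w = 0.
Proof.
case=> p hp ->; case/andP: (hp) => h0 _; rewrite /plength in h0.
have hne : parrows p != [::] by rewrite -size_eq0 -lt0n.
have hc : cycle (@composable V Q) (parrows p).
  by case E: (parrows p) h0 => [//|a t] _; apply: cycle_arrows hp.
rewrite cyc_coefB !cyc_coef_prod ?rot_cycle //; last first.
  by rewrite -size_eq0 size_rot size_eq0.
rewrite [X in _ - X](sum_rot_shift (fun t => (t == rot 1 (parrows p))%:R)).
apply/eqP; rewrite subr_eq0; apply/eqP; apply: eq_bigr => i _.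
by rewrite (rotS (ltn_ord i)) (inj_eq (@rot_inj 1 _)).
Qed.

Lemma ord_ge_cyc_coef d x w : ord_ge d x -> (size w < d)%N -> cyc_coef x w = 0.
Proof.
move=> hx hw; rewrite /cyc_coef big1 // => i _.
by apply: ord_ge_wcoef hx _; rewrite size_rot.
Qed.

(** Rotations cancel in the sum over all rotations, and the closure does no harm, because an
    approximation in lengths up to [size w] is exact at [w]. *)
Lemma cyc_equiv_coef S S' w : cyc_equiv S S' -> cyc_coef S w = cyc_coef S' w.
Proof.
move=> /(_ (size w).+1)[y [n [c [g [hg ->]]]] hy].
have h : ord_ge (size w).+1 (S - S' - \sum_(i < n) c i *: g i).
  by move=> p hp; rewrite -[LHS]/((S - S') p - _) hy // subrr.
have := ord_ge_cyc_coef h (ltnSn _); rewrite !cyc_coefB cyc_coef_sum.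
rewrite big1 => [|i _]; last by rewrite cyc_coefZ (cyc_coef_rotation _ (hg i)) mulr0.
by rewrite subr0 => /eqP; rewrite subr_eq0 => /eqP.
Qed.

Lemma cyc_derivE S a p : is_potential S -> parrows p != [::] ->
  cyc_deriv a S p = cyc_coef S (a :: parrows p).
Proof.
move=> hS hp; rewrite /cyc_coef sum_rot_shift /= /cyc_deriv /plength.
apply: eq_bigr => -[i hi] _ /=.
have -> : rot i.+1 (a :: parrows p) = drop i (parrows p) ++ a :: take i (parrows p) by [].
case E: (drop i (parrows p)) => [|c t] /=.
  (* At the last cut the derivative reads [a :: parrows p] from [pend p], whereas [wcoef] reads it
     from [src a]; where these differ, the word is no cycle and [S] has no such term. *)
  have {hi E} -> : i = size (parrows p).
    apply/eqP; rewrite eqn_leq -ltnS hi /= -subn_eq0.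
    by rewrite -size_drop E.
  rewrite take_size ptake_size; case: (pend p =P src a) => [->//|ne].
  rewrite coef_nonpath; last first.
    by apply/negP => /andP[/= /andP[/eqP e _] _]; apply: ne.
  case: (eqVneq (wcoef S (a :: parrows p)) 0) => [<- //|/(wcoef_cycle hS)].
  move: hp ne; rewrite /pend; case E: (parrows p) => [//|c t] _ ne /=.
  rewrite rcons_path /= => /and3P[_ _ /eqP h]; case: ne.
  by rewrite word_end_cons.
congr (coef S (_, _)).
by rewrite -(@pstartE _ _ (pdrop i p) c t).
Qed.

End CyclicCoefficients.

(** * Morphisms of completed path algebras in low degrees *)

Arguments wcoef : simpl never.

Section HomogeneousComponents.
Local Open Scope ring_scope.
Variables (K : fieldType) (V : finType) (Q : quiver V).
Notation A := (cpath_alg K Q).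
Implicit Types (x : A) (w : seq (arrow Q)).

Definition hcomp n x : A :=
  \sum_(t : n.-tuple (arrow Q)) wcoef x t *: \prod_(a <- t) arr K a.

Lemma wcoef_hcomp n x w : (0 < n)%N ->
  wcoef (hcomp n x) w = (size w == n)%:R * wcoef x w.
Proof.
move=> n0; rewrite /hcomp wcoef_sum.
under eq_bigr => t _ do rewrite wcoefZ wcoef_prod -?size_eq0 ?size_tuple -?lt0n //.
case: (size w =P n) => [e|ne]; last first.
  rewrite mul0r big1 // => t _; case: (w =P t) => [e|]; last by rewrite andbF mulr0.
  by case: ne; rewrite e size_tuple.
have et : tval (tcast e (in_tuple w)) = w by rewrite val_tcast.
rewrite (bigD1 (tcast e (in_tuple w))) //= et eqxx andbT big1 => [|t ht].
  rewrite mul1r addr0; case: (eqVneq (wcoef x w) 0) => [->|h]; first by rewrite mul0r.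
  by rewrite (wcoef_sorted h) mulr1.
case: (w =P t) => [e'|]; last by rewrite andbF mulr0.
by case/eqP: ht; apply: val_inj; rewrite /= et e'.
Qed.

Lemma ord_ge_hcomp n x : ord_ge n (hcomp n x).
Proof.
apply: ord_ge_sum => t _; apply: ord_geZ.
by rewrite -{1}(size_tuple t); apply: ord_ge_prod.
Qed.

Lemma ord_ge_wcoefP n x : ord_ge 1 x ->
  (forall w, (size w < n)%N -> wcoef x w = 0) -> ord_ge n x.
Proof.
move=> h1 hx p hp; case: (eqVneq (parrows p) [::]) => [e|ne].
  by apply: h1; rewrite /plength e.
by rewrite -wcoefE // hx.
Qed.

Lemma ord_ge_subhcomp n x : (0 < n)%N -> ord_ge n x -> ord_ge n.+1 (x - hcomp n x).
Proof.
move=> n0 hx; apply: ord_ge_wcoefP => [|w hw].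
  by apply/ord_geD/ord_geN; apply: (@ord_geS _ _ _ n) => //; apply: ord_ge_hcomp.
rewrite wcoefB wcoef_hcomp //; case: eqP => [_|ne]; first by rewrite mul1r subrr.
rewrite mul0r subr0; apply: ord_ge_wcoef hx _.
by rewrite ltn_neqAle -ltnS hw andbT; apply/eqP.
Qed.

Lemma hcomp_shift n m x : (0 < m < n)%N -> hcomp n (x - hcomp m x) = hcomp n x.
Proof.
case/andP=> m0 mn; apply: eq_bigr => t _; congr (_ *: _).
by rewrite wcoefB wcoef_hcomp // size_tuple gtn_eqF // mul0r subr0.
Qed.

End HomogeneousComponents.

Lemma sum_tupleS (R : nmodType) (T : finType) n (F : seq T -> R) :
  (\sum_(t : n.+1.-tuple T) F t = \sum_a \sum_(t : n.-tuple T) F (a :: t))%R.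
Proof.
rewrite pair_big /= (reindex (fun p : T * n.-tuple T => [tuple of p.1 :: p.2])) //=.
exists (fun t : n.+1.-tuple T => (thead t, [tuple of behead t])) => [[a t]|t] _ /=.
  by congr pair; apply: val_inj.
by rewrite -tuple_eta.
Qed.

Lemma sum_tuple0 (R : nmodType) (T : finType) (F : seq T -> R) :
  (\sum_(t : 0.-tuple T) F t = F [::])%R.
Proof. by rewrite (big_pred1 [tuple]) // => t; apply/esym/eqP/tuple0. Qed.

Section Morphisms.
Local Open Scope ring_scope.
Variables (K : fieldType) (V : finType) (Qa Qb : quiver V).
Variable phi : {rmorphism cpath_alg K Qa -> cpath_alg K Qb}.
Hypothesis phiZ : scalable phi.
Hypothesis phi_idem : forall v, phi (idem K Qa v) = idem K Qb v.
Hypothesis phi_arr : forall u : arrow Qa, ord_ge 1 (phi (arr K u)).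
Implicit Types (x W : cpath_alg K Qa) (u v : arrow Qa) (a b c : arrow Qb).

(** Continuity is automatic: the quiver is finite, so an element of order [d + 1] is a finite sum of
    arrows times elements of order [d]. *)
Lemma hom_ord_ge d x : ord_ge d x -> ord_ge d (phi x).
Proof.
elim: d x => [//|d IH] x hx.
rewrite (ord_ge_decomp (@ord_geS _ _ _ d.+1 1 x isT hx)) rmorph_sum.
apply: ord_ge_sum => u _; rewrite rmorphM; apply: (@ord_geM _ _ _ 1 d) => //.
exact/IH/ord_ge_lderiv.
Qed.

Lemma phi_idem_arr u : idem K Qb (src u) * phi (arr K u) = phi (arr K u).
Proof. by rewrite -phi_idem -rmorphM idem_arr. Qed.
Lemma phi_arr_idem u : phi (arr K u) * idem K Qb (tgt u) = phi (arr K u).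
Proof. by rewrite -phi_idem -rmorphM arr_idem. Qed.

Lemma hom_support u a w : wcoef (phi (arr K u)) (a :: w) != 0 ->
  src u = src a /\ tgt u = tgt (last a w).
Proof.
move=> h; split; apply/eqP.
  apply: contraNT h => h; rewrite -phi_idem_arr idem_mul_wcoef [src a == _]eq_sym (negbTE h).
  by rewrite mul0r.
apply: contraNT h => h; rewrite -phi_arr_idem mul_idem_wcoef [tgt _ == _]eq_sym (negbTE h).
by rewrite mulr0.
Qed.

Lemma wcoef_phi_mul u x w : ord_ge 1 x -> idem K Qb (tgt u) * phi x = phi x ->
  wcoef (phi (arr K u) * phi x) w =
  \sum_(i < size w) wcoef (phi (arr K u)) (take i w) * wcoef (phi x) (drop i w).
Proof.
by move=> hx vx; apply: wcoef_mul (phi_arr_idem u) vx => //; apply: hom_ord_ge.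
Qed.

Lemma ord_ge_arr u : ord_ge 1 (arr K u).
Proof. by move=> p; rewrite ltnS leqn0 arrE /plength size_eq0 => /eqP ->. Qed.

Lemma wcoef_phi2 u v w : tgt u = src v -> wcoef (phi (arr K u * arr K v)) w =
  \sum_(i < size w) wcoef (phi (arr K u)) (take i w) * wcoef (phi (arr K v)) (drop i w).
Proof.
move=> e; rewrite rmorphM wcoef_phi_mul ?e ?phi_idem_arr //; exact: ord_ge_arr.
Qed.

Lemma hom_lin x a : ord_ge 1 x ->
  wcoef (phi x) [:: a] = \sum_u wcoef x [:: u] * wcoef (phi (arr K u)) [:: a].
Proof.
move=> hx; rewrite -[x in phi x](subrK (hcomp 1 x)) rmorphD wcoefD.
rewrite (ord_ge_wcoef (hom_ord_ge (ord_ge_subhcomp (ltn0Sn _) hx))) // add0r.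
rewrite /hcomp rmorph_sum wcoef_sum.
rewrite (@sum_tupleS _ _ 0 (fun t => wcoef (phi (wcoef x t *: \prod_(a <- t) arr K a)) [:: a])).
apply: eq_bigr => u _; rewrite (sum_tuple0 (fun t => wcoef (phi (wcoef x (u :: t) *:
  \prod_(a <- u :: t) arr K a)) [:: a])).
by rewrite phiZ wcoefZ big_seq1.
Qed.

Lemma wcoef_phi_hcomp2 W w : wcoef (phi (hcomp 2 W)) w =
  \sum_u \sum_v wcoef W [:: u; v] *
   (\sum_(i < size w) wcoef (phi (arr K u)) (take i w) * wcoef (phi (arr K v)) (drop i w)).
Proof.
rewrite /hcomp rmorph_sum wcoef_sum.
rewrite (sum_tupleS _ (fun t => wcoef (phi (wcoef W t *: \prod_(a <- t) arr K a)) w)).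
apply: eq_bigr => u _.
rewrite (sum_tupleS _ (fun t => wcoef (phi (wcoef W (u :: t) *: \prod_(a <- u :: t) arr K a)) w)).
apply: eq_bigr => v _.
rewrite (sum_tuple0 (fun t => wcoef (phi (wcoef W [:: u, v & t] *:
  \prod_(a <- [:: u, v & t]) arr K a)) w)).
rewrite phiZ wcoefZ !big_cons big_nil mulr1.
case: (eqVneq (wcoef W [:: u; v]) 0) => [->|h]; first by rewrite !mul0r.
congr (_ * _); apply: wcoef_phi2.
by have /= := wcoef_sorted h; rewrite andbT => /eqP.
Qed.

Lemma wcoef_phi_hcomp3 W a b c : wcoef (phi (hcomp 3 W)) [:: a; b; c] =
  \sum_u \sum_v \sum_t wcoef W [:: u; v; t] *
   (wcoef (phi (arr K u)) [:: a] * wcoef (phi (arr K v)) [:: b] *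
    wcoef (phi (arr K t)) [:: c]).
Proof.
set w := [:: a; b; c]; rewrite /hcomp rmorph_sum wcoef_sum.
rewrite (sum_tupleS _ (fun t => wcoef (phi (wcoef W t *: \prod_(a <- t) arr K a)) w)).
apply: eq_bigr => u _.
rewrite (sum_tupleS _ (fun t => wcoef (phi (wcoef W (u :: t) *: \prod_(a <- u :: t) arr K a)) w)).
apply: eq_bigr => v _.
rewrite (sum_tupleS _ (fun t => wcoef (phi (wcoef W [:: u, v & t] *:
  \prod_(a <- [:: u, v & t]) arr K a)) w)).
apply: eq_bigr => t _.
rewrite (sum_tuple0 (fun s => wcoef (phi (wcoef W [:: u, v, t & s] *:
  \prod_(a <- [:: u, v, t & s]) arr K a)) w)).
rewrite phiZ wcoefZ !big_cons big_nil mulr1.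
case: (eqVneq (wcoef W [:: u; v; t]) 0) => [->|h]; first by rewrite !mul0r.
congr (_ * _); have /= := wcoef_sorted h; rewrite andbT => /andP[/eqP e1 /eqP e2].
rewrite rmorphM wcoef_phi_mul; first last.
- by rewrite rmorphM mulrA e1 phi_idem_arr.
- by apply: (@ord_geM _ _ _ 1 0) => //; exact: ord_ge_arr.
rewrite /w /= !big_ord_recl big_ord0 /= !wcoef_phi2 //= !big_ord_recl !big_ord0 /=.
rewrite (ord_ge_wcoef (x := phi (arr K u)) (d := 1)) //.
rewrite (ord_ge_wcoef (w := [::]) (x := phi (arr K v)) (d := 1)) //.
by rewrite !(mul0r, add0r, addr0, mulr0) mulrA.
Qed.

Lemma hom_quad W a b : ord_ge 2 W -> wcoef (phi W) [:: a; b] =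
  \sum_u \sum_v wcoef W [:: u; v] *
    (wcoef (phi (arr K u)) [:: a] * wcoef (phi (arr K v)) [:: b]).
Proof.
move=> hW; rewrite -[W in phi W](subrK (hcomp 2 W)) rmorphD wcoefD.
rewrite (ord_ge_wcoef (hom_ord_ge (ord_ge_subhcomp (ltn0Sn _) hW))) // add0r.
rewrite wcoef_phi_hcomp2; apply: eq_bigr => u _; apply: eq_bigr => v _.
rewrite /= !big_ord_recl big_ord0 /=.
by rewrite (ord_ge_wcoef (w := [::]) (x := phi (arr K u)) (d := 1)) // mul0r add0r addr0.
Qed.

Lemma hom_cubic W a b c : ord_ge 2 W -> wcoef (phi W) [:: a; b; c] =
  \sum_u \sum_v wcoef W [:: u; v] *
    (wcoef (phi (arr K u)) [:: a] * wcoef (phi (arr K v)) [:: b; c]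
     + wcoef (phi (arr K u)) [:: a; b] * wcoef (phi (arr K v)) [:: c])
  + \sum_u \sum_v \sum_t wcoef W [:: u; v; t] *
   (wcoef (phi (arr K u)) [:: a] * wcoef (phi (arr K v)) [:: b] *
    wcoef (phi (arr K t)) [:: c]).
Proof.
move=> hW; rewrite -[W in phi W](subrK (hcomp 2 W)) rmorphD wcoefD addrC.
have h3 := ord_ge_subhcomp (ltn0Sn _) hW.
rewrite -[W - _](subrK (hcomp 3 (W - hcomp 2 W))) rmorphD wcoefD.
rewrite (ord_ge_wcoef (hom_ord_ge (ord_ge_subhcomp (ltn0Sn _) h3))) // add0r.
rewrite hcomp_shift // wcoef_phi_hcomp3 wcoef_phi_hcomp2; congr (_ + _).
apply: eq_bigr => u _; apply: eq_bigr => v _.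
rewrite /= !big_ord_recl big_ord0 /=.
by rewrite (ord_ge_wcoef (w := [::]) (x := phi (arr K u)) (d := 1)) // mul0r add0r addr0.
Qed.

Lemma hom_cyc_quad W a b : ord_ge 2 W -> cyc_coef (phi W) [:: a; b] =
  \sum_u \sum_v cyc_coef W [:: u; v] *
    (wcoef (phi (arr K u)) [:: a] * wcoef (phi (arr K v)) [:: b]).
Proof.
move=> hW; rewrite cyc_coef2 !hom_quad // [X in _ + X]exchange_big -big_split.
apply: eq_bigr => u _; rewrite -big_split; apply: eq_bigr => v _ /=.
by rewrite cyc_coef2 mulrDl [X in _ + _ * X]mulrC.
Qed.

(** A quadratic term of [W] reaches degree three when one factor contributes its linear part and the
    other its quadratic part. Over the rotations these contributions pair up so that the linear part
    is contracted with the symmetrized quadratic form of [W], which the second hypothesis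
    annihilates. *)
Lemma hom_cyc_cubic W a b c : ord_ge 2 W ->
  (forall d u, d \in [:: a; b; c] ->
     \sum_v cyc_coef W [:: u; v] * wcoef (phi (arr K v)) [:: d] = 0) ->
  cyc_coef (phi W) [:: a; b; c] =
  \sum_u \sum_v \sum_t cyc_coef W [:: u; v; t] *
   (wcoef (phi (arr K u)) [:: a] * wcoef (phi (arr K v)) [:: b] *
    wcoef (phi (arr K t)) [:: c]).
Proof.
move=> hW h0; rewrite cyc_coef3 !hom_cubic //.
set P := fun u d => wcoef (phi (arr K u)) [:: d].
set F := fun u d e => wcoef (phi (arr K u)) [:: d; e].
pose L d e g := \sum_u \sum_v wcoef W [:: u; v] * (P u d * F v e g).
pose R d e g := \sum_u \sum_v wcoef W [:: u; v] * (F u d e * P v g).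
have LR d e g : d \in [:: a; b; c] -> L d e g + R e g d = 0.
  move=> hd; rewrite /L exchange_big -big_split /=.
  apply: big1 => x _; rewrite -big_split /=.
  transitivity (\sum_y F x e g * (cyc_coef W [:: x; y] * P y d)).
    by apply: eq_bigr => y _; rewrite cyc_coef2; ring.
  by rewrite -big_distrr /= h0 ?mulr0.
have quad d e g : \sum_u \sum_v wcoef W [:: u; v] * (P u d * F v e g + F u d e * P v g)
    = L d e g + R d e g.
  rewrite -big_split; apply: eq_bigr => u _; rewrite -big_split; apply: eq_bigr => v _.
  by rewrite mulrDr.
rewrite -/(P _ _) -/(F _ _ _) !quad.
have := LR a b c; have := LR b c a; have := LR c a b; rewrite !inE !eqxx !orbT.
move=> /(_ isT) e3 /(_ isT) e2 /(_ isT) e1.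
set C1 := \sum_u _; set C2 := \sum_u _; set C3 := \sum_u _.
transitivity ((L a b c + R b c a) + (L b c a + R c a b) + (L c a b + R a b c)
   + (C1 + C2 + C3)); first by ring.
rewrite e1 e2 e3 !add0r.
have -> : C2 = \sum_u \sum_v \sum_t wcoef W [:: v; t; u] * (P v b * P t c * P u a).
  rewrite exchange_big /=; rewrite /C2; apply: eq_bigr => u _.
  by rewrite exchange_big.
have -> : C3 = \sum_u \sum_v \sum_t wcoef W [:: t; u; v] * (P t c * P u a * P v b).
  rewrite /C3 exchange_big /=; apply: eq_bigr => u _; rewrite exchange_big //=.
rewrite -!big_split; apply: eq_bigr => u _; rewrite -!big_split; apply: eq_bigr => v _.
rewrite -!big_split; apply: eq_bigr => t _ /=; rewrite cyc_coef3 /P; ring.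
Qed.

End Morphisms.

(** * Linear data of a reduced part *)

Lemma sum_deltal (R : pzSemiRingType) (I : finType) (i : I) (F : I -> R) :
  (\sum_j (j == i)%:R * F j = F i)%R.
Proof.
rewrite (bigD1 i) //= eqxx mul1r big1 ?addr0 // => j /negbTE ->.
by rewrite mul0r.
Qed.

Lemma sum_delta_sym (R : pzSemiRingType) (I : finType) (i : I) (F : I -> R) :
  (\sum_j (i == j)%:R * F j = F i)%R.
Proof. by rewrite -[RHS](sum_deltal i F); apply: eq_bigr => j _; rewrite eq_sym. Qed.

Lemma wcoef_cyc_deriv1 (K : fieldType) (V : finType) (Q : quiver V)
    (S : cpath_alg K Q) (a b : arrow Q) : is_potential S ->
  wcoef (cyc_deriv a S) [:: b] = cyc_coef S [:: a; b].
Proof.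
move=> hS; case: (wcoefP K [:: b]) => [h0|[p [e ne ->]]].
  by have := h0 (arr K b); rewrite wcoef_arr eqxx => /eqP; rewrite oner_eq0.
by rewrite cyc_derivE // e.
Qed.

Section RelabelCoefficients.
Local Open Scope ring_scope.
Variables (K : fieldType) (V : finType) (Q Q' : quiver V).
Variable h : arrow Q' -> option (seq (arrow Q)).

(** Under this condition a word is composable exactly when its expansion is, so [relabel] can be
    computed on words and preserves potentials. *)
Definition faithful_expansion := forall c u, h c = Some u ->
  if u is a :: t then
    [/\ src a = src c, tgt (last a t) = tgt c & path (@composable V Q) a t]
  else False.
Hypothesis hh : faithful_expansion.
Implicit Types (x : cpath_alg K Q).

Lemma expand_cons c w s : expand h (c :: w) = Some s ->
  exists a t, [/\ s = a :: t, src a = src c, tgt (last a t) = tgt (last c w) &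
    path (@composable V Q') c w = path (@composable V Q) a t].
Proof.
elim: w c s => [|d w IH] c s /=.
  case E: (h c) => [[|a t]|] //; first by have := hh E.
  move=> [<-]; have [e1 e2 e3] := hh E; exists a, t; split=> //; rewrite ?cats0 //.
case E: (h c) => [[|a t]|] //; first by have := hh E.
have [e1 e2 e3] := hh E; have := IH d; rewrite /=.
case: (if h d is Some _ then _ else _) => [s1|] //= /(_ s1 erefl)[b [t1 [e4 e5 e6 ->]]] [<-].
exists a, (t ++ s1); split=> //; rewrite ?e4 ?last_cat //=.
by rewrite cat_path e3 /composable /= e2 e5.
Qed.

Lemma wcoef_relabel x w : w != [::] ->
  wcoef (relabel h x) w = oapp (wcoef x) 0 (expand h w).
Proof.
case: w => // c w _; case: (wcoefP K (c :: w)) => [e0|[p [e ne ->]]].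
  rewrite e0; case E: (expand h (c :: w)) => [s|] //=.
  have [a [t [-> _ _ hp]]] := expand_cons E.
  apply/esym/eqP; apply: contraTT isT => /wcoef_sorted /=; rewrite -hp => hs.
  have hq : is_path (src c, c :: w) by rewrite is_path_cons.
  have /eqP := e0 (\prod_(a <- c :: w) arr K a).
  by rewrite wcoef_prod // eqxx /= hs oner_eq0.
rewrite /relabel e; case E: (expand h (c :: w)) => [s|] //=.
have [a [t [-> e1 _ _]]] := expand_cons E.
by rewrite (pstartE e) /wcoef e1.
Qed.

Lemma relabel_potential x : is_potential x -> is_potential (relabel h x).
Proof.
move=> hx p; rewrite /relabel; case E: (parrows p) => [|c w].
  rewrite /=; have ht : is_path (pstart p, [::] : seq (arrow Q)) by [].
  have -> : coef x (pstart p, [::]) = x (word_path ht) by rewrite -(coef_qpath x (word_path ht)).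
  by move=> /hx.
case E': (expand h (c :: w)) => [s|] /=; last by rewrite eqxx.
have [a [t [-> e1 e2 _]]] := expand_cons E'.
rewrite (pstartE E) -e1 -[coef _ _]/(wcoef x (a :: t)) => /(wcoef_cycle hx).
rewrite /= rcons_path => /andP[_ /eqP h1].
rewrite /is_cycle /plength /pend E /= word_end_cons (pstartE E) -e1 -h1 e2.
exact: eqxx.
Qed.

End RelabelCoefficients.

(** * Splitting off the trivial part by an arbitrary right equivalence *)

Section Reduction.
Local Open Scope ring_scope.
Variables (K : fieldType) (V : finType) (Qa Qt Q' : quiver V).
Variables (W : cpath_alg K Qa) (St : cpath_alg K Qt) (S' : cpath_alg K Q').
Local Notation Qb := (dsum_quiver Qt Q').

Lemma dsum_inl_faithful : faithful_expansion
  (fun c : arrow Qb => if c is inl a then Some [:: a] else None).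
Proof. by case=> [a|a] u //= [<-]. Qed.
Lemma dsum_inr_faithful : faithful_expansion
  (fun c : arrow Qb => if c is inr a then Some [:: a] else None).
Proof. by case=> [a|a] u //= [<-]. Qed.

Lemma wcoef_dsum w : w != [::] -> wcoef (dsum_pot St S') w =
  oapp (wcoef St) 0 (expand (fun c : arrow Qb => if c is inl a then Some [:: a] else None) w) +
  oapp (wcoef S') 0 (expand (fun c : arrow Qb => if c is inr a then Some [:: a] else None) w).
Proof.
by move=> hw; rewrite wcoefD !wcoef_relabel //;
  [apply: dsum_inr_faithful | apply: dsum_inl_faithful].
Qed.

Hypothesis Qa_loopless : forall u : arrow Qa, src u != tgt u.
Hypothesis W2 : ord_ge 2 W.
Hypotheses (St_pot : is_potential St) (St_triv : trivial_qp St).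
Hypotheses (S'_pot : is_potential S') (S'_red : reduced_qp S').

(** The image of an arrow lies between two distinct idempotents, hence has no component at trivial
    paths. *)
Lemma loopless_hom_arr (Qc : quiver V) (f : {rmorphism cpath_alg K Qa -> cpath_alg K Qc}) u :
  (forall v, f (idem K Qa v) = idem K Qc v) -> ord_ge 1 (f (arr K u)).
Proof.
move=> fi p hp; rewrite -idem_arr -arr_idem !rmorphM !fi idem_mulE mul_idemE.
have -> : pend p = pstart p.
  move: hp; rewrite ltnS leqn0 /plength size_eq0 => /eqP e.
  by rewrite /pend e.
case: (pstart p =P _) => [->|_]; last by rewrite mul0r.
by rewrite (negbTE (Qa_loopless u)) mulr0 mulr0.
Qed.

(** Serves the inverse of a right equivalence, whose source quiver is not yet known to be loopless.
    The constant part of [y] can be read off from that of [f y], since [f] fixes the idempotents. *)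
Lemma hom_inverse_arr (Qc : quiver V) (f : {rmorphism cpath_alg K Qa -> cpath_alg K Qc})
    (y : cpath_alg K Qa) :
  scalable f -> (forall v, f (idem K Qa v) = idem K Qc v) -> ord_ge 1 (f y) -> ord_ge 1 y.
Proof.
move=> fZ fi hy.
pose c v : K := coef y (v, [::]).
have hm : ord_ge 1 (y - \sum_v c v *: idem K Qa v).
  move=> p hp; rewrite cpa_subE cpa_sum.
  have e : parrows p = [::] by apply/eqP; move: hp; rewrite ltnS leqn0 /plength size_eq0.
  rewrite (bigD1 (pstart p)) //= [X in _ - (_ + X)]big1 ?addr0 => [|v hv].
    rewrite cpa_scaleE idemE /plength e !eqxx mulr1.
    by rewrite /c -e coef_qpath subrr.
  by rewrite cpa_scaleE idemE [pstart p == v]eq_sym (negbTE hv) andbF mulr0.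
have hc v : c v = 0.
  have ht : is_path (v, [::] : seq (arrow Qc)) by [].
  have := hom_ord_ge (fun u => loopless_hom_arr u fi) hm.
  move=> /(_ (word_path ht) isT); rewrite rmorphB cpa_subE hy // sub0r.
  rewrite rmorph_sum cpa_sum (bigD1 v) //= big1 ?addr0 => [|u hu].
    rewrite fZ fi cpa_scaleE idemE !eqxx mulr1.
    by move/eqP; rewrite oppr_eq0 => /eqP.
  by rewrite fZ fi cpa_scaleE idemE [pstart _ == u]eq_sym (negbTE hu) andbF mulr0.
by move: hm; rewrite big1 ?subr0 // => v _; rewrite hc scale0r.
Qed.

(* [P] and [Pi] are the linear parts of the right equivalence and of its inverse.
   The span of the linear parts of the cyclic derivatives of [W] is the kernel of
   [P]: it is annihilated, and a linear form [xi] that vanishes on it factors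
   through [P]. *)
Theorem reduction : right_equiv W (dsum_pot St S') ->
  exists (P : arrow Qa -> arrow Q' -> K) (Pi : arrow Q' -> arrow Qa -> K),
  (forall u a, P u a != 0 -> src u = src a /\ tgt u = tgt a) /\
  (forall a u, Pi a u != 0 -> src a = src u /\ tgt a = tgt u) /\
  (forall u a, \sum_v cyc_coef W [:: u; v] * P v a = 0) /\
  (forall xi : arrow Qa -> K, (forall u, \sum_v cyc_coef W [:: u; v] * xi v = 0) ->
     forall u, \sum_a P u a * (\sum_v Pi a v * xi v) = xi u) /\
  (forall a a', \sum_v Pi a v * P v a' = (a == a')%:R) /\
  (forall a b c, cyc_coef S' [:: a; b; c] =
     \sum_u \sum_v \sum_t cyc_coef W [:: u; v; t] * (P u a * P v b * P t c)).
Proof.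
move=> [f [[h fK hK] fZ fi fW]].
have f1 u : ord_ge 1 (f (arr K u)) by apply: loopless_hom_arr.
pose h' : {rmorphism cpath_alg K Qb -> cpath_alg K Qa} :=
  HB.pack h (GRing.isZmodMorphism.Build _ _ h (can2_zmod_morphism fK hK))
    (GRing.isMonoidMorphism.Build _ _ h (can2_monoid_morphism fK hK)).
have hi v : h' (idem K Qb v) = idem K Qa v by rewrite /= -fi fK.
have hZ : scalable h' by move=> k x; apply: (can_inj fK); rewrite /= fZ !hK.
have h1 x : ord_ge 1 (h' (arr K x)).
  by apply: (hom_inverse_arr fZ fi); rewrite /= hK; apply: ord_ge_arr.
pose P u x := wcoef (f (arr K u)) [:: x].
pose Pi x u := wcoef (h' (arr K x)) [:: u].
have PiP x x' : \sum_v Pi x v * P v x' = (x == x')%:R.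
  rewrite -(hom_lin fZ f1) /= ?hK ?wcoef_arr ?eqseq_cons ?andbT 1?eq_sym //.
have PPi u u' : \sum_x P u x * Pi x u' = (u == u')%:R.
  rewrite -(hom_lin hZ h1) /= ?fK ?wcoef_arr ?eqseq_cons ?andbT 1?eq_sym //.
have cW w : cyc_coef (f W) w = cyc_coef (dsum_pot St S') w by apply: cyc_equiv_coef.
have quad x y : \sum_u \sum_v cyc_coef W [:: u; v] * (P u x * P v y) =
    cyc_coef (dsum_pot St S') [:: x; y].
  by rewrite -cW -hom_cyc_quad.
have red a b : cyc_coef S' [:: a; b] = 0.
  rewrite -wcoef_cyc_deriv1 //; case: (wcoefP K [:: b]) => [->//|[p [e _ ->]]].
  by apply: S'_red; rewrite /plength e.
have quad0 x a : cyc_coef (dsum_pot St S') [:: x; inr a] = 0.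
  rewrite cyc_coef2 !wcoef_dsum //; case: x => [t|b] /=; rewrite ?addr0 //.
  by rewrite !add0r -cyc_coef2.
have quadt t t' : cyc_coef (dsum_pot St S') [:: inl t; inl t'] = cyc_coef St [:: t; t'].
  by rewrite !cyc_coef2 !wcoef_dsum //= !addr0.
(* [PPi] undoes [P] in the first index; what remains is the quadratic form of the direct sum, which
   is zero as soon as one argument is an arrow of [Q']. *)
have F1 u a : \sum_v cyc_coef W [:: u; v] * P v (inr a) = 0.
  transitivity (\sum_x Pi x u * \sum_u' \sum_v cyc_coef W [:: u'; v] * (P u' x * P v (inr a))).
    transitivity (\sum_u' (u' == u)%:R * \sum_v cyc_coef W [:: u'; v] * P v (inr a)).
      by rewrite sum_deltal.
    under eq_bigr => u' _ do rewrite -PPi big_distrl.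
    rewrite exchange_big; apply: eq_bigr => x _; rewrite big_distrr.
    by apply: eq_bigr => u' _; rewrite !big_distrr; apply: eq_bigr => v _ /=; ring.
  by rewrite big1 // => x _; rewrite quad quad0 mulr0.
exists (fun u a => P u (inr a)), (fun a => Pi (inr a)).
split; first by move=> u a /(hom_support fi).
split; first by move=> a u /(hom_support hi).
split=> //; split; first last.
  split=> [a a'|a b c]; first by rewrite PiP.
  rewrite -(hom_cyc_cubic fZ fi f1 W2) => [|d u]; last first.
    by rewrite !inE => /or3P[] /eqP->; apply: F1.
  by rewrite cW !cyc_coef3 !wcoef_dsum //= !add0r.
move=> xi hxi u.
pose X x := \sum_v Pi x v * xi v.
have PX v : \sum_x P v x * X x = xi v.
  rewrite -[RHS](sum_delta_sym v xi).
  under [RHS]eq_bigr => v' _ do rewrite -PPi big_distrl.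
  rewrite [RHS]exchange_big; apply: eq_bigr => x _; rewrite [LHS]big_distrr.
  by apply: eq_bigr => v' _ /=; rewrite mulrA.
have DX t : \sum_t' cyc_coef St [:: t; t'] * X (inl t') = 0.
  transitivity (\sum_x cyc_coef (dsum_pot St S') [:: inl t; x] * X x).
    rewrite big_sumType /= [X in _ = _ + X]big1 ?addr0 => [|a _]; last first.
      by rewrite quad0 mul0r.
    by apply: eq_bigr => t' _; rewrite quadt.
  transitivity (\sum_u' P u' (inl t) * \sum_v cyc_coef W [:: u'; v] * \sum_x P v x * X x).
    under eq_bigr => x _ do rewrite -quad big_distrl.
    rewrite exchange_big; apply: eq_bigr => u' _; rewrite big_distrr.
    under eq_bigr => x _ do rewrite big_distrl.
    rewrite exchange_big; apply: eq_bigr => v _; rewrite !big_distrr.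
    by apply: eq_bigr => x _ /=; ring.
  by apply: big1 => u' _; under eq_bigr => v _ do rewrite PX; rewrite hxi mulr0.
(* Triviality writes the arrow [t] as a combination of derivatives of [St], and [X] is orthogonal to
   each of them by [DX]. *)
have tr t : X (inl t) = 0.
  have [n [c [g [hg et]]]] := St_triv.2 t.
  have e t' : (t' == t)%:R = \sum_i c i * wcoef (g i) [:: t'].
    have := wcoef_arr K t [:: t']; rewrite eqseq_cons andbT => <-.
    by rewrite et wcoef_sum; apply: eq_bigr => i _; rewrite wcoefZ.
  rewrite -[LHS](sum_deltal t (fun t' => X (inl t'))).
  under eq_bigr => t' _ do rewrite e big_distrl.
  rewrite exchange_big big1 // => i _; have [a _ eg] := hg i.
  under eq_bigr => t' _ do rewrite /= -eg wcoef_cyc_deriv1 // -mulrA.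
  by rewrite -big_distrr /= DX mulr0.
rewrite -[RHS]PX big_sumType /= [X in _ = X + _]big1 ?add0r // => t _.
by rewrite tr mulr0.
Qed.

End Reduction.

(** * Triangulation quivers and flips *)

Section TriangulationPermutations.
Variables (V X : finType) (s : X -> V) (bar : X -> X).
Implicit Types (f : X -> X) (x y z : X).

Definition bar_spec := (forall x, bar x != x) /\
  forall x y, (s x == s y) = (y == x) || (y == bar x).

(** The last field says that there is a single puncture. Sources and [bar] stay outside the record
    because flips do not change them. *)
Record triangulation_perm f : Prop := TriangulationPerm {
  tperm_f3 : forall x, f (f (f x)) = x;
  tperm_fN : forall x, f x != x;
  tperm_conn : forall x y, fconnect (bar \o f) x y
}.

Hypothesis barP : bar_spec.

Lemma s_bar x : s (bar x) = s x.
Proof. by apply/esym/eqP; rewrite barP.2 eqxx orbT. Qed.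

Lemma s_eqP x y : s x = s y -> y = x \/ y = bar x.
Proof. by move=> /eqP; rewrite barP.2 => /orP[] /eqP; [left | right]. Qed.

Lemma barK x : bar (bar x) = x.
Proof.
case: (s_eqP (s_bar x)) => [e|<-//].
by have := barP.1 x; rewrite -e eqxx.
Qed.

Section Perm.
Variable f : X -> X.
Hypothesis fP : triangulation_perm f.
Let f3 := tperm_f3 fP.
Let fN := tperm_fN fP.
Definition gperm x := bar (f x).
Local Notation g := gperm.

Lemma f_inj : injective f.
Proof. by move=> x y e; rewrite -(f3 x) -(f3 y) e. Qed.

Lemma gperm_neq x : g x != f x.
Proof. exact: barP.1. Qed.

Lemma s_gperm x : s (g x) = s (f x).
Proof. exact: s_bar. Qed.

Lemma bar_gperm x : bar (g x) = f x.
Proof. exact: barK. Qed.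

Lemma gperm_ind (P : X -> Prop) x : P x -> (forall y, P y -> P (g y)) -> forall y, P y.
Proof.
move=> Px Pg y; rewrite -(iter_findex (tperm_conn fP x y)).
by elim: (findex _ _ _) => [//|n]; apply: Pg.
Qed.

(** A loop would make [x] a fixed point of [gperm], hence the only arrow; but [bar x] is another
    one. *)
Lemma s_f_neq x : s (f x) <> s x.
Proof.
move=> e; case: (s_eqP (esym e)) => [|h]; first by apply/eqP/fN.
have gx : g x = x by rewrite /g h barK.
have /eqP := barP.1 x; apply.
by apply: (@gperm_ind (fun y => y = x) x) => // y ->.
Qed.

Lemma s_ff_neq x : s (f (f x)) <> s x.
Proof. by move=> e; apply: (@s_f_neq (f (f x))); rewrite f3. Qed.

(** Apart from two arrows of one triangle, the endpoints leave only [y = g x] and [x = g y]. Then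
    [x] and [y] would be all arrows, but [f x] is neither [x] nor [g x]. *)
Lemma no_two_cycle x y : s (f x) = s y -> s (f y) = s x -> False.
Proof.
move=> exy eyx; case: (s_eqP exy) => ey.
  by move: eyx; rewrite ey; apply: s_ff_neq.
case: (s_eqP eyx) => ex; first by move: exy; rewrite ex; apply: s_ff_neq.
have gP z : z = x \/ z = y.
  by apply: (@gperm_ind (fun z => z = x \/ z = y) x) => [|t [->|->]]; [left|right|left].
case: (gP (f x)) => [|e]; first by apply/eqP/fN.
by have := gperm_neq x; rewrite e /g -ey eqxx.
Qed.

Section Flip.
Variable k : V.

(* The flip keeps the labels, the sources and [bar]. An arrow [a] ending at [k]
   becomes the composite of [a] and [g a]; an arrow [x] starting at [k], or of a
   triangle [x, f x, f (f x)] with [f (f x)] starting at [k], becomes the reverse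
   of [f (f x)]. *)
Definition flip x :=
  if s x == k then f (f x)
  else if s (f x) == k then f (g x)
  else if s (f (f x)) == k then bar (f (f x))
  else f x.

Lemma flip_out x : s x = k -> flip x = f (f x).
Proof. by move=> e; rewrite /flip e eqxx. Qed.

Lemma flip_in x : s (f x) = k -> flip x = f (g x).
Proof.
by move=> e; rewrite /flip e eqxx ifN //; apply/eqP => e'; apply: (@s_f_neq x); rewrite e e'.
Qed.

Lemma flip_opp x : s (f (f x)) = k -> flip x = bar (f (f x)).
Proof.
move=> e; rewrite /flip e eqxx ifN ?ifN //; apply/eqP => e'.
  by apply: (@s_f_neq (f x)); rewrite e e'.
by apply: (@s_ff_neq x); rewrite e e'.
Qed.

Lemma flip_other x : s x <> k -> s (f x) <> k -> s (f (f x)) <> k -> flip x = f x.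
Proof. by rewrite /flip; do 3 case: eqP => //. Qed.

Lemma flip_case x : [\/ s x = k, s (f x) = k, s (f (f x)) = k |
  [/\ s x <> k, s (f x) <> k & s (f (f x)) <> k]].
Proof.
case: (s x =P k); first by constructor 1.
case: (s (f x) =P k); first by constructor 2.
case: (s (f (f x)) =P k); first by constructor 3.
by constructor 4.
Qed.

Lemma flip_perm : triangulation_perm flip.
Proof.
have hin x : s (f x) = k -> flip (flip (flip x)) = x.
  move=> e; have e2 : flip (f (g x)) = f x by rewrite flip_opp f3 ?bar_gperm ?s_gperm.
  by rewrite (flip_in e) e2 flip_out.
have hopp x : s (f (f x)) = k -> flip (flip (flip x)) = x.
  move=> e; rewrite (flip_opp e) [flip (bar _)]flip_out ?s_bar // flip_in ?f3 ?s_bar //.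
  by rewrite /gperm f3 barK f3.
split.
- move=> x; case: (flip_case x) => [e|e|e|[e1 e2 e3]].
  + rewrite (flip_out e) [flip (f _)]flip_in ?f3 // flip_opp ?f3 ?s_gperm ?f3 //.
    by rewrite bar_gperm f3.
  + exact: hin.
  + exact: hopp.
  + by rewrite (flip_other e1 e2 e3) (flip_other e2 e3) ?f3 // flip_other ?f3.
- move=> x; case: (flip_case x) => [e|e|e|[e1 e2 e3]].
  + by rewrite (flip_out e); apply/eqP => e'; apply: (@s_ff_neq x); rewrite e'.
  + rewrite (flip_in e); apply/eqP => e'; apply: (@no_two_cycle x (g x)); by rewrite ?s_gperm ?e'.
  + rewrite (flip_opp e); apply/eqP => e'; apply: (@s_ff_neq x); rewrite -[in RHS]e'.
    by rewrite s_bar.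
  + by rewrite (flip_other e1 e2 e3).
have go x y : s x <> k -> s y <> k -> fconnect (bar \o flip) x y.
  move=> hx hy.
  (* From an arrow [a] ending at [k] the cycle of the flip jumps to [g (g a)]. As it skips [g a],
     the invariant records at an arrow starting at [k] its predecessor under [gperm] instead. *)
  pose P z := if s z == k then exists a, [/\ s (f a) = k, g a = z & fconnect (bar \o flip) x a]
    else fconnect (bar \o flip) x z : Prop.
  suff : P y by rewrite /P; case: eqP.
  have step z w : fconnect (bar \o flip) x z -> bar (flip z) = w -> fconnect (bar \o flip) x w.
    by move=> h <-; apply: connect_trans h (fconnect1 _ _).
  apply: (@gperm_ind P x) => [|z]; first by rewrite /P; case: eqP.
  rewrite /P; case: eqP => [e [a [e1 e2 h]]|ne h].
    rewrite ifN; first by apply: step h _; rewrite (flip_in e1) e2.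
    by apply/eqP => e'; apply: (@s_f_neq z); rewrite -s_gperm e' e.
  rewrite s_gperm; case: (flip_case z) => [//|e|e|[e1 e2 e3]].
  - by rewrite e eqxx; exists z.
  - rewrite ifN; last by apply/eqP => e'; apply: (@s_f_neq (f z)); rewrite e e'.
    (* Opposite to [k], one step of [gperm] becomes two: first to [f (f z)], which starts at [k],
       then to [g z]. *)
    apply: (step (f (f z))); last by rewrite flip_out // f3.
    by apply: step h _; rewrite (flip_opp e) barK.
  - by rewrite (negbTE (introN eqP e2)); apply: step h _; rewrite (flip_other e1 e2 e3).
have go' x y : s x <> k -> fconnect (bar \o flip) x y.
  move=> hx; case: (s y =P k) => [hy|]; last exact: go.
  apply: (connect_trans (go x (f y) hx _)); first by rewrite -hy; apply: s_f_neq.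
  have {2}<- : bar (flip (f y)) = y by rewrite flip_opp ?f3 // barK.
  exact: fconnect1.
move=> x y; case: (s x =P k) => [hx|]; last exact: go'.
apply: (connect_trans (fconnect1 _ _)); apply: go' => /=.
rewrite (flip_out hx) s_bar -hx; exact: s_ff_neq.
Qed.

End Flip.
End Perm.
End TriangulationPermutations.

(** * Cubic forms in dual frames *)

Section Contractions.
Local Open Scope ring_scope.
Variables (K : fieldType).

Definition contract3 (I : finType) (D : I -> I -> I -> K) (p q r : I -> K) : K :=
  \sum_a p a * \sum_b q b * \sum_c r c * D a b c.

Section OneIndex.
Variables (I : finType) (D : I -> I -> I -> K).
Implicit Types p q r : I -> K.

Lemma eq_contract3 p q r p' q' r' : p =1 p' -> q =1 q' -> r =1 r' ->
  contract3 D p q r = contract3 D p' q' r'.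
Proof.
move=> ep eq er; apply: eq_bigr => a _; rewrite ep; congr (_ * _).
apply: eq_bigr => b _; rewrite eq; congr (_ * _).
by apply: eq_bigr => c _; rewrite er.
Qed.

Lemma contract3_eq0 p q r :
  (forall a b c, p a != 0 -> q b != 0 -> r c != 0 -> D a b c = 0) ->
  contract3 D p q r = 0.
Proof.
move=> h; apply: big1 => a _; case: (eqVneq (p a) 0) => [->|pa]; first by rewrite mul0r.
rewrite big1 ?mulr0 // => b _; case: (eqVneq (q b) 0) => [->|qb]; first by rewrite mul0r.
rewrite big1 ?mulr0 // => c _; case: (eqVneq (r c) 0) => [->|rc]; first by rewrite mul0r.
by rewrite h ?mulr0.
Qed.

Lemma contract3_neq0 p q r : contract3 D p q r != 0 ->
  exists a b c, [/\ p a != 0, q b != 0, r c != 0 & D a b c != 0].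
Proof.
move=> h; apply: contrapT => hn; case/eqP: h; apply: contract3_eq0 => a b c pa qb rc.
by apply/eqP; apply: contrapT => /negP hd; apply: hn; exists a, b, c.
Qed.

Lemma contract3_sum p q r : contract3 D p q r =
  \sum_a \sum_b \sum_c p a * q b * r c * D a b c.
Proof.
apply: eq_bigr => a _; rewrite big_distrr; apply: eq_bigr => b _ /=.
rewrite mulrA big_distrr; apply: eq_bigr => c _ /=; by rewrite !mulrA.
Qed.

Lemma contract3_rot p q r : (forall a b c, D a b c = D b c a) ->
  contract3 D p q r = contract3 D q r p.
Proof.
move=> h; rewrite !contract3_sum exchange_big; apply: eq_bigr => b _ /=.
rewrite exchange_big; apply: eq_bigr => c _ /=; apply: eq_bigr => a _.
by rewrite h; ring.
Qed.

Lemma contract3_subl p p' l q r :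
  contract3 D (fun a => p a - l * p' a) q r = contract3 D p q r - l * contract3 D p' q r.
Proof.
rewrite /contract3 big_distrr -sumrB; apply: eq_bigr => a _ /=; ring.
Qed.
End OneIndex.

Lemma contract3_pull (I J : finType) (D : I -> I -> I -> K) (P : I -> J -> K) (p q r : J -> K) :
  contract3 (fun a b c => contract3 D (P^~ a) (P^~ b) (P^~ c)) p q r =
  contract3 D (fun u => \sum_a P u a * p a) (fun u => \sum_a P u a * q a)
    (fun u => \sum_a P u a * r a).
Proof.
have pull (p' : J -> K) (F : J -> I -> K) (G : I -> K) :
    \sum_a p' a * \sum_u P u a * G u = \sum_u (\sum_a P u a * p' a) * G u.
  under eq_bigr => a _ do rewrite big_distrr.
  rewrite exchange_big; apply: eq_bigr => u _; rewrite big_distrl.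
  by apply: eq_bigr => a _ /=; ring.
have swap (p' : J -> K) (H : I -> J -> K) (G : I -> K) :
    \sum_a p' a * \sum_u G u * H u a = \sum_u G u * \sum_a p' a * H u a.
  under eq_bigr => a _ do rewrite big_distrr.
  rewrite exchange_big; apply: eq_bigr => u _; rewrite big_distrr.
  by apply: eq_bigr => a _ /=; ring.
rewrite /contract3.
under eq_bigr => a _.
  under eq_bigr => b _.
    rewrite swap.
    under eq_bigr => u _.
      rewrite swap.
      under eq_bigr => v _ do rewrite (pull _ (fun _ _ => 0)).
      over.
    over.
  rewrite swap.
  under eq_bigr => u _ do rewrite (pull _ (fun _ _ => 0)).
  over.
by rewrite (pull _ (fun _ _ => 0)).
Qed.

Section Frames.
Variables (I X : finType).
Implicit Types (th : I -> X -> K) (et : X -> I -> K).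

Definition dual_frames th et :=
  (forall a a', \sum_x th a x * et x a' = (a == a')%:R) /\
  (forall x x', \sum_a et x a * th a x' = (x == x')%:R).

Lemma frame_expand th et (F : I -> K) a : dual_frames th et ->
  F a = \sum_x et x a * \sum_a' th a' x * F a'.
Proof.
case=> h _; rewrite -[LHS](sum_deltal a F).
under eq_bigr => a' _ do rewrite -h big_distrl.
rewrite exchange_big; apply: eq_bigr => x _; rewrite [RHS]big_distrr.
by apply: eq_bigr => a' _ /=; ring.
Qed.

(** A trilinear form is determined by its values on a frame; the three indices are expanded one at a
    time. *)
Lemma frame_cubic th et (D : I -> I -> I -> K) (f : X -> X) : dual_frames th et ->
  (forall x y z, contract3 D (th^~ x) (th^~ y) (th^~ z) =
     ((y == f x) && (z == f y))%:R) ->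
  forall a b c, D a b c = \sum_x et x a * et (f x) b * et (f (f x)) c.
Proof.
move=> h hT a b c; rewrite (frame_expand (D^~ b^~ c) a h); apply: eq_bigr => x _.
rewrite -mulrA; congr (_ * _).
rewrite (frame_expand (fun b => \sum_a' th a' x * D a' b c) b h) -(sum_deltal (f x)
  (fun y => et y b * et (f y) c)); apply: eq_bigr => y _.
rewrite mulrCA; congr (_ * _).
rewrite (frame_expand (fun c => \sum_b' th b' y * \sum_a' th a' x * D a' b' c) c h).
rewrite -(sum_deltal (f y) (fun z => et z c)) big_distrr; apply: eq_bigr => z _ /=.
rewrite [in RHS]mulrA -natrM mulnb [RHS]mulrC -hT; congr (_ * _).
rewrite contract3_sum.
under eq_bigr => c' _ do rewrite big_distrr.
under eq_bigr => c' _ do under eq_bigr => b' _ do rewrite big_distrr big_distrr.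
rewrite exchange_big; under eq_bigr => b' _ do rewrite exchange_big.
rewrite exchange_big; apply: eq_bigr => a' _ /=; apply: eq_bigr => b' _; apply: eq_bigr => c' _ /=.
by ring.
Qed.

(* The change of frame is unipotent, because [w] maps the support of [l] out of
   [A]. *)
Lemma frame_change th et (A : pred X) (l : X -> K) (w : X -> X) : dual_frames th et ->
  (forall x, l x != 0 -> A x && ~~ A (w x)) ->
  dual_frames (fun a x => th a x - l x * th a (w x))
    (fun x a => et x a + \sum_y (w y == x)%:R * (l y * et y a)).
Proof.
move=> [h1 h2] hl.
have ll x : l x * l (w x) = 0.
  case: (eqVneq (l x) 0) => [->|hx]; first by rewrite mul0r.
  case: (eqVneq (l (w x)) 0) => [->|hw]; first by rewrite mulr0.
  by have /andP[_ /negP] := hl _ hx; case; case/andP: (hl _ hw).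
have lw x y : l x * l y * (y == w x)%:R = 0.
  by case: eqP => [->|]; rewrite ?ll ?mul0r ?mulr0.
split=> [a a'|x x'] /=.
  rewrite -h1; pose F x := \sum_y (w y == x)%:R * (l y * et y a').
  transitivity (\sum_x th a x * et x a' + (\sum_x th a x * F x - \sum_x l x * th a (w x) * et x a')
     - \sum_x l x * th a (w x) * F x).
    rewrite -sumrB -big_split -sumrB; apply: eq_bigr => x _ /=; rewrite /F; ring.
  rewrite (_ : \sum_x th a x * F x = \sum_x l x * th a (w x) * et x a'); last first.
    under eq_bigr => x _ do rewrite /F big_distrr.
    rewrite exchange_big; apply: eq_bigr => y _.
    rewrite -[RHS](sum_delta_sym (w y) (fun x => l y * th a x * et y a')).
    by apply: eq_bigr => x _ /=; ring.
  rewrite [X in _ - X]big1 ?subrr ?addr0 ?subr0 // => x _.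
  rewrite /F big_distrr big1 // => y _ /=.
  transitivity ((l y * l x * (x == w y)%:R) * (th a (w x) * et y a')); last by rewrite lw mul0r.
  by rewrite eq_sym; ring.
rewrite -h2; pose F a := \sum_y (w y == x)%:R * (l y * et y a).
transitivity (\sum_a et x a * th a x' - l x' * (\sum_a et x a * th a (w x'))
   + \sum_a F a * th a x' - l x' * \sum_a F a * th a (w x')).
  rewrite !big_distrr -sumrB -big_split -sumrB; apply: eq_bigr => a _ /=; rewrite /F; ring.
have EF z : \sum_a F a * th a z = (w z == x)%:R * l z.
  rewrite -[RHS](sum_deltal z (fun z => (w z == x)%:R * l z)).
  under eq_bigr => a _ do rewrite /F big_distrl.
  rewrite exchange_big; apply: eq_bigr => y _ /=; rewrite -(h2 y z) [RHS]big_distrl.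
  by apply: eq_bigr => a _ /=; ring.
rewrite !EF !h2 [l x' * (_ * l (w x'))]mulrCA ll mulr0 subr0 [x == w x']eq_sym; ring.
Qed.

End Frames.
End Contractions.

(** * Cubic parts under mutation *)

(* [x] stands for the linear combination of the arrows [a] with coefficients
   [et x a], and [th] is the inverse change of arrows; up to cyclic equivalence
   the cubic part of [S] is the sum of the triangles [x, f x, f (f x)]. *)
Record compatible (K : fieldType) (V X : finType) (s : X -> V) (f : X -> X)
    (Q : quiver V) (S : cpath_alg K Q) (th : arrow Q -> X -> K) (et : X -> arrow Q -> K)
    : Prop := Compatible {
  compat_th : forall a x, th a x != 0%R -> src a = s x /\ tgt a = s (f x);
  compat_et : forall x a, et x a != 0%R -> s x = src a /\ s (f x) = tgt a;
  compat_dual : dual_frames th et;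
  compat_cubic : forall a b c, cyc_coef S [:: a; b; c] =
    (\sum_x et x a * et (f x) b * et (f (f x)) c)%R
}.

Lemma sum_sig (R : nmodType) (T : finType) (P : pred T) (G : T -> R) :
  (forall a, ~~ P a -> G a = 0%R) -> (\sum_(a : {a | P a}) G (val a) = \sum_a G a)%R.
Proof.
move=> h; rewrite [RHS](bigID P) /= [X in (_ + X)%R]big1 // GRing.addr0.
rewrite (reindex_omap (fun x : {a | P a} => val x) insub) /= => [|a Pa].
  by apply: eq_bigl => a; rewrite valK eqxx andbT; exact/esym/(valP a).
by rewrite insubT.
Qed.

Section Premutation.
Local Open Scope ring_scope.
Variables (K : fieldType) (V X : finType) (s : X -> V) (bar : X -> X).
Hypothesis barP : bar_spec s bar.
Variable f : X -> X.
Hypothesis fP : triangulation_perm bar f.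
Variables (Q : quiver V) (S : cpath_alg K Q).
Variables (th : arrow Q -> X -> K) (et : X -> arrow Q -> K).
Hypothesis Sc : compatible s f S th et.

Let thS := compat_th Sc.
Let etS := compat_et Sc.
Let th_et := (compat_dual Sc).1.
Let et_th := (compat_dual Sc).2.

(** The row of [th] at [a] cannot vanish, as its product with [et] is 1; any nonzero entry names a
    model arrow with the same endpoints. *)
Lemma arrow_model (a : arrow Q) : exists x, src a = s x /\ tgt a = s (f x).
Proof.
have [x hx] : exists x, th a x != 0.
  apply: contrapT => h; have := th_et a a; rewrite eqxx big1.
    by move/eqP; rewrite eq_sym oner_eq0.
  move=> x _; case: (eqVneq (th a x) 0) => [->|hx]; first by rewrite mul0r.
  by case: h; exists x.
by exists x; apply: thS.
Qed.

Lemma compatible_acyclic : two_acyclic Q.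
Proof.
move=> a b [e1 e2]; have [x [sx tx]] := arrow_model a; have [y [sy ty]] := arrow_model b.
by apply: (@no_two_cycle _ _ _ _ barP _ fP x y); rewrite -?tx -?ty ?e1 ?e2.
Qed.

Lemma compatible_loopless (a : arrow Q) : src a <> tgt a.
Proof. by move=> e; apply: (@compatible_acyclic a a). Qed.

(** * Quadratic and cubic coefficients of the premutation *)

Variables (k : V) (S0 : cpath_alg K Q).
Hypothesis S0_pot : is_potential S0.
Hypothesis S0S : forall w, cyc_coef S0 w = cyc_coef S w.
Hypothesis S0k : forall p, pstart p = k -> S0 p = 0.

Local Notation Qm := (premutation k Q).
Definition premut : cpath_alg K Qm := @premutation_pot K V k Q S0.
Local Notation W := premut.
Local Notation KK := (kept k Q).
Local Notation CC := (composite k Q).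
Local Notation RR := (reversed k Q).
Definition kept_arr (a : KK) : arrow Qm := inl (inl a).
Definition comp_arr (a : CC) : arrow Qm := inl (inr a).
Definition rev_arr (a : RR) : arrow Qm := inr a.

Lemma unbracket_faithful : faithful_expansion (@unbracket V k Q).
Proof.
case=> [[a|ab]|a] u //= [<-] //=; split=> //.
by have /andP[/eqP e1 /eqP e2] := valP ab; rewrite /composable /= e1 e2 eqxx.
Qed.

Definition mut_tail : cpath_alg K Qm :=
  \sum_(ab : CC) \sum_(b : RR | val b == (val ab).2)
      \sum_(a : RR | val a == (val ab).1) arr K (comp_arr ab) * arr K (rev_arr b) * arr K (rev_arr a).

Lemma premutE : W = relabel (@unbracket V k Q) S0 + mut_tail. Proof. by []. Qed.

Lemma mut_tail_term (ab : CC) (b a : RR) w :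
  wcoef (arr K (comp_arr ab) * arr K (rev_arr b) * arr K (rev_arr a)) w =
  (sorted (@composable V Qm) w && (w == [:: comp_arr ab; rev_arr b; rev_arr a]))%:R.
Proof.
have := @wcoef_prod K V Qm [:: comp_arr ab; rev_arr b; rev_arr a] w isT.
by rewrite !big_cons big_nil mulr1 mulrA.
Qed.

(** The shape [[ab] b* a*] of the terms added by the premutation; in this rotation only do they have
    a coefficient. *)
Definition is_crr (w : seq (arrow Qm)) :=
  if w is [:: inl (inr _); inr _; inr _] then true else false.

Lemma mut_tail0 w : ~~ is_crr w -> wcoef mut_tail w = 0.
Proof.
move=> h; rewrite /mut_tail wcoef_sum big1 // => ab _; rewrite wcoef_sum big1 // => b _.
rewrite wcoef_sum big1 // => a _; rewrite mut_tail_term.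
by case: eqP => [e|]; rewrite ?andbF //; move: h; rewrite e.
Qed.

Lemma mut_tail1 (ab : CC) (b a : RR) : wcoef mut_tail [:: comp_arr ab; rev_arr b; rev_arr a] =
  ((val b == (val ab).2) && (val a == (val ab).1))%:R.
Proof.
rewrite /mut_tail wcoef_sum (bigD1 ab) //= [X in _ + X]big1 => [|ab' hab]; last first.
  rewrite wcoef_sum big1 // => b' _; rewrite wcoef_sum big1 // => a' _.
  rewrite mut_tail_term; case: eqP => [[e]|]; rewrite ?andbF //.
  by rewrite e eqxx in hab.
rewrite addr0 wcoef_sum.
have hz b' a' : (b' != b) || (a' != a) ->
    wcoef (arr K (comp_arr ab) * arr K (rev_arr b') * arr K (rev_arr a')) [:: comp_arr ab; rev_arr b; rev_arr a] = 0.
  move=> hba; rewrite mut_tail_term; case: eqP => [[e1 e2]|]; rewrite ?andbF //.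
  by move: hba; rewrite e1 e2 !eqxx.
case: (eqVneq (val b) (val ab).2) => [eb|nb]; last first.
  rewrite big1 // => b' hb'; rewrite wcoef_sum big1 // => a' _; apply: hz.
  by apply/orP; left; apply: contraNneq nb => <-.
rewrite (bigD1 b) ?eb //= [X in _ + X]big1 ?addr0 => [|b' /andP[_ hb']]; last first.
  by rewrite wcoef_sum big1 // => a' _; rewrite hz // hb'.
rewrite wcoef_sum; case: (eqVneq (val a) (val ab).1) => [ea|na]; last first.
  rewrite big1 // => a' ha'; apply: hz; apply/orP; right.
  by apply: contraNneq na => <-.
rewrite (bigD1 a) ?ea //= big1 ?addr0 => [|a' /andP[_ ha']]; last first.
  by rewrite hz // ha' orbT.
have /andP[/eqP h1 /eqP h2] := valP ab.
by rewrite mut_tail_term /= eqxx /composable /= ea eb h1 h2 !eqxx.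
Qed.

Lemma premut_pot : is_potential W.
Proof.
move=> p; rewrite premutE cpa_addE => hp.
have [h|h] := eqVneq (relabel (@unbracket V k Q) S0 p) 0; last first.
  exact: (relabel_potential unbracket_faithful S0_pot).
move: hp; rewrite h add0r /mut_tail cpa_sum => hp.
have [ab [b [a [e1 e2 e3]]]] : exists ab (b a : RR), [/\ val b = (val ab).2, val a = (val ab).1 &
    (arr K (comp_arr ab) * arr K (rev_arr b) * arr K (rev_arr a)) p != 0].
  apply: contrapT => hn; case/eqP: hp; apply: big1 => ab _; rewrite cpa_sum big1 // => b /eqP eb.
  rewrite cpa_sum big1 // => a /eqP ea; apply/eqP; apply: contrapT => /negP hc.
  by apply: hn; exists ab, b, a.
have ne : parrows p != [::].
  apply: contraNneq e3 => e; have := @ord_geM K V Qm 2 1 _ _ (@ord_geM _ _ _ 1 1 _ _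
    (@ord_ge_arr K V Qm (comp_arr ab)) (@ord_ge_arr K V Qm (rev_arr b))) (@ord_ge_arr K V Qm (rev_arr a)).
  by move=> ->; rewrite // /plength e.
move: e3; rewrite -wcoefE // mut_tail_term; case: (_ =P [:: comp_arr ab; rev_arr b; rev_arr a]) => [e _|].
  rewrite /is_cycle /plength /pend e word_end_cons (pstartE e) /= e2 //.
by rewrite andbF eqxx.
Qed.

Lemma S0_ord : ord_ge 3 S0.
Proof.
move=> p; case: (eqVneq (S0 p) 0) => // /S0_pot hc.
have /andP[h1 _] := hc; move: h1; rewrite /plength; case E: (parrows p) => [|a [|b [|]]] //= _ _.
  by have := cycle_arrows E hc; rewrite /= /composable /= andbT => /eqP /esym /compatible_loopless.
have := cycle_arrows E hc; rewrite /= /composable /= andbT => /andP[/eqP h1 /eqP h2].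
by case: (@compatible_acyclic a b).
Qed.

Lemma wcoef_S0_k a w : src a = k -> wcoef S0 (a :: w) = 0.
Proof.
move=> e; case: (wcoefP K (a :: w)) => [->//|[p [ep _ ->]]].
by apply: S0k; rewrite (pstartE ep).
Qed.

Lemma premut_wcoef w : w != [::] -> ~~ is_crr w ->
  wcoef W w = oapp (wcoef S0) 0 (expand (@unbracket V k Q) w).
Proof.
move=> hw hc; rewrite premutE wcoefD mut_tail0 // addr0 wcoef_relabel //.
exact: unbracket_faithful.
Qed.

Lemma wcoef_S0_short w : (size w < 3)%N -> wcoef S0 w = 0.
Proof. exact: ord_ge_wcoef S0_ord. Qed.

Lemma composite_ends (ab : CC) : src (val ab).2 = k /\ tgt (val ab).1 = k.
Proof. by have /andP[/eqP -> /eqP ->] := valP ab. Qed.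

Lemma composite_neq (ab : CC) : src (val ab).1 <> tgt (val ab).2.
Proof.
have [e1 e2] := composite_ends ab => e.
by apply: (@compatible_acyclic (val ab).1 (val ab).2); rewrite e1 e2 e.
Qed.

Lemma premutation_loopless (u : arrow Qm) : src u != tgt u.
Proof.
apply/eqP; case: u => [[a|ab]|a] /=; first exact: compatible_loopless.
  exact: composite_neq.
by move=> /esym; apply: compatible_loopless.
Qed.

Lemma premut_ord : ord_ge 2 W.
Proof.
move=> p; case: (eqVneq (W p) 0) => // /premut_pot hc; have /andP[h1 _] := hc; move: h1.
rewrite /plength; case E: (parrows p) => [|a [|]] //= _ _.
have := cycle_arrows E hc; rewrite /= /composable /= andbT => /eqP e.
by case: (elimN eqP (premutation_loopless a) (esym e)).
Qed.

(** The whole quadratic part: a triangle through [k] shrinks to a 2-cycle of a kept arrow and a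
    composite. The other pairings vanish: two kept arrows would be a 2-cycle of [Q], two composites
    would contain one, and reversed arrows occur in degree three only. *)
Lemma premut_quad_kc (a : KK) (bc : CC) :
  cyc_coef W [:: kept_arr a; comp_arr bc] = cyc_coef S [:: val a; (val bc).1; (val bc).2].
Proof.
(* Three rotations match two because the third starts at [k], where [S0] has no terms. *)
rewrite -S0S cyc_coef2 cyc_coef3 !premut_wcoef //= [X in _ = _ + X]wcoef_S0_k ?addr0 //.
exact: (composite_ends bc).1.
Qed.

Lemma premut_quad_ck (a : KK) (bc : CC) :
  cyc_coef W [:: comp_arr bc; kept_arr a] = cyc_coef S [:: val a; (val bc).1; (val bc).2].
Proof. by rewrite cyc_coef2C premut_quad_kc. Qed.

Lemma premut_quad_kk (a b : KK) : cyc_coef W [:: kept_arr a; kept_arr b] = 0.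
Proof. by rewrite cyc_coef2 !premut_wcoef //= !wcoef_S0_short // addr0. Qed.

Lemma premut_quad_cc (ab cd : CC) : cyc_coef W [:: comp_arr ab; comp_arr cd] = 0.
Proof.
apply/eqP; apply: contraTT isT => /(cyc_coef_cycle premut_pot).
rewrite /= /composable /= andbT => /andP[/eqP e1 /eqP e2].
have [x1 x2] := composite_ends ab; have [y1 y2] := composite_ends cd.
by case: (@compatible_acyclic (val ab).2 (val cd).1); rewrite e1 x1 y2.
Qed.

Lemma premut_quad_r (u : arrow Qm) (a : RR) :
  cyc_coef W [:: u; rev_arr a] = 0 /\ cyc_coef W [:: rev_arr a; u] = 0.
Proof.
suff h : cyc_coef W [:: u; rev_arr a] = 0 by split=> //; rewrite cyc_coef2C.
by rewrite cyc_coef2 !premut_wcoef //=; case: u => [[b|bc]|b] //=; rewrite addr0.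
Qed.

Lemma premut_cubic_kkk (a b c : KK) :
  cyc_coef W [:: kept_arr a; kept_arr b; kept_arr c] = cyc_coef S [:: val a; val b; val c].
Proof. by rewrite -S0S !cyc_coef3 !premut_wcoef. Qed.

Lemma premut_cubic_crr (ab : CC) (b a : RR) : cyc_coef W [:: comp_arr ab; rev_arr b; rev_arr a] =
  ((val b == (val ab).2) && (val a == (val ab).1))%:R.
Proof.
rewrite cyc_coef3 -mut_tail1 [X in X + _ + _]wcoefD wcoef_relabel //=; last first.
  exact: unbracket_faithful.
by rewrite !premut_wcoef //= add0r !addr0.
Qed.

Lemma premut_cubic_mixed (u v : arrow Qm) (a : RR) : ~~ is_crr [:: u; v; rev_arr a] ->
  ~~ is_crr [:: v; rev_arr a; u] -> ~~ is_crr [:: rev_arr a; u; v] ->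
  cyc_coef W [:: u; v; rev_arr a] = 0.
Proof.
move=> h1 h2 h3; rewrite cyc_coef3 !premut_wcoef //=.
by case: u {h1 h2 h3} => [[b|bc]|b]; case: v => [[b'|bc']|b'] /=; rewrite !addr0.
Qed.

(** * The arrows of the flip as coordinates on the premutation *)

Local Notation g := (gperm bar f).
Local Notation f' := (flip s bar f k).
Let f3 := tperm_f3 fP.

(** The three classes match the kinds of arrows of the premutation: an arrow of the flip is carried
    by kept arrows if its old triangle avoids [k], by composites if it ended at [k], and by reversed
    arrows if it started at [k] or lay opposite to it. *)
Definition other x := [&& s x != k, s (f x) != k & s (f (f x)) != k].
Definition incoming x := s (f x) == k.
Definition dualized x := (s x == k) || (s (f (f x)) == k).

Variant class_spec x : bool -> bool -> bool -> Type :=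
  | ClassOther of s x <> k & s (f x) <> k & s (f (f x)) <> k : class_spec x true false false
  | ClassIncoming of s (f x) = k : class_spec x false true false
  | ClassDualized of s x = k \/ s (f (f x)) = k : class_spec x false false true.

Lemma classP x : class_spec x (other x) (incoming x) (dualized x).
Proof.
rewrite /other /incoming /dualized.
case: (s (f x) =P k) => [e|n1].
  have -> : (s x == k) = false by apply/eqP => e'; apply: (s_f_neq barP fP (x := x)); rewrite e e'.
  have -> : (s (f (f x)) == k) = false.
    by apply/eqP => e'; apply: (s_f_neq barP fP (x := f x)); rewrite e e'.
  by constructor.
case: (s x =P k) => [e|n2]; first by constructor; left.
case: (s (f (f x)) =P k) => [e|n3]; first by constructor; right.
by constructor.
Qed.

(* [coord0^~ x] is the coordinate of the arrow [x] of the flip on the arrows of the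
   premutation, and [vec0 x] is the dual vector. The coordinates vanish on the
   span of the linear parts of the derivatives of the premutation, which
   corresponds to the triangle sides opposite to [k] and the composites of
   [a] and [f a]. *)
Definition coord0 (u : arrow Qm) (x : X) : K :=
  match u with
  | inl (inl a) => if other x then th (val a) x else 0
  | inl (inr ab) => if incoming x then th (val ab).1 x * th (val ab).2 (g x) else 0
  | inr a => if dualized x then et (f (f x)) (val a) else 0
  end.

Definition vec0 (x : X) (u : arrow Qm) : K :=
  match u with
  | inl (inl a) => if other x then et x (val a) else 0
  | inl (inr ab) => if incoming x then et x (val ab).1 * et (g x) (val ab).2 else 0
  | inr a => if dualized x then th (val a) (f (f x)) else 0
  end.

Lemma neq0_mul (a b : K) : a * b != 0 -> a != 0 /\ b != 0.
Proof. by rewrite mulf_eq0 negb_or => /andP. Qed.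

Lemma dualized_ends x : dualized x -> s (f' x) = s (f (f x)).
Proof.
case/orP => /eqP e; first by rewrite (flip_out _ _ e).
by rewrite (flip_opp barP fP e) s_bar.
Qed.

Lemma coord0_supp u x : coord0 u x != 0 -> src u = s x /\ tgt u = s (f' x).
Proof.
case: u => [[a|ab]|a] /=.
- case: classP => [e1 e2 e3|_|_]; rewrite ?eqxx // => /thS[-> ->].
  by rewrite flip_other.
- case: classP => [_ _ _|e|_]; rewrite ?eqxx // => /neq0_mul[/thS[-> _] /thS[_ ->]].
  by rewrite (flip_in barP fP e).
- case E: (dualized x); rewrite ?eqxx // => /etS[<- <-].
  by rewrite f3 (dualized_ends E).
Qed.

Lemma vec0_supp x u : vec0 x u != 0 -> s x = src u /\ s (f' x) = tgt u.
Proof.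
case: u => [[a|ab]|a] /=.
- case: classP => [e1 e2 e3|_|_]; rewrite ?eqxx // => /etS[<- <-].
  by rewrite flip_other.
- case: classP => [_ _ _|e|_]; rewrite ?eqxx // => /neq0_mul[/etS[<- _] /etS[_ <-]].
  by rewrite (flip_in barP fP e).
- case E: (dualized x); rewrite ?eqxx // => /thS[-> ->].
  by rewrite f3 (dualized_ends E).
Qed.

Lemma sum_Qm (F : arrow Qm -> K) :
  \sum_u F u = \sum_a F (kept_arr a) + \sum_ab F (comp_arr ab) + \sum_a F (rev_arr a).
Proof. by rewrite big_sumType /= big_sumType. Qed.

Lemma sum_kept (G : arrow Q -> K) :
  (forall a, src a = k \/ tgt a = k -> G a = 0) -> \sum_(a : KK) G (val a) = \sum_a G a.
Proof.
move=> h; apply: sum_sig => a; rewrite negb_and !negbK => /orP h'; apply: h.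
by case: h' => /eqP; [left | right].
Qed.

Lemma sum_reversed (G : arrow Q -> K) :
  (forall a, src a <> k -> tgt a <> k -> G a = 0) -> \sum_(a : RR) G (val a) = \sum_a G a.
Proof.
move=> h; apply: sum_sig => a; rewrite negb_or => /andP[/eqP h1 /eqP h2]; exact: h.
Qed.

Lemma sum_composite (G : arrow Q -> arrow Q -> K) :
  (forall a b, tgt a <> k \/ src b <> k -> G a b = 0) ->
  \sum_(ab : CC) G (val ab).1 (val ab).2 = \sum_a \sum_b G a b.
Proof.
move=> h; rewrite pair_bigA /= -(@sum_sig _ _ (fun p => (tgt p.1 == k) && (src p.2 == k)) (fun p => G p.1 p.2)) // => p.
by rewrite negb_and => /orP h'; apply: h; case: h' => /eqP; [left | right].
Qed.

Lemma contract_a b c x :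
  \sum_a cyc_coef S [:: a; b; c] * th a x = et (f x) b * et (f (f x)) c.
Proof.
rewrite -[RHS](sum_deltal x (fun y => et (f y) b * et (f (f y)) c)).
under eq_bigr => a _ do rewrite (compat_cubic Sc) big_distrl.
rewrite exchange_big; apply: eq_bigr => y _; rewrite -et_th [RHS]big_distrl.
by apply: eq_bigr => a _ /=; ring.
Qed.

Lemma contract_bc a x z :
  \sum_b \sum_c cyc_coef S [:: a; b; c] * (th b x * th c z) = (z == f x)%:R * et (f (f x)) a.
Proof.
transitivity (\sum_c (\sum_b cyc_coef S [:: b; c; a] * th b x) * th c z).
  rewrite exchange_big; apply: eq_bigr => c _; rewrite big_distrl.
  by apply: eq_bigr => b _ /=; rewrite (cyc_coef3_rot S a b c) mulrA.
under eq_bigr => c _ do rewrite contract_a mulrAC.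
by rewrite -big_distrl /= et_th eq_sym.
Qed.

Lemma contract_abc x y z :
  contract3 (fun a b c => cyc_coef S [:: a; b; c]) (th^~ x) (th^~ y) (th^~ z) =
  ((y == f x) && (z == f y))%:R.
Proof.
transitivity (\sum_a th a x * ((z == f y)%:R * et (f (f y)) a)).
  rewrite /contract3; apply: eq_bigr => a _; congr (_ * _); rewrite -contract_bc.
  apply: eq_bigr => b _; rewrite big_distrr; apply: eq_bigr => c _ /=; ring.
transitivity ((z == f y)%:R * \sum_a et (f (f y)) a * th a x).
  by rewrite big_distrr; apply: eq_bigr => a _ /=; ring.
rewrite et_th -natrM mulnb andbC; congr ((nat_of_bool (_ && _))%:R).
by apply/eqP/eqP => [<-|->]; rewrite f3.
Qed.

(** For [x] incoming, contracting the cubic form at [x] and [g x] gives the Kronecker delta of [g x]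
    and [f x], which differ. For a triangle away from [k], contracting at [x] leaves [et (f x)],
    supported on arrows that do not end at [k], unlike the first arrow of a composite. *)
Lemma coord0_kill x u : \sum_v cyc_coef W [:: u; v] * coord0 v x = 0.
Proof.
rewrite sum_Qm [X in _ + X]big1 ?addr0 => [|a _]; last by rewrite (premut_quad_r _ _).1 mul0r.
case: u => [[a|bc]|a].
- rewrite [X in X + _]big1 ?add0r => [|b _]; last by rewrite premut_quad_kk mul0r.
  rewrite /=; case: (classP x) => [_ _ _|e|_]; try by rewrite big1 // => bc _; rewrite mulr0.
  under eq_bigr => bc _ do rewrite premut_quad_kc.
  rewrite (sum_composite (G := fun b c => cyc_coef S [:: val a; b; c] * (th b x * th c (g x)))).
    by rewrite contract_bc (negbTE (gperm_neq barP f x)) mul0r.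
  move=> b c [] h.
    case: (eqVneq (th b x) 0) => [->|/thS[_ h']]; first by rewrite mul0r mulr0.
    by case: h; rewrite h'.
  case: (eqVneq (th c (g x)) 0) => [->|/thS[h' _]]; first by rewrite !mulr0.
  by case: h; rewrite h' s_gperm.
- rewrite [X in _ + X]big1 ?addr0 => [|b _]; last by rewrite premut_quad_cc mul0r.
  rewrite /=; case: (classP x) => [e1 e2 e3|_|_]; try by rewrite big1 // => a _; rewrite mulr0.
  under eq_bigr => a _ do rewrite premut_quad_ck.
  rewrite (sum_kept (G := fun a => cyc_coef S [:: a; (val bc).1; (val bc).2] * th a x)).
    rewrite contract_a; case: (eqVneq (et (f x) (val bc).1) 0) => [->|/etS[_ h]].
      by rewrite mul0r.
    by case: e3; rewrite h (composite_ends bc).2.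
  move=> a h; case: (eqVneq (th a x) 0) => [->|/thS[h1 h2]]; first by rewrite mulr0.
  by case: h; rewrite ?h1 ?h2.
- by rewrite !big1 ?addr0 // => b _; rewrite (premut_quad_r _ _).2 mul0r.
Qed.

Lemma vec0_coord0 x x' : \sum_u vec0 x u * coord0 u x' = (x == x')%:R.
Proof.
rewrite sum_Qm.
have -> : \sum_(a : KK) vec0 x (kept_arr a) * coord0 (kept_arr a) x' = (other x && (x == x'))%:R.
  rewrite /=; case Ex: (other x) => /=; last by rewrite big1 // => a _; rewrite mul0r.
  case E: (other x'); last first.
    rewrite big1 => [|a _]; last by rewrite mulr0.
    by case: eqP => // e; move: E; rewrite -e Ex.
  case: (classP x) Ex => // e1 e2 e3 _.
  rewrite (sum_kept (G := fun a => et x a * th a x')) ?et_th // => a h.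
  case: (eqVneq (et x a) 0) => [->|/etS[h1 h2]]; first by rewrite mul0r.
  by case: h; rewrite -?h1 -?h2.
have -> : \sum_(ab : CC) vec0 x (comp_arr ab) * coord0 (comp_arr ab) x' = (incoming x && (x == x'))%:R.
  rewrite /=; case Ex: (incoming x) => /=; last by rewrite big1 // => a _; rewrite mul0r.
  case E: (incoming x'); last first.
    rewrite big1 => [|a _]; last by rewrite mulr0.
    by case: eqP => // e'; move: E; rewrite -e' Ex.
  case: (classP x) Ex => // e _.
  rewrite (sum_composite (G := fun a b => et x a * et (g x) b * (th a x' * th b (g x')))).
    transitivity (\sum_a et x a * th a x' * \sum_b et (g x) b * th b (g x')).
      by apply: eq_bigr => a _; rewrite big_distrr; apply: eq_bigr => b _ /=; ring.
    rewrite -big_distrl /= !et_th -natrM mulnb.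
    by case: eqP => [->|]; rewrite // eqxx.
  move=> a b [] h.
    case: (eqVneq (et x a) 0) => [->|/etS[_ h']]; first by rewrite !mul0r.
    by case: h; rewrite -h'.
  case: (eqVneq (et (g x) b) 0) => [->|/etS[h' _]]; first by rewrite mulr0 mul0r.
  by case: h; rewrite -h' s_gperm.
have -> : \sum_(a : RR) vec0 x (rev_arr a) * coord0 (rev_arr a) x' = (dualized x && (x == x'))%:R.
  rewrite /=; case Ex: (dualized x) => /=; last by rewrite big1 // => a _; rewrite mul0r.
  case E: (dualized x'); last first.
    rewrite big1 => [|a _]; last by rewrite mulr0.
    by case: eqP => // e'; move: E; rewrite -e' Ex.
  case: (classP x) Ex => // e _.
  rewrite (sum_reversed (G := fun a => th a (f (f x)) * et (f (f x')) a)) => [|a h1 h2].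
    under eq_bigr => a _ do rewrite mulrC.
    rewrite et_th; congr ((nat_of_bool _)%:R).
    by rewrite !(inj_eq (f_inj fP)) eq_sym.
  case: (eqVneq (th a (f (f x))) 0) => [->|/thS[h3 h4]]; first by rewrite mul0r.
  by case: e => e; [case: h2; rewrite h4 f3 | case: h1; rewrite h3].
by case: (classP x) => /= *; rewrite ?add0r ?addr0.
Qed.

Lemma th_expand (F : arrow Q -> K) a : \sum_x th a x * \sum_a' et x a' * F a' = F a.
Proof.
rewrite -[RHS](sum_delta_sym a F); under [RHS]eq_bigr => a' _ do rewrite -th_et big_distrl.
rewrite [RHS]exchange_big; apply: eq_bigr => x _; rewrite big_distrr.
by apply: eq_bigr => a' _ /=; ring.
Qed.

Lemma vec0_sum_other (F : arrow Qm -> K) x : other x ->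
  \sum_u vec0 x u * F u = \sum_(a : KK) et x (val a) * F (kept_arr a).
Proof.
move=> Ex; rewrite sum_Qm /= Ex; case: (classP x) Ex => // e1 e2 e3 _.
by rewrite [X in _ + X + _]big1 ?[X in _ + X]big1 ?addr0 // => a _; rewrite mul0r.
Qed.
Lemma vec0_sum_incoming (F : arrow Qm -> K) x : incoming x ->
  \sum_u vec0 x u * F u = \sum_(ab : CC) et x (val ab).1 * et (g x) (val ab).2 * F (comp_arr ab).
Proof.
move=> Ex; rewrite sum_Qm /= Ex; case: (classP x) Ex => // e1 _.
by rewrite [X in X + _ + _]big1 ?[X in _ + X]big1 ?addr0 ?add0r // => a _; rewrite mul0r.
Qed.
Lemma vec0_sum_dualized (F : arrow Qm -> K) x : dualized x ->
  \sum_u vec0 x u * F u = \sum_(a : RR) th (val a) (f (f x)) * F (rev_arr a).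
Proof.
move=> Ex; rewrite sum_Qm /= Ex; case: (classP x) Ex => // e1 _.
by rewrite [X in X + _ + _]big1 ?[X in _ + X + _]big1 ?addr0 ?add0r // => a _; rewrite mul0r.
Qed.

(** With [coord0_kill] this shows that the vectors [coord0^~ x] span the kernel of the quadratic
    part: in an element of the kernel, the coordinates that [coord0] leaves out vanish. *)
Lemma coord0_vec0 (Pa : arrow Qm -> K) : (forall w, \sum_u cyc_coef W [:: w; u] * Pa u = 0) ->
  forall v, \sum_x coord0 v x * \sum_u vec0 x u * Pa u = Pa v.
Proof.
move=> hP; case=> [[a|ab]|a].
(* Extension by zero to all arrows of [Q], where the dual frames live. *)
- pose F a' := oapp (fun b : KK => Pa (kept_arr b)) 0 (insub a').
  have FE (b : KK) : F (val b) = Pa (kept_arr b) by rewrite /F valK.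
  have F0 b : src b = k \/ tgt b = k -> F b = 0.
    by move=> h; rewrite /F insubF //; case: h => ->; rewrite eqxx ?andbF.
  have EK (G : arrow Q -> K) : \sum_(b : KK) G (val b) * Pa (kept_arr b) = \sum_b G b * F b.
    rewrite -(sum_kept (G := fun b => G b * F b)) => [|b h]; last by rewrite F0 ?mulr0.
    by apply: eq_bigr => b _; rewrite FE.
  pose E x := \sum_b et x b * F b.
  (* The kernel equations at the composites, contracted with [th] at [f x] and [f (f x)], kill the
     coordinate of the side opposite to [k]. *)
  have Eopp x : s (f (f x)) = k -> E x = 0.
    move=> hx.
    have z b c : \sum_a' cyc_coef S [:: a'; b; c] * F a' * (th b (f x) * th c (f (f x))) = 0.
      case: (eqVneq (th b (f x)) 0) => [->|/thS[_ tb]].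
        by rewrite big1 // => a' _; rewrite mul0r mulr0.
      case: (eqVneq (th c (f (f x))) 0) => [->|/thS[sc _]].
        by rewrite big1 // => a' _; rewrite !mulr0.
      have hbc : (tgt b == k) && (src c == k) by rewrite tb sc hx eqxx.
      have := hP (comp_arr (exist _ (b, c) hbc)); rewrite sum_Qm.
      rewrite [X in _ + X + _]big1 => [|? _]; last by rewrite premut_quad_cc mul0r.
      rewrite [X in _ + X]big1 => [|? _]; last by rewrite (premut_quad_r _ _).1 mul0r.
      rewrite !addr0; under eq_bigr => a' _ do rewrite premut_quad_ck.
      rewrite (EK (fun a' => cyc_coef S [:: a'; b; c])) => h.
      by rewrite -big_distrl /= h mul0r.
    rewrite /E; transitivity (\sum_a' (\sum_b \sum_c
        cyc_coef S [:: a'; b; c] * (th b (f x) * th c (f (f x)))) * F a').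
      by apply: eq_bigr => a' _; rewrite contract_bc eqxx mul1r f3.
    under eq_bigr => a' _ do rewrite big_distrl.
    rewrite exchange_big big1 // => b _.
    under eq_bigr => a' _ do rewrite big_distrl.
    rewrite exchange_big big1 // => c _; rewrite -[RHS](z b c).
    by apply: eq_bigr => a' _ /=; ring.
  rewrite -FE -(th_expand F); apply: eq_bigr => x _ /=.
  case: (boolP (other x)) => Ex.
    by rewrite vec0_sum_other // (EK (et x)).
  rewrite mul0r; case: (eqVneq (th (val a) x) 0) => [->|/thS[e1 e2]]; first by rewrite mul0r.
  have /andP[/eqP h1 /eqP h2] := valP a.
  rewrite [X in _ * X]Eopp ?mulr0 //; move: Ex; case: (classP x) => // [e|[e|//]] _.
    by case: h2; rewrite e2.
  by case: h1; rewrite e1.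
- pose F a' b' := oapp (fun ab : CC => Pa (comp_arr ab)) 0 (insub (a', b')).
  have FE (cd : CC) : F (val cd).1 (val cd).2 = Pa (comp_arr cd).
    by rewrite /F -surjective_pairing valK.
  have F0 b c : tgt b <> k \/ src c <> k -> F b c = 0.
    by move=> h; rewrite /F insubF //; case: h => /eqP/negbTE /= ->; rewrite ?andbF.
  have EC (G : arrow Q -> arrow Q -> K) :
      \sum_(bc : CC) G (val bc).1 (val bc).2 * Pa (comp_arr bc) = \sum_b \sum_c G b c * F b c.
    rewrite -(sum_composite (G := fun b c => G b c * F b c)) => [|b c h].
      by apply: eq_bigr => b _; rewrite FE.
    by rewrite F0 ?mulr0.
  pose E x y := \sum_b et x b * \sum_c et y c * F b c.
  (* The kernel equations at the kept arrows, contracted with [th] at [f (f x)], kill the composites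
     that run inside a triangle. *)
  have Eout x : s (f x) = k -> E x (f x) = 0.
    move=> hx.
    have z a' : \sum_b \sum_c cyc_coef S [:: a'; b; c] * F b c * th a' (f (f x)) = 0.
      case: (eqVneq (th a' (f (f x))) 0) => [->|/thS[sa ta]].
        by rewrite big1 // => b _; rewrite big1 // => c _; rewrite mulr0.
      have ha : (src a' != k) && (tgt a' != k).
        rewrite sa ta f3 -hx; apply/andP; split; apply/eqP; first exact: (s_f_neq barP fP).
        by move=> h; apply: (s_f_neq barP fP (x := x)).
      have := hP (kept_arr (exist _ a' ha)); rewrite sum_Qm.
      rewrite [X in X + _ + _]big1 => [|? _]; last by rewrite premut_quad_kk mul0r.
      rewrite [X in _ + X]big1 => [|? _]; last by rewrite (premut_quad_r _ _).1 mul0r.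
      rewrite addr0 add0r; under eq_bigr => bc _ do rewrite premut_quad_kc.
      rewrite (EC (fun b c => cyc_coef S [:: a'; b; c])) => h.
      under eq_bigr => b _ do rewrite -big_distrl.
      by rewrite -big_distrl /= h mul0r.
    transitivity (\sum_b \sum_c (\sum_a' cyc_coef S [:: a'; b; c] * th a' (f (f x))) * F b c).
      apply: eq_bigr => b _; rewrite big_distrr; apply: eq_bigr => c _ /=.
      by rewrite contract_a !f3 mulrA.
    under eq_bigr => b _ do under eq_bigr => c _ do rewrite big_distrl.
    under eq_bigr => b _ do rewrite exchange_big.
    rewrite exchange_big big1 // => a' _; rewrite -[RHS](z a').
    by apply: eq_bigr => b _; apply: eq_bigr => c _ /=; ring.
  have <- : \sum_x th (val ab).1 x * \sum_y th (val ab).2 y * E x y = Pa (comp_arr ab).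
    rewrite -FE -(th_expand (F^~ (val ab).2)); apply: eq_bigr => x _; congr (_ * _).
    under [RHS]eq_bigr => a' _ do rewrite -(th_expand (F a')) big_distrr.
    rewrite [RHS]exchange_big; apply: eq_bigr => y _; rewrite big_distrr /=.
    by apply: eq_bigr => a' _ /=; ring.
  have [c1 c2] := composite_ends ab.
  apply: eq_bigr => x _ /=; case: (eqVneq (th (val ab).1 x) 0) => [->|/thS[e1 e2]].
    by rewrite !mul0r if_same !mul0r.
  have hx : incoming x by rewrite /incoming -e2 c2.
  rewrite hx vec0_sum_incoming // -mulrA; congr (_ * _).
  (* Besides [g x], only [f x] starts where [x] ends, and its term is killed by [Eout]. *)
  rewrite (bigD1 (g x)) //= [X in _ = _ + X]big1 ?addr0 => [|y hy].
    congr (_ * _); rewrite (EC (fun b c => et x b * et (g x) c)).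
    by apply: eq_bigr => b _; rewrite big_distrr; apply: eq_bigr => c _ /=; ring.
  case: (eqVneq (th (val ab).2 y) 0) => [->|/thS[e3 _]]; first by rewrite mul0r.
  have : s (f x) = s y by rewrite -e2 c2 -e3.
  case/(s_eqP barP) => ey; last by rewrite ey eqxx in hy.
  by rewrite ey Eout ?mulr0 //; exact/eqP.
- pose F a' := oapp (fun b : RR => Pa (rev_arr b)) 0 (insub a').
  have FE (b : RR) : F (val b) = Pa (rev_arr b) by rewrite /F valK.
  have F0 b : src b <> k -> tgt b <> k -> F b = 0.
    by move=> /eqP h1 /eqP h2; rewrite /F insubF // (negbTE h1) (negbTE h2).
  rewrite -FE.
  have <- : \sum_y et y (val a) * \sum_b th b y * F b = F (val a).
    rewrite -[RHS](sum_deltal (val a) F).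
    under [RHS]eq_bigr => b _ do rewrite -th_et big_distrl.
    rewrite [RHS]exchange_big; apply: eq_bigr => y _; rewrite big_distrr.
    by apply: eq_bigr => b _ /=; ring.
  rewrite [RHS](reindex_inj (f_inj fP)) [RHS](reindex_inj (f_inj fP)).
  apply: eq_bigr => x _ /=; case: (boolP (dualized x)) => Ex.
    congr (_ * _); rewrite vec0_sum_dualized //.
    rewrite -(sum_reversed (G := fun b => th b (f (f x)) * F b)) => [|b h1 h2].
      by apply: eq_bigr => b _; rewrite FE.
    by rewrite F0 ?mulr0.
  rewrite mul0r; case: (eqVneq (et (f (f x)) (val a)) 0) => [->|/etS[e1 e2]].
    by rewrite mul0r.
  move: Ex; rewrite /dualized e1 -[in s x](f3 x) e2 orbC.
  by have := valP a => /= ->.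
Qed.

Lemma flipP : triangulation_perm bar f'.
Proof. exact: flip_perm. Qed.

Lemma coord0_sum_other (F : arrow Qm -> K) x : other x ->
  \sum_u coord0 u x * F u = \sum_(a : KK) th (val a) x * F (kept_arr a).
Proof.
move=> Ex; rewrite sum_Qm /= Ex; case: (classP x) Ex => // e1 e2 e3 _.
by rewrite [X in _ + X + _]big1 ?[X in _ + X]big1 ?addr0 // => a _; rewrite mul0r.
Qed.
Lemma coord0_sum_incoming (F : arrow Qm -> K) x : incoming x ->
  \sum_u coord0 u x * F u = \sum_(ab : CC) th (val ab).1 x * th (val ab).2 (g x) * F (comp_arr ab).
Proof.
move=> Ex; rewrite sum_Qm /= Ex; case: (classP x) Ex => // e1 _.
by rewrite [X in X + _ + _]big1 ?[X in _ + X]big1 ?addr0 ?add0r // => a _; rewrite mul0r.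
Qed.
Lemma coord0_sum_dualized (F : arrow Qm -> K) x : dualized x ->
  \sum_u coord0 u x * F u = \sum_(a : RR) et (f (f x)) (val a) * F (rev_arr a).
Proof.
move=> Ex; rewrite sum_Qm /= Ex; case: (classP x) Ex => // e1 _.
by rewrite [X in X + _ + _]big1 ?[X in _ + X + _]big1 ?addr0 ?add0r // => a _; rewrite mul0r.
Qed.

Lemma sum_th_kept (F : arrow Q -> K) x : other x ->
  \sum_(a : KK) th (val a) x * F (val a) = \sum_a th a x * F a.
Proof.
move=> Ex; apply: (sum_kept (G := fun a => th a x * F a)) => a h.
case: (eqVneq (th a x) 0) => [->|/thS[h1 h2]]; first by rewrite mul0r.
by move: Ex; case: (classP x) => // n1 n2 _ _; case: h; rewrite ?h1 ?h2.
Qed.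

(** * The cubic form of the premutation in the coordinates of the flip *)

Definition cubic0 x y z := contract3 (fun u v t => cyc_coef W [:: u; v; t])
  (coord0^~ x) (coord0^~ y) (coord0^~ z).

Lemma cubic0_rot x y z : cubic0 x y z = cubic0 y z x.
Proof. by apply: contract3_rot => a b c; apply: cyc_coef3_rot. Qed.

Lemma premut_cubic_composable u v t : cyc_coef W [:: u; v; t] != 0 ->
  [/\ tgt u = src v, tgt v = src t & tgt t = src u].
Proof.
move=> /(cyc_coef_cycle premut_pot) /=; rewrite andbT.
by move=> /and3P[/eqP h1 /eqP h2 /eqP h3].
Qed.

Lemma cubic0_supp x y z : cubic0 x y z != 0 ->
  [/\ s (f' x) = s y, s (f' y) = s z & s (f' z) = s x].
Proof.
case/contract3_neq0 => u [v [t [/coord0_supp[u1 u2] /coord0_supp[v1 v2] /coord0_supp[t1 t2]]]].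
by case/premut_cubic_composable => e1 e2 e3; rewrite -u2 -v2 -t2 e1 e2 e3.
Qed.

Lemma cubic0_other x y z : other x -> other y -> other z ->
  cubic0 x y z = ((y == f x) && (z == f y))%:R.
Proof.
move=> Ex Ey Ez; rewrite -contract_abc /cubic0 /contract3 coord0_sum_other //.
rewrite -(sum_th_kept _ Ex); apply: eq_bigr => a _; congr (_ * _).
rewrite coord0_sum_other // -(sum_th_kept _ Ey); apply: eq_bigr => b _; congr (_ * _).
rewrite coord0_sum_other // -(sum_th_kept _ Ez); apply: eq_bigr => c _; congr (_ * _).
exact: premut_cubic_kkk.
Qed.

(** Only the added terms [[ab] b* a*] join a composite to two reversed arrows. Their coefficients
    are Kronecker deltas, so [th] meets [et] twice and duality applies. *)
Lemma cubic0_incoming x y z : incoming x -> dualized y -> dualized z ->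
  cubic0 x y z = ((y == f (g x)) && (z == f x))%:R.
Proof.
move=> Ex Ey Ez; rewrite /cubic0 /contract3 coord0_sum_incoming //.
have inner (ab : CC) : \sum_v coord0 v y * \sum_t coord0 t z * cyc_coef W [:: comp_arr ab; v; t] =
    et (f (f y)) (val ab).2 * et (f (f z)) (val ab).1.
  have [e1 e2] := composite_ends ab.
  rewrite coord0_sum_dualized //.
  transitivity (\sum_(b : RR) et (f (f y)) (val b) * ((val b == (val ab).2)%:R * et (f (f z)) (val ab).1)).
    apply: eq_bigr => b _; congr (_ * _); rewrite coord0_sum_dualized //.
    under eq_bigr => a _ do rewrite premut_cubic_crr.
    rewrite (sum_reversed (G := fun a => et (f (f z)) a *
      ((val b == (val ab).2) && (a == (val ab).1))%:R)) => [|a h1 h2].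
      rewrite -[in RHS](sum_deltal (val ab).1 (et (f (f z)))) big_distrr.
      by apply: eq_bigr => a _ /=; rewrite -mulnb natrM; ring.
    by case: eqP => [_|]; case: eqP => [e|]; rewrite ?mulr0 //; case: h2; rewrite e.
  rewrite (sum_reversed (G := fun b => et (f (f y)) b * ((b == (val ab).2)%:R * et (f (f z)) (val ab).1))).
    rewrite -[et _ (val ab).2](sum_deltal (val ab).2 (et (f (f y)))) big_distrl.
    by apply: eq_bigr => b _ /=; ring.
  move=> b h1 h2; case: eqP => [e|]; last by rewrite mul0r mulr0.
  by case: h1; rewrite e.
under eq_bigr => ab _ do rewrite inner.
rewrite (sum_composite (G := fun a b => th a x * th b (g x) * (et (f (f y)) b * et (f (f z)) a))).
  transitivity (\sum_a et (f (f z)) a * th a x * \sum_b et (f (f y)) b * th b (g x)).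
    by apply: eq_bigr => a _; rewrite big_distrr; apply: eq_bigr => b _ /=; ring.
  rewrite -big_distrl /= !et_th -natrM mulnb andbC.
  have e u v : (f (f u) == v) = (u == f v) by rewrite -(inj_eq (f_inj fP)) f3.
  by rewrite !e.
move=> a b [] h.
  case: (eqVneq (th a x) 0) => [->|/thS[_ h']]; first by rewrite !mul0r.
  by case: h; rewrite h'; apply/eqP.
case: (eqVneq (th b (g x)) 0) => [->|/thS[h' _]]; first by rewrite mulr0 mul0r.
by case: h; rewrite h' (s_gperm barP) //; apply/eqP.
Qed.

(** A reversed arrow occurs only in the added terms, hence only beside a composite and another
    reversed arrow. *)
Lemma cubic0_mixed x y z : dualized z -> ~~ (incoming x && dualized y) ->
  ~~ (incoming y && dualized x) -> cubic0 x y z = 0.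
Proof.
move=> Ez n1 n2; apply: contract3_eq0 => u v t.
have Ez' : other z = false /\ incoming z = false by case: (classP z) Ez.
case: t => [[t|t]|t] /=; rewrite ?Ez'.1 ?Ez'.2 ?eqxx // => hu hv _.
apply: premut_cubic_mixed => //=; case: u hu => [[a|a]|a] //=; case: v hv => [[b|b]|b] //=.
  by case: ifP n1 => [_ /=|_ _]; [case: ifP => // _ _ | rewrite ?eqxx //]; rewrite ?eqxx.
by case: ifP n2 => [_ /=|_ _]; [case: ifP => // _ _ | rewrite ?eqxx //]; rewrite ?eqxx.
Qed.

Lemma other_f x : other x -> other (f x).
Proof. by rewrite /other f3 andbC -andbA. Qed.

(** The endpoints force [y = g (g x)]. If [z] were [g y], they would also force [x = g z]; then [x],
    [g x], [y], [z] would be all arrows, but [f x] is none of them. *)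
Lemma cubic0_quartic x y z : incoming x -> other y -> other z -> cubic0 x y z != 0 ->
  y = g (g x) /\ z = f y.
Proof.
move=> Ex Ey Ez /cubic0_supp[].
case: (classP y) (Ey) => // y1 y2 y3 _; case: (classP z) (Ez) => // z1 z2 z3 _.
rewrite (flip_in barP fP (eqP Ex)) flip_other // flip_other // => h1 h2 h3.
have ey : y = g (g x).
  case: (s_eqP barP h1) => // e; case: y3; rewrite e f3 (s_gperm barP) //; exact/eqP.
split=> //; case: (s_eqP barP h2) => [//|ez].
case: (s_eqP barP h3) => ex; first by case: z3; rewrite -ex; apply/eqP.
have gP t : [\/ t = x, t = g x, t = y | t = z].
  apply: (@gperm_ind _ _ _ fP (fun t => [\/ t = x, t = g x, t = y | t = z]) x).
    by constructor 1.
  move=> u [] ->; [constructor 2|constructor 3|constructor 4|constructor 1] => //.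
case: (gP (f x)) => e.
- by have := tperm_fN fP x; rewrite e eqxx.
- by have := gperm_neq barP f x; rewrite e eqxx.
- by case: y1; rewrite -e; apply/eqP.
- by case: z1; rewrite -e; apply/eqP.
Qed.

(* [cubic0 x (g (g x)) (f (g (g x)))] is the coefficient of the only 4-cycle through
   [k] that contributes to the cubic part without being a triangle; it is removed
   by subtracting a multiple of the arrow [quartic_arrow x], which is parallel to
   the new arrow [x]. *)
Definition quartic_coef x : K :=
  if incoming x && other (g (g x)) then cubic0 x (g (g x)) (f (g (g x))) else 0.
Definition quartic_arrow x := f (f (g (g x))).

Lemma quartic_coefP x : quartic_coef x != 0 ->
  [/\ incoming x, other (quartic_arrow x), s (quartic_arrow x) = s x &
    s (f' (quartic_arrow x)) = s (f' x)].
Proof.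
rewrite /quartic_coef; case: ifP => [/andP[Ex Ey]|]; rewrite ?eqxx // => h.
have Ez := other_f Ey; have Ew := other_f Ez.
have [h1 h2 h3] := cubic0_supp h; split=> //.
  by rewrite -h3 flip_other //; case: (classP (f (g (g x)))) Ez.
case: (classP (quartic_arrow x)) Ew => // e1 e2 e3 _.
by rewrite flip_other // /quartic_arrow f3 h1.
Qed.

Definition coord1 (u : arrow Qm) x := coord0 u x - quartic_coef x * coord0 u (quartic_arrow x).

Lemma coord1_supp u x : coord1 u x != 0 -> src u = s x /\ tgt u = s (f' x).
Proof.
rewrite /coord1; case: (eqVneq (coord0 u x) 0) => [->|/coord0_supp//].
rewrite sub0r oppr_eq0 => /neq0_mul[/quartic_coefP[_ _ <- <-]].
exact: coord0_supp.
Qed.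

Definition cubic1 x y z := contract3 (fun u v t => cyc_coef W [:: u; v; t])
  (coord1^~ x) (coord1^~ y) (coord1^~ z).

Lemma cubic1_rot x y z : cubic1 x y z = cubic1 y z x.
Proof. by apply: contract3_rot => a b c; apply: cyc_coef3_rot. Qed.

Lemma cubic1_supp x y z : cubic1 x y z != 0 ->
  [/\ s (f' x) = s y, s (f' y) = s z & s (f' z) = s x].
Proof.
case/contract3_neq0 => u [v [t [/coord1_supp[u1 u2] /coord1_supp[v1 v2] /coord1_supp[t1 t2]]]].
by case/premut_cubic_composable => e1 e2 e3; rewrite -u2 -v2 -t2 e1 e2 e3.
Qed.

Lemma quartic_coef_incoming x : ~~ incoming x -> quartic_coef x = 0.
Proof. by rewrite /quartic_coef => /negbTE ->. Qed.

Lemma coord1_nincoming x : ~~ incoming x -> coord1^~ x =1 coord0^~ x.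
Proof. by move=> h u; rewrite /coord1 quartic_coef_incoming // mul0r subr0. Qed.

(** Otherwise [g x] and [y] would form a 2-cycle. So a cyclically composable triple has at most one
    incoming arrow, and the correction in [coord1] enters [cubic1] linearly. *)
Lemma incoming_next x y : incoming x -> s (f' x) = s y -> ~~ incoming y.
Proof.
move=> Ex; rewrite (flip_in barP fP (eqP Ex)) => h; apply/negP => /eqP Ey.
by apply: (no_two_cycle barP fP h); rewrite Ey (s_gperm barP) // (eqP Ex).
Qed.

Definition tri x y z : K := ((y == f' x) && (z == f' y))%:R.

Lemma tri_rot x y z : tri x y z = tri y z x.
Proof.
rewrite /tri; congr ((nat_of_bool _)%:R); apply/andP/andP => -[/eqP-> /eqP->].
  by rewrite (tperm_f3 flipP) !eqxx.
by rewrite (tperm_f3 flipP) !eqxx.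
Qed.

Lemma tri_supp x y z : tri x y z != 0 ->
  [/\ s (f' x) = s y, s (f' y) = s z & s (f' z) = s x].
Proof.
rewrite /tri; case: (y =P f' x) => [->|_]; last by rewrite eqxx.
case: (z =P _) => [->|_]; last by rewrite eqxx.
by rewrite (tperm_f3 flipP).
Qed.

Lemma nincoming_class x : ~~ incoming x -> other x || dualized x.
Proof. by case: (classP x). Qed.

(** At the quartic triple, [quartic_arrow x], [y], [z] is a triangle away from [k], where [cubic0]
    is 1, and the subtraction cancels [quartic_coef x]. Elsewhere the correction term vanishes and
    [cubic0] decides. *)
Lemma cubic1_incoming x y z : incoming x -> s (f' x) = s y -> s (f' z) = s x ->
  cubic1 x y z = tri x y z.
Proof.
move=> Ex hxy hzx; have ny := incoming_next Ex hxy.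
have nz : ~~ incoming z by apply/negP => Ez; have := incoming_next Ez hzx; rewrite Ex.
have -> : cubic1 x y z = cubic0 x y z - quartic_coef x * cubic0 (quartic_arrow x) y z.
  rewrite -contract3_subl; apply: eq_contract3 => //; exact: coord1_nincoming.
have dfg : dualized (f (g x)) by rewrite /dualized f3 (s_gperm barP) // (eqP Ex) eqxx orbT.
have dfx : dualized (f x) by rewrite /dualized (eqP Ex) eqxx.
have f'x : f' x = f (g x) by rewrite (flip_in barP fP (eqP Ex)).
have f'fg : f' (f (g x)) = f x.
  by rewrite (flip_opp barP fP) f3 ?(bar_gperm barP) // (s_gperm barP) //; apply/eqP.
have triE : tri x y z = ((y == f (g x)) && (z == f x))%:R.
  by rewrite /tri f'x; case: (y =P _) => // ->; rewrite f'fg.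
have q0 : dualized y || dualized z -> quartic_coef x * cubic0 (quartic_arrow x) y z = 0.
  case: (eqVneq (quartic_coef x) 0) => [->|/quartic_coefP[_ Ew _ _]]; first by rewrite mul0r.
  have nw : ~~ incoming (quartic_arrow x) /\ ~~ dualized (quartic_arrow x) by case: (classP _) Ew.
  case/orP => h; first by rewrite cubic0_rot cubic0_rot cubic0_mixed ?mulr0 ?(negbTE nw.1) ?andbF ?(negbTE nz).
  by rewrite cubic0_mixed ?mulr0 ?(negbTE nw.1) ?(negbTE ny).
case/orP: (nincoming_class ny) => Ey; case/orP: (nincoming_class nz) => Ez.
- have -> : tri x y z = 0.
    by rewrite triE; case: eqP => //= e; move: Ey dfg; rewrite -e; case: (classP y).
  have [/andP[/eqP ey /eqP ez]|ne] := boolP ((y == g (g x)) && (z == f y)).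
    have qa : quartic_arrow x = f (f y) by rewrite /quartic_arrow -ey.
    rewrite /quartic_coef Ex -ey Ey ez qa [cubic0 (f (f y)) _ _]cubic0_other ?other_f //.
    by rewrite f3 !eqxx /= mulr1 subrr.
  have -> : cubic0 x y z = 0.
    apply/eqP; apply: contraNT ne => /(cubic0_quartic Ex Ey Ez)[e1 e2].
    by apply/andP; split; apply/eqP.
  case: (eqVneq (quartic_coef x) 0) => [->|/quartic_coefP[_ Ew _ _]]; first by rewrite mul0r subrr.
  by rewrite cubic0_other // /quartic_arrow f3 (negbTE ne) mulr0 subrr.
- rewrite q0 ?Ez ?orbT // subr0 cubic0_mixed //.
  + by rewrite triE; case: eqP => //= e; move: Ey dfg; rewrite -e; case: (classP y).
  + by move: Ey; case: (classP y) => //; rewrite andbF.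
  + by move: Ey; case: (classP y).
- rewrite q0 ?Ey // subr0 cubic0_rot cubic0_rot cubic0_mixed //.
  + rewrite triE; case: (z =P f x) => [e|]; rewrite ?andbF //.
    by move: Ez dfx; rewrite -e; case: (classP z).
  + by rewrite (negbTE nz).
  + by move: Ez; case: (classP z) => //; rewrite andbF.
- by rewrite q0 ?Ey // subr0 cubic0_incoming.
Qed.

Lemma dualized_tri x : dualized x -> incoming (f' x) \/ incoming (f' (f' x)).
Proof.
case/orP => /eqP e; rewrite /incoming.
  by left; rewrite (flip_out _ _ e) f3 e.
by right; rewrite (flip_opp barP fP e) (flip_out _ _ (_ : s (bar (f (f x))) = k))
  ?(s_bar barP) // f3 (s_bar barP) // e.
Qed.

Lemma cubic1_tri x y z : cubic1 x y z = tri x y z.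
Proof.
have [h|h] : [/\ s (f' x) = s y, s (f' y) = s z & s (f' z) = s x] \/
    (cubic1 x y z = 0 /\ tri x y z = 0).
- have [h|/cubic1_supp] := eqVneq (cubic1 x y z) 0; last by left.
  have [h'|/tri_supp] := eqVneq (tri x y z) 0; last by left.
  by right.
- case: h => h1 h2 h3.
  case Ex: (incoming x); first exact: cubic1_incoming.
  case Ey: (incoming y); first by rewrite cubic1_rot tri_rot; apply: cubic1_incoming.
  case Ez: (incoming z); first by rewrite -cubic1_rot -tri_rot; apply: cubic1_incoming.
  have -> : cubic1 x y z = cubic0 x y z by apply: eq_contract3; apply: coord1_nincoming; rewrite ?Ex ?Ey ?Ez.
  (* By [dualized_tri], a triangle of the flip with a dualized arrow contains an incoming one, and
     here there is none. *)
  have dual0 t : t \in [:: x; y; z] -> dualized t -> tri x y z = 0.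
    rewrite !inE /tri => ht Et; case: eqP => // ey; case: eqP => //= ez; exfalso.
    case: (dualized_tri Et); case/or3P: ht => /eqP->;
      by rewrite ?ez ?ey ?(tperm_f3 flipP) -?ey -?ez ?Ex ?Ey ?Ez.
  case/orP: (nincoming_class (negbT Ez)) => Oz; last first.
    by rewrite (dual0 z) ?inE ?eqxx ?orbT // cubic0_mixed ?Ex ?Ey.
  case/orP: (nincoming_class (negbT Ey)) => Oy; last first.
    by rewrite (dual0 y) ?inE ?eqxx ?orbT // cubic0_rot cubic0_rot cubic0_mixed ?Ex ?Ez.
  case/orP: (nincoming_class (negbT Ex)) => Ox; last first.
    by rewrite (dual0 x) ?inE ?eqxx ?orbT // cubic0_rot cubic0_mixed ?Ey ?Ez.
  rewrite cubic0_other // /tri.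
  have -> : f' x = f x by rewrite flip_other //; case: (classP x) Ox.
  by have -> : f' y = f y by rewrite flip_other //; case: (classP y) Oy.
- by rewrite h.1 h.2.
Qed.

(** By [coord0_kill] the coordinates factor through [P] and so live on the arrows of [Q']; [vec0] is
    pushed forward by [P], and [coord0_vec0] with [vec0_coord0] makes the two dual. The change by
    [quartic_coef] then brings the cubic form to the triangles of the flip. *)
Theorem premutation_compatible (Qt Q' : quiver V) (St : cpath_alg K Qt) (S' : cpath_alg K Q') :
  is_potential St -> trivial_qp St -> is_potential S' -> reduced_qp S' ->
  right_equiv W (dsum_pot St S') ->
  exists (th' : arrow Q' -> X -> K) (et' : X -> arrow Q' -> K), compatible s f' S' th' et'.
Proof.
move=> St_pot St_triv S'_pot S'_red hW.
have [P [Pi [Ps [Pis [Pk [Pxi [PiP Pcub]]]]]]] :=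
  reduction premutation_loopless premut_ord St_pot St_triv S'_pot S'_red hW.
pose th0 a x := \sum_v Pi a v * coord0 v x.
pose et0 x a := \sum_u vec0 x u * P u a.
have Pth0 u x : \sum_a P u a * th0 a x = coord0 u x.
  by apply: (Pxi (coord0^~ x)) => w; apply: coord0_kill.
have th0_supp a x : th0 a x != 0 -> src a = s x /\ tgt a = s (f' x).
  case: (boolP [forall v, Pi a v * coord0 v x == 0]) => [/forallP h|].
    by rewrite /th0 big1 ?eqxx // => v _; apply/eqP.
  by case/forallPn => v /neq0_mul[/Pis[-> ->] /coord0_supp].
have et0_supp x a : et0 x a != 0 -> s x = src a /\ s (f' x) = tgt a.
  case: (boolP [forall u, vec0 x u * P u a == 0]) => [/forallP h|].
    by rewrite /et0 big1 ?eqxx // => u _; apply/eqP.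
  by case/forallPn => u /neq0_mul[/vec0_supp[-> ->] /Ps].
have dual0 : dual_frames th0 et0.
  split=> [a a'|x x'].
    rewrite -PiP; under eq_bigr => x _ do rewrite /th0 big_distrl.
    rewrite exchange_big; apply: eq_bigr => v _.
    rewrite -[in RHS](coord0_vec0 (Pk^~ a')) big_distrr.
    by apply: eq_bigr => x _ /=; rewrite mulrA.
  rewrite -vec0_coord0; under eq_bigr => a _ do rewrite /et0 big_distrl.
  rewrite exchange_big; apply: eq_bigr => u _.
  rewrite -[in RHS]Pth0 big_distrr.
  by apply: eq_bigr => a _ /=; rewrite mulrA.
have dual := frame_change dual0 (A := incoming) (l := quartic_coef) (w := quartic_arrow).
eexists; eexists; split; last first.
- apply: (frame_cubic (D := fun a b c => cyc_coef S' [:: a; b; c])); first apply: dual.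
    move=> x /quartic_coefP[-> Ew _ _]; by case: (classP _) Ew.
  move=> x y z; rewrite -/(tri x y z) -cubic1_tri /cubic1.
  transitivity (contract3 (fun a b c => contract3 (fun u v t => cyc_coef W [:: u; v; t])
    (P^~ a) (P^~ b) (P^~ c)) (fun a => th0 a x - quartic_coef x * th0 a (quartic_arrow x))
    (fun a => th0 a y - quartic_coef y * th0 a (quartic_arrow y))
    (fun a => th0 a z - quartic_coef z * th0 a (quartic_arrow z))).
    rewrite !contract3_sum; apply: eq_bigr => a _; apply: eq_bigr => b _; apply: eq_bigr => c _.
    rewrite Pcub contract3_sum; congr (_ * _); apply: eq_bigr => u _.
    by apply: eq_bigr => v _; apply: eq_bigr => t _; rewrite mulrC.
  rewrite contract3_pull.
  have Pth x' u : \sum_a P u a * (th0 a x' - quartic_coef x' * th0 a (quartic_arrow x')) = coord1 u x'.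
    rewrite /coord1 -!Pth0 big_distrr -sumrB; apply: eq_bigr => a _ /=; ring.
  by apply: eq_contract3 => u.
- by apply: dual => x /quartic_coefP[-> Ew _ _]; case: (classP _) Ew.
- move=> x a; case: (eqVneq (et0 x a) 0) => [->|/et0_supp//]; rewrite add0r.
  case: (boolP [forall y, (quartic_arrow y == x)%:R * (quartic_coef y * et0 y a) == 0]) => [/forallP h|].
    by rewrite big1 ?eqxx // => y _; apply/eqP.
  case/forallPn => y; case: (quartic_arrow y =P x) => [<-|_]; last by rewrite mul0r eqxx.
  by move=> /neq0_mul[_ /neq0_mul[/quartic_coefP[_ _ -> ->] /et0_supp]].
- move=> a x; case: (eqVneq (th0 a x) 0) => [->|/th0_supp//].
  rewrite sub0r oppr_eq0 => /neq0_mul[/quartic_coefP[_ _ <- <-]]; exact: th0_supp.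
Qed.
End Premutation.

(** * Potentials of once-punctured surfaces *)

Section Nondegeneracy.
Variables (K : fieldType) (V X : finType) (s : X -> V) (bar : X -> X).
Hypothesis barP : bar_spec s bar.

(** Only the cubic part of a mutated potential is under control, so the induction ranges over all
    [f], [Q] and [S] at once. *)
Theorem compatible_nondegenerate ks (f : X -> X) (Q : quiver V) (S : cpath_alg K Q) th et :
  triangulation_perm bar f -> compatible s f S th et -> is_potential S ->
  nondegenerate_along ks S.
Proof.
elim: ks f Q S th et => [|k ks IH] f Q S th et fP Sc Sp /=.
  by split=> //; apply: (compatible_acyclic barP fP Sc).
split; first exact: (compatible_acyclic barP fP Sc).
move=> Q' S' [_ [S0 [Qt [St [[p0 e0 k0] [pt tt p' r' re]]]]]].
have e0' w : cyc_coef S0 w = cyc_coef S w by apply/esym/cyc_equiv_coef.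
have [th' [et' Sc']] := premutation_compatible barP fP Sc p0 e0' k0 pt tt p' r' re.
exact: (IH _ _ _ _ _ (flip_perm barP fP k) Sc' p').
Qed.

End Nondegeneracy.

(** * The triangulation quiver of a surface and its potentials *)

Section Surface.
Local Open Scope ring_scope.
Variables (T : triangulation).
Local Notation Q := (adj_quiver T).
Local Notation X := (arrow (adj_quiver T)).
Implicit Types a c x y : X.

(** Each arc is a side exactly twice: this makes the [pick] in [adj_bar] succeed and its result
    unique. *)
Lemma adj_barP : bar_spec (@src _ Q) (@adj_bar T).
Proof.
have key (x : X) : exists2 y, y != x & forall z : X, (src x == src z) = (z == x) || (z == y).
  have /eqP/cards2P[u [v [uv e]]] := sideP (src x).
  have mem (z : X) : (src x == src z) = (z == (u : X)) || (z == (v : X)).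
    by have := in_set2 (z : triangle T * 'Z_3) u v; rewrite -e inE eq_sym.
  have := mem x; rewrite eqxx => /esym/orP[]/eqP ex.
    by exists v; rewrite ex ?(eq_sym v) // => z; rewrite -ex mem ex.
  by exists u; rewrite ex // => z; rewrite -ex mem ex orbC.
have barE x : adj_bar x != x /\ src (adj_bar x) = src x.
  rewrite /adj_bar; case: pickP => [y /andP[/eqP e ne] //|h].
  have [y ne e] := key x; have := h y.
  by rewrite ne andbT eq_sym e eqxx orbT.
split=> [x|x y]; first by case: (barE x).
have [z ne e] := key x; have [n1 n2] := barE x.
have -> : adj_bar x = z by move: (e (adj_bar x)); rewrite n2 eqxx (negbTE n1) => /esym/eqP.
exact: e.
Qed.

Lemma Z3_add3 (i : 'Z_3) : i + 1 + 1 + 1 = i.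
Proof. by rewrite -!addrA; apply: val_inj; case: i => [[|[|[|]]]]. Qed.
Lemma Z3_add1 (i : 'Z_3) : i + 1 != i.
Proof. by case: i => [[|[|[|]]]]. Qed.

Hypothesis hT : closed_once_punctured T.

Lemma adj_f3 x : adj_f (adj_f (adj_f x)) = x.
Proof. by case: x => t i; rewrite /adj_f /= Z3_add3. Qed.

Lemma adj_g_inj : injective (@adj_g T).
Proof.
apply: (@inj_comp _ _ _ (@adj_bar T) (@adj_f T)); first exact: can_inj (barK adj_barP).
by move=> x y e; rewrite -(adj_f3 x) -(adj_f3 y) e.
Qed.

Lemma adj_g_conn x y : fconnect (@adj_g T) x y.
Proof.
have [_ h] := hT; rewrite /num_punctures in h.
have sym := fconnect_sym adj_g_inj.
have /card1P[r hr] : #|predI (froots (@adj_g T)) (mem predT)| == 1%N by apply/eqP/h.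
have root_r z : froot (@adj_g T) z = r.
  by apply/eqP; have := hr (froot (@adj_g T) z); rewrite !inE (roots_root sym) => <-.
by rewrite -(root_connect sym) !root_r.
Qed.

Lemma adj_fP : triangulation_perm (@adj_bar T) (@adj_f T).
Proof.
split; [exact: adj_f3 | | exact: adj_g_conn].
by case=> t i; rewrite /adj_f xpair_eqE eqxx /= Z3_add1.
Qed.

Lemma src_adj_g x : src (adj_g x) = tgt x.
Proof. exact: (s_gperm adj_barP). Qed.

Lemma composable_f x : @composable _ Q x (adj_f x).
Proof. exact/eqP. Qed.
Lemma composable_g x : @composable _ Q x (adj_g x).
Proof. exact/eqP/esym/src_adj_g. Qed.

Lemma adj_order x : order (@adj_g T) x = #|{: X}|.
Proof. by apply: eq_card => y; rewrite !inE; apply: adj_g_conn. Qed.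

(** A triangle has three arrows, and [bar x] is a fourth: it has the source of [x], which [f x] and
    [f (f x)] avoid. *)
Lemma card_arrows : (0 < #|{: X}|)%N -> (4 <= #|{: X}|)%N.
Proof.
move=> /card_gt0P[x _].
have fN := tperm_fN adj_fP; have sf y := @s_f_neq _ _ _ _ adj_barP _ adj_fP y.
have sff y := @s_ff_neq _ _ _ _ adj_barP _ adj_fP y.
have bs y := s_bar adj_barP y.
suff u : uniq [:: x; adj_f x; adj_f (adj_f x); adj_bar x].
  by rewrite -[4%N]/(size [:: x; adj_f x; adj_f (adj_f x); adj_bar x]) -(card_uniqP u) max_card.
rewrite /= !inE !negb_or !andbT; do !(apply/andP; split).
- by rewrite eq_sym.
- by apply/eqP => e; apply: (sff x); rewrite -e.
- by rewrite eq_sym adj_barP.1.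
- by rewrite eq_sym.
- by apply/eqP => e; apply: (sf x); rewrite e bs.
- by apply/eqP => e; apply: (sff x); rewrite e bs.
Qed.

Variable K : fieldType.
Variable b : X.
Let N := #|{: X}|.

Lemma N_ge4 : (4 <= N)%N.
Proof. by apply: card_arrows; apply/card_gt0P; exists b. Qed.

Lemma iter_adj_g x : iter N (@adj_g T) x = x.
Proof. by rewrite /N -(adj_order x) iter_order //; apply: adj_g_inj. Qed.

Lemma iter_adj_gM m x : iter (m * N) (@adj_g T) x = x.
Proof. by elim: m => // m IH; rewrite mulSn iterD IH iter_adj_g. Qed.

Lemma omega_exp m :
  omega K b ^+ m = \prod_(a <- traject (@adj_g T) b (m * N)) arr K a.
Proof.
elim: m => [|m IH]; first by rewrite big_nil.
rewrite exprS IH mulSn trajectD iter_adj_g big_cat /=; congr (_ * _).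
by rewrite /omega /orbit adj_order.
Qed.

Lemma traject_cycle m x : (0 < m)%N ->
  cycle (@composable _ Q) (traject (@adj_g T) x (m * N)).
Proof.
move=> m0; have := N_ge4; have := iter_adj_gM m x.
have : (0 < m * N)%N by rewrite muln_gt0 m0 (leq_trans _ N_ge4).
case: (m * N)%N => // n _ hn _.
rewrite /= rcons_path; apply/andP; split.
  by elim: n {hn} x => [//|n IH] x; rewrite /= composable_g; apply: IH.
by rewrite last_traject -[X in composable _ X]hn; apply: composable_g.
Qed.

Variable p : nat -> K.
Hypothesis p0 : p 0%N = 0.

Lemma series_omega_ord : ord_ge N (series_eval p (omega K b)).
Proof.
move=> w hw; rewrite /series_eval big1 // => -[[|m] hm] _ /=; first by rewrite p0 mul0r.
rewrite [X in _ * X](_ : _ = 0) ?mulr0 // omega_exp.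
have := @ord_ge_prod K _ Q (traject (@adj_g T) b (m.+1 * N)); rewrite size_traject; apply.
by apply: leq_trans hw _; rewrite mulSn leq_addr.
Qed.

Variable R : {set X}.
Hypothesis hR : f_representatives R.

Definition triangles : cpath_alg K Q :=
  \sum_(a in R) arr K a * arr K (adj_f a) * arr K (adj_f (adj_f a)).

Lemma triangle_prod a : arr K a * arr K (adj_f a) * arr K (adj_f (adj_f a)) =
  \prod_(c <- [:: a; adj_f a; adj_f (adj_f a)]) arr K c.
Proof. by rewrite !big_cons big_nil mulr1 mulrA. Qed.

Lemma triangle_cycle a : cycle (@composable _ Q) [:: a; adj_f a; adj_f (adj_f a)].
Proof.
by rewrite /= !composable_f -[X in composable _ X]adj_f3 composable_f.
Qed.

Lemma triangles_potential : is_potential triangles.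
Proof.
apply: big_ind => [w||a _]; [by rewrite eqxx | exact: is_potentialD |].
rewrite triangle_prod; exact/potential_prod/triangle_cycle.
Qed.

Lemma surface_potential_potential : is_potential (surface_potential R b p).
Proof.
apply: is_potentialD; last exact: triangles_potential.
move=> w; rewrite -[X in X != 0]/(- series_eval p (omega K b) w) oppr_eq0 => h.
apply: contrapT => hw; case/eqP: h; apply: big1 => -[[|m] hm] _ /=.
  by rewrite p0 mul0r.
rewrite omega_exp; case: (eqVneq ((\prod_(a <- traject (@adj_g T) b (m.+1 * N)) arr K a) w) 0).
  by move=> ->; rewrite mulr0.
move=> h; case: hw; apply: (potential_prod _ (traject_cycle b (ltn0Sn m))) h.
rewrite -size_eq0 size_traject -lt0n muln_gt0 /=; exact: leq_trans N_ge4.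
Qed.

Lemma fconnect_adj_f a x :
  fconnect (@adj_f T) a x = (x == a) || (x == adj_f a) || (x == adj_f (adj_f a)).
Proof.
apply/idP/idP => [/iter_findex <-|].
  elim: (findex _ _ _) => [|n]; first by rewrite eqxx.
  by case/orP=> [/orP[]|] /eqP e; rewrite iterS e ?adj_f3 eqxx ?orbT.
case/orP=> [/orP[]|] /eqP ->; rewrite ?connect0 ?fconnect1 //.
exact: connect_trans (fconnect1 _ _) (fconnect1 _ _).
Qed.

Lemma cyc_coef_triangle r a a' c :
  cyc_coef (arr K r * arr K (adj_f r) * arr K (adj_f (adj_f r)) : cpath_alg K Q) [:: a; a'; c] =
  ((a' == adj_f a) && (c == adj_f a'))%:R *
    ((r == a)%:R + (r == adj_f a)%:R + (r == adj_f (adj_f a))%:R).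
Proof.
rewrite triangle_prod cyc_coef_prod ?triangle_cycle // !big_ord_recl big_ord0 addr0 addrA /=.
rewrite /rot /= !eqseq_cons !andbT.
have -> : ((a == r) && ((a' == adj_f r) && (c == adj_f (adj_f r)))) =
    ((a' == adj_f a) && (c == adj_f a')) && (r == a).
  apply/idP/idP => [/and3P[/eqP-> /eqP-> /eqP->]|]; first by rewrite !eqxx.
  by case/andP => /andP[/eqP-> /eqP->] /eqP->; rewrite !eqxx.
have -> : ((a' == r) && ((c == adj_f r) && (a == adj_f (adj_f r)))) =
    ((a' == adj_f a) && (c == adj_f a')) && (r == adj_f a).
  apply/idP/idP => [/and3P[/eqP-> /eqP-> /eqP->]|]; first by rewrite adj_f3 !eqxx.
  by case/andP => /andP[/eqP-> /eqP->] /eqP->; rewrite adj_f3 !eqxx.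
have -> : ((c == r) && ((a == adj_f r) && (a' == adj_f (adj_f r)))) =
    ((a' == adj_f a) && (c == adj_f a')) && (r == adj_f (adj_f a)).
  apply/idP/idP => [/and3P[/eqP-> /eqP-> /eqP->]|]; first by rewrite adj_f3 !eqxx.
  by case/andP => /andP[/eqP-> /eqP->] /eqP->; rewrite adj_f3 !eqxx.
by rewrite -!mulnb !natrM; ring.
Qed.

Lemma sum_representatives a :
  \sum_(r in R) ((r == a)%:R + (r == adj_f a)%:R + (r == adj_f (adj_f a))%:R) = 1 :> K.
Proof.
transitivity (#|[set x in R | fconnect (@adj_f T) a x]|%:R : K); last by rewrite hR.
rewrite -sum1_card natr_sum (eq_bigl (fun x => (x \in R) && fconnect (@adj_f T) a x)); last first.
  by move=> x; rewrite inE.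
rewrite big_mkcondr /=; apply: eq_bigr => r _; rewrite fconnect_adj_f.
have fN := tperm_fN adj_fP.
case: (r =P a) => [->|_] /=.
  rewrite [a == _]eq_sym (negbTE (fN a)) -[X in (X == adj_f (adj_f a))]adj_f3.
  by rewrite (negbTE (fN _)) !addr0.
case: (r =P adj_f a) => [->|_] /=; last by case: (r == _); rewrite ?add0r ?addr0.
by rewrite [adj_f a == _]eq_sym (negbTE (fN _)) add0r addr0.
Qed.

Lemma surface_cubic a a' c : cyc_coef (surface_potential R b p) [:: a; a'; c] =
  ((a' == adj_f a) && (c == adj_f a'))%:R.
Proof.
rewrite cyc_coefD (@ord_ge_cyc_coef _ _ _ 4) ?add0r //; last first.
  by apply/ord_geN/(ord_geS N_ge4)/series_omega_ord.
rewrite cyc_coef_sum; under eq_bigr => r _ do rewrite cyc_coef_triangle.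
by rewrite -big_distrr /= sum_representatives mulr1.
Qed.

Lemma surface_compatible : compatible (@src _ Q) (@adj_f T) (surface_potential R b p)
  (fun a x => (a == x)%:R) (fun x a => (x == a)%:R).
Proof.
split=> [a x|x a||a a' c].
- by case: (a =P x) => [-> //|]; rewrite eqxx.
- by case: (x =P a) => [-> //|]; rewrite eqxx.
- by split=> x x'; rewrite sum_delta_sym.
rewrite surface_cubic -[LHS]mul1r.
transitivity (\sum_x (x == a)%:R * ((adj_f x == a')%:R * (adj_f (adj_f x) == c)%:R : K)).
  rewrite sum_deltal mul1r -mulnb natrM ![adj_f _ == _]eq_sym.
  by case: (a' =P _) => [->//|]; rewrite !mul0r.
by apply: eq_bigr => x _; rewrite mulrA.
Qed.

Theorem surface_nondegenerate : nondegenerate_qp (surface_potential R b p).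
Proof.
split; first exact: surface_potential_potential.
move=> ks; apply: (compatible_nondegenerate adj_barP _ adj_fP surface_compatible).
exact: surface_potential_potential.
Qed.

End Surface.

(** * Jacobian algebras *)

Section JacobianIdeal.
Local Open Scope ring_scope.
Variables (K : fieldType) (V : finType) (Q : quiver V) (S : cpath_alg K Q).
Notation A := (cpath_alg K Q).
Notation J := (jacobian_algebra S).
Local Open Scope quotient_scope.
Implicit Types x y z u v : A.
Local Notation I := (ideal_gen (range (@cyc_deriv K V Q ^~ S))).

Lemma cyc_deriv_trivial a q : ord_ge 2 S -> plength q = 0%N -> cyc_deriv a S q = 0.
Proof.
move=> S2 /eqP; rewrite size_eq0 => /eqP e.
rewrite /cyc_deriv /plength e big_ord_recl big_ord0 addr0 /=.
set w := (_, _); case: (boolP (is_path w)) => [h|h]; last exact: coef_nonpath.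
rewrite -[w]/(pstart (word_path h), parrows (word_path h)) coef_qpath.
by apply: S2; rewrite -[plength _]/(size w.2) /w /=.
Qed.

(** Membership in the ideal up to order [d]; required for all [d], it is membership in the
    closure. *)
Definition ideal_mod d x := exists z, I z /\ ord_ge d (x - z).

Lemma ideal_mod_ord d x : ord_ge d x -> ideal_mod d x.
Proof. by move=> h; exists 0; split; [exact: ideal_gen0 | rewrite subr0]. Qed.

Lemma ideal_modS d e x : (e <= d)%N -> ideal_mod d x -> ideal_mod e x.
Proof. by move=> h [z [Iz hz]]; exists z; split=> //; apply: ord_geS hz. Qed.

Lemma ideal_modD d x y : ideal_mod d x -> ideal_mod d y -> ideal_mod d (x + y).
Proof.
move=> [z [Iz hz]] [t [It ht]]; exists (z + t); split; first exact: ideal_genD.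
by rewrite opprD addrACA; apply: ord_geD.
Qed.

Lemma ideal_modM d e f u x v : ord_ge e u -> ord_ge f v -> ideal_mod d x ->
  ideal_mod (e + d + f) (u * x * v).
Proof.
move=> hu hv [z [Iz hz]]; exists (u * z * v); split.
  exact/ideal_genMr/ideal_genMl.
by rewrite -mulrBl -mulrBr; apply: ord_geM => //; apply: ord_geM.
Qed.

Lemma ideal_modMM d u x v : ideal_mod d x -> ideal_mod d (u * x * v).
Proof. by move=> h; have := @ideal_modM d 0 0 u x v; rewrite add0n addn0; apply. Qed.

Lemma ideal_modZ d (k : K) x : ideal_mod d x -> ideal_mod d (k *: x).
Proof.
move=> [z [Iz hz]]; exists (k *: z); split; last by rewrite -scalerBr; apply: ord_geZ.
by rewrite -[z]mul1r cpa_scalerAl; apply: ideal_genMl.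
Qed.

Lemma ideal_mod_sum d T (r : seq T) (P : pred T) (F : T -> A) :
  (forall i, P i -> ideal_mod d (F i)) -> ideal_mod d (\sum_(i <- r | P i) F i).
Proof.
by move=> h; apply: big_ind => //; [exact: ideal_mod_ord | exact: ideal_modD].
Qed.

Lemma ideal_mod_deriv d a : ideal_mod d (cyc_deriv a S).
Proof.
exists (cyc_deriv a S); split; last by rewrite subrr.
exists 1%N, (fun=> 1), (fun=> 1), (fun=> cyc_deriv a S); split; first by move=> _; exists a.
by rewrite big_ord1 mul1r mulr1.
Qed.

Lemma ideal_mod_closure x : (forall d, ideal_mod d x) -> jacobian_ideal S x.
Proof.
move=> h d; have [z [Iz hz]] := h d; exists z => // p hp.
by apply/eqP; rewrite -subr_eq0 -cpa_subE hz.
Qed.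

(** Successive approximation: if words of length at least [n] can be pushed up one degree modulo the
    ideal, so can all elements of order at least [n], and the closure absorbs the limit. *)
Lemma ideal_mod_words n :
  (forall w, (n <= size w)%N -> sorted (@composable V Q) w ->
    ideal_mod (size w).+1 (\prod_(a <- w) arr K a)) -> (0 < n)%N ->
  forall x, ord_ge n x -> jacobian_ideal S x.
Proof.
move=> hw n0.
have step l x : (n <= l)%N -> ord_ge l x -> ideal_mod l.+1 x.
  move=> nl hx; rewrite -[x](subrK (hcomp l x)).
  apply: ideal_modD; first exact/ideal_mod_ord/ord_ge_subhcomp/hx/(leq_trans n0).
  apply: ideal_mod_sum => t _; case: (eqVneq (wcoef x t) 0) => [->|/wcoef_sorted h].
    by rewrite scale0r; apply: ideal_mod_ord.
  by apply: ideal_modZ; rewrite -{1}(size_tuple t); apply: hw; rewrite ?size_tuple.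
move=> x hx; apply: ideal_mod_closure => d; apply: (@ideal_modS (n + d)); first exact: leq_addl.
elim: d => [|d [z [Iz hz]]]; first by rewrite addn0; apply: ideal_mod_ord.
rewrite addnS -[x](subrK z); apply: ideal_modD.
  by apply: step hz; apply: leq_addr.
by exists z; rewrite subrr.
Qed.

(** At [q], a product [u * d * v] sees the derivative [d] only through its values at subpaths of
    [q]. *)
Lemma jacobian_ideal_coef (q : qpath Q) :
  (forall a i j, cyc_deriv a S (ptake j (pdrop i q)) = 0) ->
  forall x, jacobian_ideal S x -> x q = 0.
Proof.
move=> h x /(_ (plength q).+1) [y [n [u [v [g [hg ->]]]]] ->] //.
rewrite cpa_sum big1 // => i _; have [a _ <-] := hg i.
rewrite -mulrA cpa_mulE big1 // => j _; rewrite cpa_mulE [X in _ * X]big1 ?mulr0 // => l _.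
by rewrite h mul0r.
Qed.

Lemma jac_piE0 x : (\pi_J x == 0) = jac_mem S x.
Proof.
have -> : (0 : J) = \pi_J 0 by rewrite piE.
by apply/eqP/idP => [/jac_piE|h]; [|apply/jac_piE]; rewrite subr0.
Qed.

Lemma jac_pi_prod (s : seq A) : \prod_(x <- s) (\pi_J x : J) = \pi_J (\prod_(x <- s) x).
Proof.
elim: s => [|x s IH]; first by rewrite !big_nil.
by rewrite !big_cons IH; apply: jac_piM.
Qed.

Definition nil2_product n := exists l : seq J,
  [/\ size l = n, forall x : J, x \in l -> x * x = 0 & \prod_(x <- l) x != 0].

Lemma nil2_product_word (w : seq (arrow Q)) : (forall a : arrow Q, src a <> tgt a) ->
  w != [::] -> sorted (@composable V Q) w ->
  (forall q, parrows q = w -> forall x, jacobian_ideal S x -> x q = 0) ->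
  nil2_product (size w).
Proof.
move=> noloop wne ws hw; exists [seq (\pi_J (arr K a) : J) | a <- w]; split.
- by rewrite size_map.
- move=> _ /mapP[a _ ->]; rewrite [LHS]jac_piM.
  suff -> : arr K a * arr K a = 0 by rewrite piE.
  apply/funext => p; have := @prod_arrE K V Q [:: a; a] p isT.
  rewrite !big_cons big_nil mulr1 => ->; case: eqP => // e.
  have := sorted_parrows p; rewrite e /= /composable /= andbT => /eqP /esym.
  by move/noloop.
- rewrite (_ : \prod_(x <- _) x = \pi_J (\prod_(a <- w) arr K a)); last first.
    by rewrite -(big_map (arr K (Q := Q)) xpredT id) -jac_pi_prod !big_map.
  rewrite jac_piE0; apply/negP => /asboolP hx.
  case: w wne ws hw hx => // a w _ ws hw hx.
  have hp : is_path (src a, a :: w) by rewrite is_path_cons.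
  have := hw (word_path hp) erefl _ hx; rewrite prod_arrE // /parrows /= eqxx.
  by move/eqP; rewrite oner_eq0.
Qed.

(** The Jacobian ideal has no constant terms, so at a trivial path the coefficient of a
    representative of a square-zero element squares to zero in the field. Representatives thus have
    order at least one, and a product of [n] of them has order at least [n]. *)
Lemma nil2_product_bound n : ord_ge 2 S ->
  (forall x, ord_ge n x -> jacobian_ideal S x) -> ~ nil2_product n.
Proof.
move=> S2 hn [l [sl l2 /negP]]; apply.
have J1 x : jacobian_ideal S x -> ord_ge 1 x.
  move=> hx p; rewrite ltnS leqn0 /plength size_eq0 => /eqP hp.
  apply: (jacobian_ideal_coef _ hx) => a i j.
  have e : parrows (ptake j (pdrop i p)) = [::] by rewrite parrows_take parrows_drop hp.
  by apply: cyc_deriv_trivial; rewrite // /plength e.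
have r1 (x : J) : x \in l -> ord_ge 1 (repr x).
  move=> /l2 hx p hp; have : jac_mem S (repr x * repr x).
    by rewrite -jac_piE0 -[\pi_J _]/(x * x) hx.
  move=> /asboolP/J1/(_ p hp); rewrite cpa_mulE.
  move: (hp); rewrite ltnS leqn0 => /eqP e; rewrite e big_ord_recl big_ord0 addr0 /=.
  have tp : ptake 0 p = p by rewrite -[X in ptake X]e ptake_size.
  by rewrite pdrop0 tp => /eqP; rewrite mulf_eq0 orbb => /eqP.
have -> : \prod_(t <- l) t = \pi_J (\prod_(x <- [seq repr t | t <- l]) x).
  rewrite -jac_pi_prod !big_map; apply: eq_bigr => t _; by rewrite reprK.
rewrite jac_piE0; apply/asboolP/hn; rewrite -sl big_map.
elim: l {sl l2} r1 => [|x l IH] r1 p //.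
rewrite big_cons /=; apply: (@ord_geM _ _ _ 1); first by apply: r1; rewrite inE eqxx.
by apply: IH => y hy; apply: r1; rewrite inE hy orbT.
Qed.

End JacobianIdeal.

Lemma nil2_product_iso (K : fieldType) (V V' : finType) (Q : quiver V) (Q' : quiver V')
    (S : cpath_alg K Q) (S' : cpath_alg K Q') n :
  jacobian_iso S S' -> nil2_product S n <-> nil2_product S' n.
Proof.
move=> [f [[h fK hK] _]]; split=> -[l [sl l2 lp]].
  exists (map f l); split; first by rewrite size_map.
    by move=> _ /mapP[x /l2 hx ->]; rewrite -rmorphM hx rmorph0.
  by rewrite big_map -rmorph_prod -(rmorph0 f) (inj_eq (can_inj fK)).
exists (map h l); split; first by rewrite size_map.
  by move=> _ /mapP[x /l2 hx ->]; apply: (can_inj fK); rewrite rmorphM hK hx rmorph0.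
rewrite big_map -(inj_eq (can_inj fK)) rmorph0 rmorph_prod.
by rewrite (eq_bigr id) // => x _; rewrite hK.
Qed.

(** * Vanishing and survival of long paths in the Jacobian algebras *)

Section SurfaceJacobian.
Local Open Scope ring_scope.
Variable T : triangulation.
Hypothesis hT : closed_once_punctured T.
Variables (K : fieldType) (R : {set arrow (adj_quiver T)}).
Hypothesis hR : f_representatives R.
Variable b : arrow (adj_quiver T).
Local Notation Q := (adj_quiver T).
Local Notation X := (arrow (adj_quiver T)).
Local Notation f := (@adj_f T).
Local Notation g := (@adj_g T).
Local Notation N := #|{: X}|.
Local Notation path_elt s := (\prod_(a <- s) arr K (Q := Q) a).
Implicit Types (a c : X) (p : nat -> K).

Lemma adj_loopless a : src a <> tgt a.
Proof. by move/esym; apply: (s_f_neq (adj_barP T) (adj_fP hT)). Qed.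

Lemma adj_g_neq_f a : g a != f a.
Proof. exact: gperm_neq (adj_barP T) _ _. Qed.

Lemma series_omega_ge p m : (forall i, (i < m)%N -> p i = 0) ->
  ord_ge (m * N) (series_eval p (omega K b)).
Proof.
move=> hp w hw; rewrite /series_eval big1 // => -[i hi] _ /=.
case: (ltnP i m) => him; first by rewrite hp // mul0r.
rewrite [X in _ * X](_ : _ = 0) ?mulr0 // (omega_exp hT).
have := @ord_ge_prod K _ Q (traject g b (i * N)); rewrite size_traject; apply.
by apply: leq_trans hw _; rewrite leq_mul2r him orbT.
Qed.

Lemma series_omegaX m : (0 < m)%N ->
  series_eval (power_series_X K m) (omega K b) = path_elt (traject g b (m * N)).
Proof.
move=> m0; have N0 : (0 < N)%N by apply: leq_trans (N_ge4 hT b).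
rewrite -(omega_exp hT); apply/funext => w; rewrite /series_eval.
case: (ltnP m (plength w).+1) => h.
  rewrite (bigD1 (Ordinal h)) //= /power_series_X eqxx mul1r big1 ?addr0 // => i hi.
  rewrite (_ : (nat_of_ord i == m) = false) ?mul0r //.
  by apply: contraNF hi => /eqP e; apply/eqP/val_inj.
rewrite big1 => [|i _]; last first.
  by rewrite /power_series_X ltn_eqF ?mul0r // (leq_trans (ltn_ord i)).
rewrite (omega_exp hT); apply/esym.
have := @ord_ge_prod K _ Q (traject g b (m * N)); rewrite size_traject; apply.
by apply: leq_trans h _; rewrite leq_pmulr.
Qed.

Lemma triangles_ord : ord_ge 3 (triangles K R).
Proof.
apply: ord_ge_sum => a _; rewrite triangle_prod.
exact: (@ord_ge_prod K _ Q [:: a; f a; f (f a)]).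
Qed.

Lemma surface_ord p : p 0%N = 0 -> ord_ge 3 (surface_potential R b p).
Proof.
move=> p0; apply: ord_geD; last exact: triangles_ord.
by apply/ord_geN/(@ord_geS _ _ _ N)/series_omega_ord => //; apply: leq_trans (N_ge4 hT b).
Qed.

Lemma cyc_coef_triangles a (w : seq X) :
  cyc_coef (triangles K R) (a :: w) = (w == [:: f a; f (f a)])%:R.
Proof.
case: (eqVneq (size w) 2) => [|hw].
  case: w => [|a' [|c []]] //= _; rewrite cyc_coef_sum.
  under eq_bigr => r _ do rewrite cyc_coef_triangle.
  rewrite -big_distrr /= (sum_representatives hT K hR) mulr1 !eqseq_cons andbT.
  by case: (a' =P f a) => [->|].
rewrite (_ : (w == _) = false); last by apply: contraNF hw => /eqP ->.
rewrite cyc_coef_sum big1 // => r _.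
rewrite triangle_prod cyc_coef_prod ?(triangle_cycle r) // big1 // => i _.
case: eqP => // /(congr1 size); rewrite size_rot /= => -[e].
by rewrite e in hw.
Qed.

(** The factor [m] counts the rotations of [a :: w] that start at [b]: a [g]-path of [m * N] arrows
    meets [b] once in each of its [m] turns. This is where the characteristic enters. *)
Lemma cyc_coef_traject m a (w : seq X) : (0 < m)%N ->
  cyc_coef (path_elt (traject g b (m * N))) (a :: w) =
  (w == traject g (g a) (m * N).-1)%:R * m%:R.
Proof.
move=> m0; have N4 := N_ge4 hT b.
have mN0 : (0 < m * N)%N by rewrite muln_gt0 m0 (leq_trans _ N4).
have rotT i c : (i <= m * N)%N ->
    rot i (traject g c (m * N)) = traject g (iter i g c) (m * N).
  move=> hi; rewrite -{1}(subnKC hi) trajectD -{1}(size_traject g c i) rot_size_cat.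
  rewrite -[in RHS](subnK hi) trajectD; congr (_ ++ traject _ _ _).
  by rewrite -iterD subnK // (iter_adj_gM hT).
rewrite cyc_coef_prod ?(traject_cycle hT b) -?size_eq0 ?size_traject -?lt0n //.
case: (w =P _) => [->|ne]; last first.
  rewrite mul0r big1 // => -[i hi'] _ /=; case: eqP => // e; case: ne.
  have hs : size (a :: w) = (m * N)%N by rewrite -(size_rot i) e size_traject.
  have hi : (i <= m * N)%N by rewrite -hs ltnW.
  have {}hi' : (i <= size (a :: w))%N by exact: ltnW.
  have := rotT (m * N - i)%N b (leq_subr _ _); rewrite -e.
  rewrite -[X in rot (X - _) _]hs -(size_rot i) -/(rotr i _) rotK.
  by case: (m * N)%N mN0 => // n _ [-> ->].
rewrite mul1r; have -> : a :: traject g (g a) (m * N).-1 = traject g a (m * N).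
  by case: (m * N)%N mN0.
rewrite size_traject.
have key n c : (\sum_(i < n) (iter i g c == b) = count_mem b (traject g c n))%N.
  elim: n => [|n IH]; first by rewrite big_ord0.
  by rewrite trajectSr -cats1 count_cat big_ord_recr /= IH addn0.
have cN : count_mem b (traject g a N) = 1%N.
  rewrite -(adj_order hT a) -/(orbit g a) count_uniq_mem ?orbit_uniq //.
  by rewrite -fconnect_orbit (adj_g_conn hT).
have cM k : count_mem b (traject g a (k * N)) = k.
  by elim: k => // k IH; rewrite mulSn trajectD count_cat cN (iter_adj_g hT) IH.
rewrite -[in RHS](cM m) -key natr_sum; apply: eq_bigr => i _.
rewrite rotT; last by rewrite ltnW.
congr ((nat_of_bool _)%:R); case: (m * N)%N mN0 i => // n _ i /=.
apply/eqP/eqP => [[]//|->//].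
Qed.

Section Monomial.
Variable m : nat.
Hypothesis m0 : (0 < m)%N.
Hypothesis mK : m%:R != 0 :> K.
Local Notation S := (surface_potential R b (power_series_X K m)).
Local Notation M := (m * N)%N.

Lemma pX0 : power_series_X K m 0 = 0.
Proof. by rewrite /power_series_X ltn_eqF. Qed.

Lemma M_ge4 : (4 <= M)%N.
Proof. by apply: leq_trans (N_ge4 hT b) _; rewrite leq_pmull. Qed.

(** The rotation of [omega ^ m] that starts with [a], without this first letter. *)
Definition g_complement a : cpath_alg K Q := path_elt (traject g (g a) M.-1).

Lemma monomial_deriv a :
  cyc_deriv a S = arr K (f a) * arr K (f (f a)) - m%:R *: g_complement a.
Proof.
have M4 := M_ge4; have pot : is_potential S by apply: (surface_potential_potential hT pX0).
have e2 : arr K (f a) * arr K (f (f a)) = path_elt [:: f a; f (f a)].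
  by rewrite !big_cons big_nil mulr1.
rewrite e2 /g_complement; apply/funext => w; rewrite cpa_subE cpa_scaleE !prod_arrE //; last first.
  by rewrite -size_eq0 size_traject; case: (M) M4 => [|[]].
have [e|ne] := eqVneq (parrows w) [::]; last first.
  rewrite cyc_derivE // cyc_coefD cyc_coef_triangles (series_omegaX m0).
  rewrite -[- _]sub0r cyc_coefB cyc_coef0 sub0r cyc_coef_traject //.
  by rewrite addrC; congr (_ - _); rewrite mulrC.
rewrite e (_ : ([::] == traject g (g a) M.-1) = false); last by case: (M) M4 => [|[|n]].
rewrite mulr0 subr0; apply: cyc_deriv_trivial; last by rewrite /plength e.
exact/(@ord_geS _ _ _ 3 2)/surface_ord/pX0.
Qed.

Local Notation Imod := (@ideal_mod K _ Q S).

Lemma f_pair_mod a : exists c, arr K a * arr K (f a) = cyc_deriv c S + m%:R *: g_complement c.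
Proof.
by exists (f (f a)); rewrite monomial_deriv !adj_f3 subrK.
Qed.

Lemma ord_g_complement a : ord_ge M.-1 (g_complement a).
Proof.
by have := @ord_ge_prod K _ Q (traject g (g a) M.-1); rewrite size_traject.
Qed.

(** Modulo the ideal, two letters are traded for [M - 1], a gain since [M] is at least 4. *)
Lemma f_pair_word (s1 s2 : seq X) a :
  Imod (size s1 + M.-1 + size s2) (path_elt (s1 ++ [:: a, f a & s2])).
Proof.
rewrite big_cat !big_cons /= [arr K a * _]mulrA; have [c ->] := f_pair_mod a.
rewrite mulrA; apply: ideal_modM; rewrite ?ord_ge_prod //; try exact: ord_ge_prod.
apply: ideal_modD; first exact: ideal_mod_deriv.
exact/ideal_mod_ord/ord_geZ/ord_g_complement.
Qed.

(** With [c = g a], the word is the complement of [a] followed by [a] and [c]. As [m] is invertible,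
    the complement can be traded for [f a] and [f (f a)]; then [f (f a)] and [a] are traded for the
    complement of [f a], whose last arrow [d] satisfies [f d = c], so that one more pair can be
    traded. *)
Lemma g_word_mod c : Imod M.+2 (path_elt (traject g c M.+1)).
Proof.
have M4 := M_ge4.
set a := iter M.-1 g c.
have ga : g a = c.
  by rewrite /a -iterS (ltn_predK M4) (iter_adj_gM hT).
have -> : path_elt (traject g c M.+1) = g_complement a * (arr K a * arr K c).
  rewrite /g_complement ga trajectSr -{1}(ltn_predK M4) trajectSr (iter_adj_gM hT) -/a.
  by rewrite -!cats1 -catA big_cat /= !big_cons big_nil mulr1.
have [d fd gd] : exists2 d, f d = c & f a :: traject g (g (f a)) M.-1 =
    f a :: rcons (traject g (g (f a)) M.-2) d.
  (* The predecessor of [f a] under [g]: then [f d = bar (g d) = bar (f a) = g a]. *)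
  exists (iter M.-1 g (f a)).
    have h : g (iter M.-1 g (f a)) = f a by rewrite -iterS (ltn_predK M4) (iter_adj_gM hT).
    exact: etrans (esym (barK (adj_barP T) _)) (etrans (congr1 (@adj_bar T) h) ga).
  by case: (M) M4 => [|[|n]] // _; rewrite [_.-1]/= trajectSr -iterSr.
have -> : g_complement a * (arr K a * arr K c) =
    m%:R^-1 *: ((arr K (f a) * arr K (f (f a)) - cyc_deriv a S) * (arr K a * arr K c)).
  by rewrite monomial_deriv opprB addrC subrK -cpa_scalerAl scalerA mulVf // scale1r.
apply: ideal_modZ; rewrite mulrBl; apply: ideal_modD; last first.
  rewrite -mulNr -scaleN1r -[_ *: _]mul1r; apply: ideal_modMM; exact/ideal_modZ/ideal_mod_deriv.
have -> : arr K (f a) * arr K (f (f a)) * (arr K a * arr K c) =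
    arr K (f a) * (arr K (f (f a)) * arr K a) * arr K c by rewrite !mulrA.
have -> : arr K (f (f a)) * arr K a = cyc_deriv (f a) S + m%:R *: g_complement (f a).
  by rewrite monomial_deriv !adj_f3 subrK.
rewrite mulrDr mulrDl; apply: ideal_modD.
  apply: ideal_modMM; exact: ideal_mod_deriv.
rewrite -cpa_scalerAr -cpa_scalerAl; apply: ideal_modZ.
have -> : arr K (f a) * g_complement (f a) * arr K c =
    path_elt ((f a :: traject g (g (f a)) M.-2) ++ [:: d, f d & [::]]).
  have e : (f a :: traject g (g (f a)) M.-2) ++ [:: d; f d] =
      (f a :: traject g (g (f a)) M.-1) ++ [:: c] by rewrite gd fd /= cat_rcons.
  by rewrite e big_cat big_cons !big_seq1.
(* The order reached is [2 * M - 2], which is at least [M + 2] precisely when [M] is at least 4. *)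
apply: (ideal_modS _ (@f_pair_word _ _ _)); rewrite /= size_traject.
have ar n : (4 <= n -> n.+1 < n.-2.+1 + n.-1 + 0)%N by lia.
exact: ar M4.
Qed.

Lemma word_dichotomy (c : X) (w : seq X) : path (@composable _ Q) c w ->
  (exists s1 a s2, c :: w = s1 ++ [:: a, f a & s2]) \/ c :: w = traject g c (size w).+1.
Proof.
elim: w c => [|a w IH] c /=; first by right.
case/andP=> /eqP hca /IH[[s1 [d [s2 ->]]]|->]; first by left; exists (c :: s1), d, s2.
case: (s_eqP (adj_barP T) (hca : src (f c) = src a)) => [->|e].
  by left; exists [::], c, (traject g (g (f c)) (size w)).
by right; rewrite e.
Qed.

Lemma long_word_mod (w : seq X) : (M < size w)%N -> sorted (@composable _ Q) w ->
  Imod (size w).+1 (path_elt w).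
Proof.
have M4 := M_ge4; case: w => // c w hw ws.
case: (word_dichotomy ws) => [[s1 [a [s2 e]]]|e].
  rewrite e; apply: ideal_modS (f_pair_word s1 s2 a).
  have := hw; rewrite e size_cat /=.
  have ar i j n : (4 <= n -> i + j.+2 < i + n.-1 + j)%N by lia.
  by move=> _; apply: ar.
rewrite e size_traject; set l := (size w).+1.
have hl : (M.+1 <= l)%N by [].
rewrite -(subnKC hl) trajectD big_cat /= -[X in Imod X _](_ : 0 + M.+2 + (l - M.+1) = _)%N; last first.
  by rewrite add0n !addSn.
rewrite -[X in ideal_mod _ _ (X * _)]mul1r; apply: ideal_modM => //; last exact: g_word_mod.
by have := @ord_ge_prod K _ Q (traject g (iter M.+1 g c) (l - M.+1)); rewrite size_traject.
Qed.

Lemma monomial_nilpotent : ~ nil2_product S M.+1.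
Proof.
apply: nil2_product_bound; first exact/(@ord_geS _ _ _ 3 2)/surface_ord/pX0.
by apply: ideal_mod_words => // w hw ws; apply: long_word_mod.
Qed.

End Monomial.

(** No derivative meets a subpath of a short [g]-path: triangles contribute pairs [f a], [f (f a)],
    never consecutive under [g], and [p(omega)] contributes paths of at least [m * N - 1] arrows.
    For [p] zero, every [m] is allowed. *)
Lemma g_words_nonzero p m n : (forall i, (i < m)%N -> p i = 0) -> (0 < m)%N -> (0 < n)%N ->
  (n.+1 < m * N)%N -> nil2_product (surface_potential R b p) n.
Proof.
move=> hp m0 n0 hn; have p0 : p 0%N = 0 by apply: hp.
have pot := @surface_potential_potential T hT K b p p0 R.
rewrite -(size_traject g b n); apply: nil2_product_word.
- exact: adj_loopless.
- by rewrite -size_eq0 size_traject -lt0n.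
- case: n n0 {hn} => //= n _; elim: n b => //= n IH c; by rewrite composable_g IH.
move=> q eq x; apply: jacobian_ideal_coef => a i j.
have S3 := surface_ord p0.
set w := ptake j (pdrop i q).
have [/eqP e|ne] := eqVneq (parrows w) [::].
  apply: cyc_deriv_trivial; first exact: (ord_geS _ S3).
  by apply/eqP; rewrite /plength size_eq0.
have hs : (size (parrows w) <= n)%N.
  rewrite parrows_take parrows_drop eq size_take_min size_drop size_traject.
  by rewrite (leq_trans (geq_minr _ _)) ?leq_subr.
rewrite cyc_derivE // cyc_coefD cyc_coef_triangles (ord_ge_cyc_coef (ord_geN (series_omega_ge hp))) ?add0r.
  case: eqP => // e; exfalso.
  have : sorted (fun x y => y == g x) (parrows w).
    rewrite parrows_take parrows_drop eq; apply/take_sorted/drop_sorted.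
    by case: (n) => //= k; elim: k b => //= k IH c; rewrite eqxx IH.
  by rewrite e /= andbT eq_sym (negbTE (adj_g_neq_f _)).
by rewrite /= (leq_ltn_trans _ hn).
Qed.

End SurfaceJacobian.

Local Open Scope classical_set_scope.

Lemma jacobian_iso_refl (K : fieldType) (V : finType) (Q : quiver V) (S : cpath_alg K Q) :
  jacobian_iso S S.
Proof.
by exists (idfun : {rmorphism jacobian_algebra S -> jacobian_algebra S}); split=> //; exists id.
Qed.

Lemma special_seriesP (K : fieldType) (p : nat -> K) : special_series K p ->
  (forall i, p i = 0%R) \/
  exists m, [/\ (0 < m)%N, (m%:R != 0 :> K)%R & p = power_series_X K m].
Proof.
case=> [->|[m [m0 hm] <-]]; [by left | right; exists m; split=> //].
rewrite natf_neq0_pchar; apply/pnatP => // d pd dm; rewrite inE /=.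
by apply/negP => /hm; rewrite dm.
Qed.

(** * Separating the special series *)

Section NonIsomorphic.
Variables (T : triangulation) (hT : closed_once_punctured T) (K : fieldType).
Variables (R : {set arrow (adj_quiver T)}) (hR : f_representatives R).
Variable b : arrow (adj_quiver T).
Local Notation Pot := (surface_potential R b).

(** At length [m * N + 1] the monomial gives zero, while [p] starts in degree [m + 1] at the
    earliest and keeps [g]-paths up to length [(m + 1) * N - 2], which is larger. *)
Lemma monomial_separated m (p : nat -> K) : (0 < m)%N -> (m%:R != 0 :> K)%R ->
  (forall i, (i <= m)%N -> p i = 0%R) ->
  ~ (nil2_product (Pot p) (m * #|{: arrow (adj_quiver T)}|).+1 <->
     nil2_product (Pot (power_series_X K m)) (m * #|{: arrow (adj_quiver T)}|).+1).
Proof.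
move=> m0 mK hp [h _]; apply: (monomial_nilpotent hT hR m0 mK (b := b)); apply: h.
apply: (g_words_nonzero hT hR b (m := m.+1)) => //.
rewrite mulSn; have ar i j : (4 <= i -> j.+2 < i + j)%N by lia.
exact/ar/(N_ge4 hT b).
Qed.

Lemma special_not_iso (p q : nat -> K) : special_series K p -> special_series K q ->
  p <> q -> ~ jacobian_iso (Pot p) (Pot q).
Proof.
have X0 m i : (i < m)%N -> power_series_X K m i = 0%R.
  by move=> h; rewrite /power_series_X ltn_eqF.
move=> /special_seriesP hp /special_seriesP hq pq iso.
have e n := nil2_product_iso n iso.
case: hp hq => [p0|[m [m0 mK ep]]] [q0|[m' [m'0 m'K eq]]].
- by apply: pq; apply/funext => i; rewrite p0 q0.
- by apply: (monomial_separated m'0 m'K (p := p)) => [i _|]; rewrite ?p0 // -eq.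
- by apply: (monomial_separated m0 mK (p := q)) => [i _|]; rewrite ?q0 // -ep; split=> /e.
- case: (ltngtP m m') => [h|h|h].
  + apply: (monomial_separated m0 mK (p := q)) => [i hi|]; last by rewrite -ep; split=> /e.
    by rewrite eq X0 // (leq_ltn_trans hi).
  + apply: (monomial_separated m'0 m'K (p := p)) => [i hi|]; last by rewrite -eq.
    by rewrite ep X0 // (leq_ltn_trans hi).
  + by apply: pq; rewrite ep eq h.
Qed.

Lemma pchar_multiple : exists c, (0 < c)%N /\ forall d, d \in [pchar K]%R -> (d %| c)%N.
Proof.
have [[c hc]|h] := pselect (exists c, c \in [pchar K]%R); last first.
  by exists 1%N; split=> // d hd; case: h; exists d.
exists c; split; first by apply/prime_gt0/pcharf_prime/hc.
by move=> d; rewrite (pcharf_eq hc) => /eqP ->.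
Qed.

Lemma infinite_special : infinite_set [set Pot p | p in special_series K].
Proof.
have [c [c0 hc]] := pchar_multiple.
(* [c] is a multiple of the characteristic whenever that is positive, so no [m n] is divisible by
   it. *)
pose m n := (c * n).+1.
have spec n : special_series K (power_series_X K (m n)).
  right; exists (m n) => //; split=> // d hd; rewrite /m -addn1 dvdn_addr.
    by rewrite dvdn1; apply/eqP => e; have := pcharf_prime hd; rewrite e.
  by apply: dvdn_mulr; apply: hc.
have Xinj n n' : n <> n' -> power_series_X K (m n) <> power_series_X K (m n').
  move=> ne /(congr1 (fun p => p (m n))); rewrite /power_series_X eqxx.
  case: eqP => [[e]|_]; last by move/eqP; rewrite oner_eq0.
  by move=> _; apply: ne; apply/eqP; rewrite -(eqn_pmul2l c0) e.
move=> fin; apply: infinite_nat.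
apply: (@sub_finite_set _ _ ((fun n => Pot (power_series_X K (m n))) @^-1`
    [set Pot p | p in special_series K])).
  by move=> n _; exists (power_series_X K (m n)).
apply: finite_preimage fin => n n' _ _ e; apply: contrapT => ne.
(* Equal potentials have isomorphic Jacobian algebras, so non-isomorphism yields injectivity. *)
apply: (special_not_iso (spec n) (spec n') (Xinj _ _ ne)); rewrite e.
exact: jacobian_iso_refl.
Qed.

End NonIsomorphic.

Theorem corollary2p17 (K : fieldType) (T : triangulation)
    (hT : closed_once_punctured T)
    (R : {set arrow (adj_quiver T)}) (hR : f_representatives R)
    (b : arrow (adj_quiver T)) :
  (forall p : nat -> K, p 0%N = 0%R -> nondegenerate_qp (surface_potential R b p))
  /\
  [/\ infinite_set [set surface_potential R b p | p in special_series K],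
      forall p, special_series K p -> nondegenerate_qp (surface_potential R b p)
    & forall p q, special_series K p -> special_series K q -> p <> q ->
        ~ jacobian_iso (surface_potential R b p) (surface_potential R b q)].
Proof.
have nondeg (p : nat -> K) : p 0%N = 0%R -> nondegenerate_qp (surface_potential R b p).
  by move=> p0; apply: surface_nondegenerate.
split=> //; split; [exact: (infinite_special hT hR) | | exact: (special_not_iso hT hR)].
move=> p /special_seriesP[p0|[m [m0 _ ->]]]; apply: nondeg => //.
exact: pX0.
Qed.
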